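(* Let $\nu\ge1$ and $\varepsilon\in[0,\infty)$. Then, for all $t>0$, $$\big\|e^{\varepsilon|\cdot|_\varrho/\sqrt t}\,K_{e^{-t\Delta_\nu}}\big\|_{L^1(G_\nu)}\le C,\qquad \big\|e^{\varepsilon|\cdot|_\varrho/\sqrt t}\,|\nabla_\nu K_{e^{-t\Delta_\nu}}|\big\|_{L^1(G_\nu)}\le C\,t^{-1/2},$$ where the constant $C$ depends only on $\varepsilon$ and $\nu$ (not on $t$).
   Context: For real $\nu\ge1$, $G_\nu=[0,\infty)\times\mathbb{R}$ is equipped with the measure $d\bar\mu_\nu(x,u)=x^{\nu-1}\,dx\,du$. Set $L_\nu=-\partial_x^2-\frac{\nu-1}{x}\partial_x$ and $\Delta_\nu=-\partial_u^2+e^{2u}L_\nu$, regarded as a nonnegative self-adjoint operator on $L^2(G_\nu)$ with Neumann boundary conditions. The gradient is $\nabla_\nu=(Y_0,Y_1)$ with $Y_0=\partial_u$, $Y_1=e^u\partial_x$, so $|\nabla_\nu f|^2=|\partial_uf|^2+e^{2u}|\partial_xf|^2$. For $(x,u)\in G_\nu$, $|(x,u)|_\varrho=\operatorname{arccosh}(\cosh u+e^{-u}x^2/2)$ (the Riemannian distance from the identity $(0,0)$). $K_{e^{-t\Delta_\nu}}$ is the convolution kernel of the heat operator $e^{-t\Delta_\nu}$ with respect to the hypergroup convolution of $G_\nu$, i.e. $e^{-t\Delta_\nu}f=f\diamond_\nu K_{e^{-t\Delta_\nu}}$; explicitly, $$K_{e^{-t\Delta_\nu}}(x,u)=\frac{2}{\Gamma(\nu/2)}\int_0^\infty\Psi_t(\xi)\,(2\xi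 e^u)^{-\nu/2}\exp\Big(-\frac{\cosh u}{\xi}-\frac{x^2}{2\xi e^u}\Big)\,d\xi,$$ $$\Psi_t(\xi)=\frac{e^{\pi^2/(4t)}}{\xi^2\sqrt{4\pi^3t}}\int_0^\infty\sinh\theta\,\sin\Big(\frac{\pi\theta}{2t}\Big)\exp\Big(-\frac{\theta^2}{4t}-\frac{\cosh\theta}{\xi}\Big)\,d\theta,\qquad \xi>0.$$ The convolution is $f\diamond_\nu g(\mathbf x)=\int_{G_\nu}f(\mathbf y^-)\,r_{\mathbf x}g(\mathbf y)\,d\bar\mu_\nu(\mathbf y)$, where $(y,v)^-=(e^{-v}y,-v)$, $r_{(x,u)}g(y,v)=\int_{-1}^1g\big(\sqrt{(e^vx)^2+y^2-2\omega e^vxy},\,u+v\big)\,d\varpi_\nu(\omega)$, and $\varpi_\nu$ is the probability measure on $[-1,1]$ proportional to $(1-\omega^2)^{(\nu-3)/2}d\omega$ if $\nu>1$ and $(\delta_{-1}+\delta_1)/2$ if $\nu=1$. *)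

(* Defs.v *)
From HB Require Import structures.
From mathcomp Require Import all_boot all_order all_algebra.
From mathcomp Require Import all_classical all_reals all_analysis.

Set Implicit Arguments.
Unset Strict Implicit.
Unset Printing Implicit Defensive.

Import Order.TTheory GRing.Theory Num.Theory.
Import numFieldNormedType.Exports.

Local Open Scope classical_set_scope.
Local Open Scope ring_scope.

Definition coshR (R : realType) (x : R) : R := (expR x + expR (- x)) / 2.

Definition sinhR (R : realType) (x : R) : R := (expR x - expR (- x)) / 2.

(* the inverse of coshR restricted to [0, +oo[, meaningful for 1 <= y *)
Definition arccosh (R : realType) (y : R) : R :=
  ln (y + Num.sqrt (y ^+ 2 - 1)).

(* Euler's integral, meaningful for 0 < z *)
Definition Gamma (R : realType) (z : R) : R :=
  \int[@lebesgue_measure R]_(s in `]0, +oo[) (s `^ (z - 1) * expR (- s)).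

(* G_nu = [0, +oo[ * R; functions on G_nu are represented by functions on
   R * R, of which only the values on Gset matter *)
Definition Gset (R : realType) : set (R * R) := [set p | 0 <= p.1].

(* the norm of L^1(G_nu), the measure of G_nu being x^(nu-1) dx du *)
Definition L1norm (R : realType) (nu : R) (f : R * R -> R) : \bar R :=
  \int[(@lebesgue_measure R \x @lebesgue_measure R)%E]_(p in @Gset R)
    (`|f p| * p.1 `^ (nu - 1))%:E.

Definition rho (R : realType) (p : R * R) : R :=
  arccosh (coshR p.2 + expR (- p.2) * p.1 ^+ 2 / 2).

Definition Y0 (R : realType) (f : R * R -> R) (p : R * R) : R :=
  derive1 (fun v : R => f (p.1, v)) p.2.

Definition Y1 (R : realType) (f : R * R -> R) (p : R * R) : R :=
  expR p.2 * derive1 (fun y : R => f (y, p.2)) p.1.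

Definition grad_norm (R : realType) (f : R * R -> R) (p : R * R) : R :=
  Num.sqrt (Y0 f p ^+ 2 + Y1 f p ^+ 2).

Definition Psi (R : realType) (t xi : R) : R :=
  expR (pi ^+ 2 / (4 * t)) / (xi ^+ 2 * Num.sqrt (4 * pi ^+ 3 * t)) *
  \int[@lebesgue_measure R]_(theta in `]0, +oo[)
    (sinhR theta * sin (pi * theta / (2 * t)) *
     expR (- (theta ^+ 2 / (4 * t)) - coshR theta / xi)).

(* the convolution kernel of exp(- t Delta_nu), by its explicit formula *)
Definition heat_kernel (R : realType) (nu t : R) (p : R * R) : R :=
  2 / Gamma (nu / 2) *
  \int[@lebesgue_measure R]_(xi in `]0, +oo[)
    (Psi t xi * (2 * xi * expR p.2) `^ (- (nu / 2)) *
     expR (- (coshR p.2 / xi) - p.1 ^+ 2 / (2 * xi * expR p.2))).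

(* Main.v *)
Require Import Defs.
From HB Require Import structures.
From mathcomp Require Import all_boot all_order all_algebra.
From mathcomp Require Import all_classical all_reals all_analysis.
From mathcomp Require Import measurable_realfun ring lra.

(** Put alpha = nu/2, a = 1/(4t), and let c = cosh |(x,u)|.  Interchanging the two
    integrals of the kernel and scaling the inner one gives, in [heat_kernelE],

      K(x,u) = const * e^(- alpha u) * N_alpha(c),
      N_s(c) = int_0^oo w(y) (cosh y + c)^(-1-s) dy,
      w(y)   = sinh y * sin(2 a pi y) * e^(- a y^2).

    The weight w oscillates and the constant contains e^(a pi^2), so absolute
    values inside N_alpha would ruin uniformity in t.  Two facts avoid this.

    - For s = 0 the integral is explicit ([stj_hw0]):
      e^(a pi^2) N_0(cosh r) = pi e^(- a r^2).  Up to a factor, the left-hand side is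
      the imaginary part of the integral of e^(- a z^2) coth((z - r)/2) over the
      line of height pi; that integral does not depend on the height, and near the
      real axis only the pole at r contributes.  Up to factors N_k is the k-th
      derivative of N_0, so one gets functions G_k of c with G_k' = - G_(k+1) and
      G_0 = e^(- a arccosh^2).  Now G_1 = 2a A_0 G_0, where A_0(cosh r) = r / sinh r
      is the integral of 1/(cosh y + cosh r) over y > 0, whose derivatives in cosh r
      alternate in sign.  By the Leibniz rule and induction all G_k are nonnegative
      ([Gs_ge0]): the cancellations in N_k are entirely accounted for.

    - For a general order, the Weyl fractional integral

        B N_alpha(c) = int_(v > c) (v - c)^(p-1) N_m(v) dv,   p = m - alpha,

      with B a beta integral, raises alpha to an integer m = k + 1 with p >= 1
      ([weyl_stj]).  Absolute values may now be taken under this integral.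

    The weighted norm of K is thus at most an integral over (x,u,v) with v > c.
    Enlarge the domain to cosh u < v, x^2 <= 2 e^u (v - 1) and integrate over x
    first: the volume of the slice cancels e^(- alpha u) and completes the power of
    v - 1 to the integer k ([integral_sliceI]).  The u-integral contributes
    2 r with r = arccosh v, and what remains is the integral over v > 1 of
    e^(eps r/sqrt t) r (v - 1)^k G_(k+1)(v).  For nonnegative functions with
    F_k' = - F_(k+1) the mean value theorem gives
    (v - 1)^k F_k(v) <= C F_0(1 + (v - 1)/2^k) ([dseq_steps]), which leads back to
    the Gaussian e^(- r^2/(4t)); in the variable r/sqrt t the resulting integral is
    bounded independently of t ([dseq_reduce], [integral_hbar]).

    For Y_1 K one more derivative and a factor x appear, and the same computation
    gains t^(-1/2).  In Y_0 K the derivative of e^(- alpha u) produces - alpha K,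
    which has no such gain by itself; it has to be combined with the derivative of
    N_alpha(c).  The combination passes through the Weyl integral ([weyl_twist]) to
    (v - q) G_(m+1) - m G_m with q = e^u, which is up to sign the m-th derivative of
    (v - q) G_1 = 2a (v - q) A_0 G_0.  The Leibniz rule bounds it by nonnegative
    sequences ([Eseq_ub]), using |v - e^u| A_0(v) <= arccosh v when cosh u <= v
    ([horocycle_le]). *)

Set Implicit Arguments.
Unset Strict Implicit.
Unset Printing Implicit Defensive.

Import Order.TTheory GRing.Theory Num.Theory.
Import numFieldNormedType.Exports.

Local Open Scope classical_set_scope.
Local Open Scope ring_scope.

(** * Integrals on the real line *)

Section IntegralTools.
Context {R : realType}.
Notation mu := (@lebesgue_measure R).
Import HBNNSimple.

(** The integral of a nonnegative function is the supremum over the simple functions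
    below it, so it is monotone even for functions not known to be measurable, such
    as the weighted gradient of the kernel. *)
Lemma le_ge0_integral d (T : measurableType d) (m : {measure set T -> \bar R})
    (D : set T) (f g : T -> \bar R) :
  (forall x, D x -> (0 <= f x)%E) -> (forall x, D x -> (f x <= g x)%E) ->
  (\int[m]_(x in D) f x <= \int[m]_(x in D) g x)%E.
Proof.
move=> f0 fg; have g0 x (Dx : D x) := le_trans (f0 x Dx) (fg x Dx).
rewrite !ge0_integralE//; apply: ereal_sup_le => _ [h /= hf <-].
exists h => // x; apply: le_trans (hf x) _; rewrite !patchE.
by case: ifPn => // /set_mem; exact: fg.
Qed.

Lemma ge0_integral_affine (a b : R) (f : R -> \bar R) : 0 < a ->
  measurable_fun [set: R] f -> (forall x, (0 <= f x)%E) ->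
  (\int[mu]_x f x = a%:E * \int[mu]_x f (a * x + b)%R)%E.
Proof.
move=> a0 mf f0.
pose phi : measurableTypeR R -> measurableTypeR R := fun x : R => (a * x + b)%R.
have mphi : measurable_fun [set: measurableTypeR R] phi.
  by apply: measurable_funD => //; exact: measurable_funM.
have H A : measurable A ->
    mscale (NngNum (ltW a0)) (pushforward mu phi) A = mu A.
  move=> mA; apply/esym/lebesgue_measure_unique => //= _ [[c d]] _ <-.
  have phiE : phi @^-1` `]c, d]%classic = `](c - b) / a, (d - b) / a]%classic.
    apply/seteqP; split => x /=; rewrite /phi !in_itv/=;
      by rewrite ltr_pdivrMr// ler_pdivlMr// ltrBlDr lerBrDr mulrC.
  rewrite /= /mscale /= [pushforward _ _ _](congr1 mu phiE).
  rewrite !lebesgue_measure_itv/= !lte_fin ltr_pM2r ?invr_gt0// ltrD2r.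
  case: ifPn => _; last by rewrite mule0.
  by rewrite -!EFinB -EFinM -mulrBl mulrCA divff ?gt_eqF// mulr1 opprB addrA subrK.
rewrite [X in (_ * X)%E](_ : _ = \int[mu]_(x in phi @^-1` setT) (f \o phi) x)%E;
  last by rewrite preimage_setT.
rewrite -(ge0_integral_pushforward mphi)//.
have mf' : measurable_fun [set: measurableTypeR R] f by [].
rewrite -(@ge0_integral_mscale _ _ _ _ _ measurableT (NngNum (ltW a0)))//.
by apply: eq_measure_integral => A mA _; exact/esym/(H mphi).
Qed.

Lemma is_derive_integral (D : set R) (f df : R -> R -> R) (G : R -> R)
    (a u v : R) : measurable D -> u < a < v ->
  (forall x, u < x < v -> mu.-integrable D (EFin \o f x)) ->
  (forall x y, u < x < v -> D y -> is_derive x 1 (f ^~ y) (df x y)) ->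
  mu.-integrable D (EFin \o G) ->
  (forall x y, u < x < v -> D y -> `|df x y| <= G y) ->
  is_derive a 1 (fun x => \int[mu]_(y in D) f x y) (\int[mu]_(y in D) df a y).
Proof.
move=> mD auv intf derf iG Gub.
have Ia : [set` `]u, v[%R] a by rewrite /= in_itv.
have I0 (x : R) : [set` `]u, v[%R] x -> u < x < v by rewrite /= in_itv.
have intf' x : [set` `]u, v[%R] x -> mu.-integrable D (EFin \o f x).
  by move=> /I0; exact: intf.
have derf' (x y : R) : [set` `]u, v[%R] x -> D y -> derivable (f ^~ y) x 1.
  by move=> /I0 xuv Dy; have [] := derf x y xuv Dy.
have dfE (x y : R) : u < x < v -> D y -> partial1of2 f x y = df x y.
  by move=> xuv Dy; rewrite partial1of2E; have [_ ->] := derf x y xuv Dy.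
have iG' : mu.-integrable D (EFin \o (fun y => `|G y|)).
  exact: integrable_norm.
have Gub' (x y : R) : [set` `]u, v[%R] x -> D y -> `|partial1of2 f x y| <= `|G y|.
  move=> /I0 xuv Dy; rewrite dfE// (le_trans (Gub x y xuv Dy))//.
  exact: ler_norm.
have G0 y : 0 <= `|G y| by [].
have E : (\int[mu]_(y in D) partial1of2 f a y = \int[mu]_(y in D) df a y)%R.
  by apply: eq_Rintegral => y /set_mem Dy; rewrite dfE.
apply: DeriveDef.
  exact: (@derivable_under_integral R _ _ mu f D mD a u v Ia intf' derf'
    (fun y => `|G y|) G0 iG' Gub').
rewrite -derive1E -E.
exact: (@differentiation_under_integral R _ _ mu f D mD a u v Ia intf' derf'
    (fun y => `|G y|) G0 iG' Gub').
Qed.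

End IntegralTools.

Section FTC.
Context {R : realType}.
Notation mu := (@lebesgue_measure R).

Lemma is_derive_continuous (f : R -> R) (x a : R) :
  is_derive x 1 f a -> {for x, continuous f}.
Proof.
by move=> [df _]; apply/differentiable_continuous/derivable1_diffP.
Qed.

Lemma ge0_FTC (f F : R -> R) (a l : R) : (forall x, a <= x -> 0 <= f x) ->
  (forall x, a <= x -> is_derive x 1 F (f x)) ->
  (forall x, a <= x -> {for x, continuous f}) ->
  F x @[x --> +oo] --> l ->
  (\int[mu]_(x in `]a, +oo[) (f x)%:E = (l - F a)%:E)%E.
Proof.
move=> f0 dF cf Fl.
have cF : {for a, continuous F} := is_derive_continuous (dF a (lexx _)).
have mf : measurable_fun `]a, +oo[ f.
  apply: open_continuous_measurable_fun => // x; rewrite inE/= in_itv/= andbT.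
  by move=> /ltW; exact: cf.
rewrite integral_itv_obnd_cbnd; last exact/measurable_EFinP.
rewrite (@ge0_continuous_FTC2y _ f F a l)//.
- apply: continuous_in_subspaceT => x; rewrite inE/= in_itv/= andbT.
  exact: cf.
- by move=> x /ltW ax; have [] := dF x ax.
- exact: cvg_at_right_filter.
- move=> x; rewrite in_itv/= andbT => /ltW ax; rewrite derive1E.
  by have [_ ->] := dF x ax.
Qed.

(** Here the integrand may have an integrable singularity at the endpoint: exhaust the
    half-line by closed ones on which the primitive is differentiable. *)
Lemma ge0_FTC_open (f F : R -> R) (a B : R) : (forall x, a < x -> 0 <= f x) ->
  (forall x : R, a < x -> is_derive x 1 F (f x)) ->
  (forall x : R, a < x -> {for x, continuous f}) ->
  F x @[x --> +oo] --> (0 : R) -> (forall x, a < x -> - F x <= B) ->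
  (\int[mu]_(x in `]a, +oo[) (f x)%:E <= B%:E)%E.
Proof.
move=> f0 dF cf Fl FB.
have mf : measurable_fun (`]a, +oo[ : set R) f.
  by apply: open_continuous_measurable_fun => // x; rewrite inE/= in_itv/= andbT; exact: cf.
pose E (n : nat) : set R := `]a + n.+1%:R^-1, +oo[%classic.
have En : `]a, +oo[%classic = \bigcup_n E n.
  apply/seteqP; split => x /=; rewrite in_itv/= andbT.
    move=> ax; have ax0 : 0 < x - a by rewrite subr_gt0.
    have [n _ /(_ n (leqnn n))/= h] := near_infty_natSinv_lt (PosNum ax0).
    by exists n => //; rewrite /E/= in_itv/= andbT -ltrBrDl.
  by move=> [n _]; rewrite /E/= in_itv/= andbT; apply: lt_trans; rewrite ltrDl.
have mE n : measurable (E n) by exact: measurable_itv.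
have ndE : nondecreasing_seq E.
  move=> m n mn; apply/subsetPset => x; rewrite /E/= !in_itv/= !andbT.
  by apply: le_lt_trans; rewrite lerD2l lef_pV2 ?posrE// ler_nat ltnS.
have mfE n : measurable_fun (E n) (EFin \o f).
  apply/measurable_EFinP; apply: measurable_funS mf => //.
  by rewrite En; exact: bigcup_sup.
have f0E n x : E n x -> (0 <= (f x)%:E)%E.
  rewrite /E/= in_itv/= andbT => h; rewrite lee_fin f0//.
  by apply: lt_trans h; rewrite ltrDl.
have cv := ge0_nondecreasing_set_cvg_integral (mu := mu) ndE mE mfE f0E.
rewrite En -(cvg_lim (@ereal_hausdorff R) cv).
apply: lime_le; first by apply/cvg_ex; eexists; exact: cv.
apply: nearW => n; rewrite /E.
have an : a < a + n.+1%:R^-1 by rewrite ltrDl.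
have f0' x : a + n.+1%:R^-1 <= x -> 0 <= f x by move=> nx; apply/f0/(lt_le_trans an).
have dF' (x : R) : a + n.+1%:R^-1 <= x -> is_derive x 1 F (f x).
  by move=> nx; apply/dF/(lt_le_trans an).
have cf' (x : R) : a + n.+1%:R^-1 <= x -> {for x, continuous f}.
  by move=> nx; apply/cf/(lt_le_trans an).
by have /= -> := ge0_FTC f0' dF' cf' Fl; rewrite sub0r lee_fin FB.
Qed.

End FTC.

(** * Hyperbolic functions *)

(** The derivative is a separate argument so that each use can choose its shape. *)
Lemma is_derive_chain (R : realType) (f g : R -> R) (x a b c : R) :
  is_derive (g x) 1 f a -> is_derive x 1 g b -> c = a * b ->
  is_derive x 1 (fun y => f (g y)) c.
Proof.
by move=> df dg ->; apply: is_derive_eq (is_derive1_comp df dg) _.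
Qed.

Section Hyperbolic.
Context {R : realType}.
Implicit Types (x y r c : R).

Lemma coshRN x : coshR (- x) = coshR x.
Proof. by rewrite /coshR opprK addrC. Qed.

Lemma sinhRN x : sinhR (- x) = - sinhR x.
Proof. by rewrite /sinhR opprK -mulNr opprB. Qed.

Lemma coshR_sqr x : coshR x ^+ 2 = 1 + sinhR x ^+ 2.
Proof.
rewrite /coshR /sinhR; have := expRxMexpNx_1 x.
set a := expR x; set b := expR (- x) => h.
by transitivity (a * b + ((a - b) / 2) ^+ 2); [field|rewrite h].
Qed.

Lemma coshRDsinhR x : coshR x + sinhR x = expR x.
Proof. by rewrite /coshR /sinhR; field. Qed.

Lemma coshRD x y : coshR (x + y) = coshR x * coshR y + sinhR x * sinhR y.
Proof. by rewrite /coshR /sinhR opprD !expRD; field. Qed.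

Lemma sinhRD x y : sinhR (x + y) = sinhR x * coshR y + coshR x * sinhR y.
Proof. by rewrite /coshR /sinhR opprD !expRD; field. Qed.

Lemma coshR0 : coshR 0 = 1 :> R.
Proof. by rewrite /coshR oppr0 expR0; field. Qed.

Lemma sinhR0 : sinhR 0 = 0 :> R.
Proof. by rewrite /sinhR oppr0 subrr mul0r. Qed.

Global Instance is_derive_coshR x : is_derive x 1 (@coshR R) (sinhR x).
Proof.
rewrite /coshR /sinhR; apply: is_derive_eq.
by rewrite /GRing.scale/=; ring.
Qed.

Global Instance is_derive_sinhR x : is_derive x 1 (@sinhR R) (coshR x).
Proof.
rewrite /coshR /sinhR; apply: is_derive_eq.
by rewrite /GRing.scale/=; ring.
Qed.

Lemma continuous_coshR : continuous (@coshR R).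
Proof.
by move=> x; apply/differentiable_continuous/derivable1_diffP; exact: ex_derive.
Qed.

Lemma continuous_sinhR : continuous (@sinhR R).
Proof.
by move=> x; apply/differentiable_continuous/derivable1_diffP; exact: ex_derive.
Qed.

Lemma measurable_coshR : measurable_fun [set: R] (@coshR R).
Proof. by apply: continuous_measurable_fun; exact: continuous_coshR. Qed.

Lemma measurable_sinhR : measurable_fun [set: R] (@sinhR R).
Proof. by apply: continuous_measurable_fun; exact: continuous_sinhR. Qed.

Lemma coshR_gt0 x : 0 < coshR x.
Proof. by rewrite divr_gt0// addr_gt0// expR_gt0. Qed.

Lemma coshR_ge1 x : 1 <= coshR x.
Proof.
rewrite -(@ler_pXn2r _ 2)// ?nnegrE ?(ltW (coshR_gt0 _))//.
by rewrite expr1n coshR_sqr lerDl sqr_ge0.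
Qed.

Lemma sinhR_ge0 x : 0 <= x -> 0 <= sinhR x.
Proof. by move=> x0; rewrite divr_ge0// subr_ge0 ler_expR; lra. Qed.

Lemma sinhR_gt0 x : 0 < x -> 0 < sinhR x.
Proof. by move=> x0; rewrite divr_gt0// subr_gt0 ltr_expR; lra. Qed.

Lemma ler_coshR x y : 0 <= x -> x <= y -> coshR x <= coshR y.
Proof.
move=> x0 xy; have -> : y = x + (y - x) by ring.
rewrite coshRD -[leLHS]addr0 -[coshR x in leLHS]mulr1 lerD//.
  by rewrite ler_wpM2l ?coshR_ge1// ltW// coshR_gt0.
by rewrite mulr_ge0// sinhR_ge0//; lra.
Qed.

Lemma ltr_coshR x y : 0 <= x -> x < y -> coshR x < coshR y.
Proof.
move=> x0 xy; have -> : y = (x + (y - x) / 2) + (y - x) / 2 by field.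
rewrite [ltRHS]coshRD; apply: (@le_lt_trans _ _ (coshR (x + (y - x) / 2))).
  by apply: ler_coshR => //; lra.
rewrite -[ltLHS]addr0 -[X in X + 0 < _]mulr1 ler_ltD//.
  by rewrite ler_wpM2l ?coshR_ge1// ltW// coshR_gt0.
by rewrite mulr_gt0// sinhR_gt0//; lra.
Qed.

Lemma sinhR_ge_id x : 0 <= x -> x <= sinhR x.
Proof.
rewrite le_eqVlt => /predU1P[<-|x0]; first by rewrite sinhR0.
have [//|c] := @MVT R (@sinhR R) (@coshR R) 0 x x0.
  by apply: continuous_subspaceT; exact: continuous_sinhR.
rewrite sinhR0 !subr0 => _ ->.
by rewrite -[leLHS]mul1r ler_wpM2r ?coshR_ge1// ltW.
Qed.

Lemma arccosh_coshR r : 0 <= r -> arccosh (coshR r) = r.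
Proof.
move=> r0; rewrite /arccosh coshR_sqr [1 + _]addrC addrK sqrtr_sqr.
by rewrite ger0_norm ?sinhR_ge0// coshRDsinhR expRK.
Qed.

Lemma arccosh_ge0 c : 1 <= c -> 0 <= arccosh c.
Proof. by move=> c1; rewrite ln_ge0// ler_wpDr// sqrtr_ge0. Qed.

Lemma coshR_arccosh c : 1 <= c -> coshR (arccosh c) = c.
Proof.
move=> c1; have c21 : 0 <= c ^+ 2 - 1 by rewrite subr_ge0 exprn_ege1.
have s0 := sqrtr_ge0 (c ^+ 2 - 1); have s2 := sqr_sqrtr c21.
rewrite /coshR expRN /arccosh lnK; last by rewrite posrE; lra.
set s := Num.sqrt _ in s0 s2 *.
have -> : (c + s)^-1 = c - s.
  apply: (mulfI (_ : c + s != 0)); first by rewrite gt_eqF//; lra.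
  rewrite divff; last by rewrite gt_eqF//; lra.
  rewrite (_ : (c + s) * (c - s) = c ^+ 2 - s ^+ 2); first by rewrite s2; ring.
  by ring.
by field.
Qed.

Lemma sinhR_arccosh c : 1 <= c -> sinhR (arccosh c) = Num.sqrt (c ^+ 2 - 1).
Proof.
move=> c1; rewrite -{2}(coshR_arccosh c1) coshR_sqr [1 + _]addrC addrK.
by rewrite sqrtr_sqr ger0_norm// sinhR_ge0// arccosh_ge0.
Qed.

Lemma arccosh_gt0 c : 1 < c -> 0 < arccosh c.
Proof.
move=> c1; rewrite lt_neqAle arccosh_ge0 ?(ltW c1)// andbT.
apply/eqP => h; have := coshR_arccosh (ltW c1); rewrite -h coshR0 => h1.
by move: c1; rewrite -h1 ltxx.
Qed.

Lemma ler_arccosh c (c' : R) : 1 <= c -> c <= c' -> arccosh c <= arccosh c'.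
Proof.
move=> c1 cc'; rewrite leNgt; apply/negP => h.
have := ltr_coshR (arccosh_ge0 (le_trans c1 cc')) h.
by rewrite !coshR_arccosh ?(le_trans c1)// ltNge cc'.
Qed.

Lemma is_derive_arccosh c : 1 < c ->
  is_derive c 1 (@arccosh R) (Num.sqrt (c ^+ 2 - 1))^-1.
Proof.
move=> c1; have c21 : 0 < c ^+ 2 - 1 by rewrite subr_gt0 exprn_egt1.
have s0 : 0 < Num.sqrt (c ^+ 2 - 1) by rewrite sqrtr_gt0.
have ds : is_derive c 1 (fun x : R => Num.sqrt (x ^+ 2 - 1))
    (c / Num.sqrt (c ^+ 2 - 1)).
  apply: (is_derive_chain (f := @Num.sqrt R) (g := fun x => x ^+ 2 - 1)
    (is_derive1_sqrt c21)).
  rewrite /GRing.scale/= invfM; field.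
  by rewrite gt_eqF.
apply: (is_derive_chain (f := @ln R) (g := fun x : R => x + Num.sqrt (x ^+ 2 - 1))
   (is_derive1_ln _)).
  by lra.
by rewrite /GRing.scale/=; field; apply/andP; split; rewrite gt_eqF//; lra.
Qed.

End Hyperbolic.

(** * Generalized Stieltjes transforms *)

Section Stieltjes.
Context {R : realType}.
Notation mu := (@lebesgue_measure R).

Lemma integrable_le (D : set R) (f g : R -> R) : measurable D ->
  measurable_fun D f -> mu.-integrable D (EFin \o g) ->
  (forall x, D x -> `|f x| <= g x) -> mu.-integrable D (EFin \o f).
Proof.
move=> mD mf ig fg; apply: le_integrable ig => //.
  exact/measurable_EFinP.
move=> x Dx; rewrite /= lee_fin (le_trans (fg x Dx))//.
exact: ler_norm.
Qed.

Lemma integrable_scale (D : set R) (k : R) (f : R -> R) : measurable D ->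
  mu.-integrable D (EFin \o f) -> mu.-integrable D (EFin \o (fun x => k * f x)).
Proof. by move=> mD; exact: integrableZl. Qed.

Lemma integrable_expRN : mu.-integrable `]0, +oo[ (EFin \o (fun x : R => expR (- x))).
Proof.
have h := @integrable_exponential_pdf R 1 ltr01.
have : mu.-integrable `]0, +oo[ (EFin \o exponential_pdf 1).
  by apply: integrableS h => //.
apply: eq_integrable => // x; rewrite inE/= in_itv/= andbT => x0.
by rewrite /= exponential_pdfE ?(ltW x0)// mul1r mulN1r.
Qed.

Lemma coshRV_le (x : R) : (coshR x)^-1 <= 2 * expR (- x).
Proof.
rewrite -[leLHS]mul1r ler_pdivrMr ?coshR_gt0//.
rewrite /coshR; have := expRxMexpNx_1 x; have := expR_gt0 (- x).
set a := expR x; set b := expR (- x) => b0 h.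
rewrite (_ : 2 * b * _ = a * b + b ^+ 2); last by field.
by rewrite h lerDl sqr_ge0.
Qed.

Lemma kernel_pow_le (s c x : R) : 0 < c -> 0 <= s ->
  (coshR x + c) `^ (-1 - s) <= 2 * expR (- x).
Proof.
move=> c0 s0; have x1 := coshR_ge1 x.
apply: (le_trans _ (coshRV_le x)).
apply: (@le_trans _ _ ((coshR x + c) `^ (-1))).
  by apply: ler_powR; lra.
rewrite powR_inv1; last by lra.
by rewrite lef_pV2 ?posrE; lra.
Qed.

(** In the variable [cosh x] this is a generalized Stieltjes transform; up to elementary
    factors, the heat kernel and its derivatives are sums of these. *)
Definition stj (f : R -> R) (s c : R) : R :=
  \int[mu]_(x in `]0, +oo[) (f x * (coshR x + c) `^ (-1 - s)).

Variables (f : R -> R) (M : R).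
Hypotheses (mf : measurable_fun [set: R] f)
  (fM : forall x, 0 < x -> `|f x| <= M).

Lemma measurable_stj (s c : R) :
  measurable_fun [set: R] (fun x => f x * (coshR x + c) `^ (-1 - s)).
Proof.
apply: measurable_funM => //.
apply: (measurableT_comp (f := fun a : R => a `^ (-1 - s))).
  exact: measurable_powR.
by apply: measurable_funD => //; exact: measurable_coshR.
Qed.

Lemma stj_bound (s c x : R) : 0 < x -> 0 < c -> 0 <= s ->
  `|f x * (coshR x + c) `^ (-1 - s)| <= 2 * M * expR (- x).
Proof.
move=> x0 c0 s0; rewrite normrM (ger0_norm (powR_ge0 _ _)).
rewrite [leRHS](_ : _ = M * (2 * expR (- x))); last by ring.
by rewrite ler_pM ?powR_ge0// ?fM// kernel_pow_le.
Qed.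

Lemma integrable_stj (s c : R) : 0 < c -> 0 <= s ->
  mu.-integrable `]0, +oo[ (EFin \o (fun x => f x * (coshR x + c) `^ (-1 - s))).
Proof.
move=> c0 s0; apply: (integrable_le (measurable_itv _) _
   (integrable_scale (2 * M) (measurable_itv _) integrable_expRN)).
  by apply: measurable_funTS; exact: measurable_stj.
by move=> x; rewrite /= in_itv/= andbT => x0; exact: stj_bound.
Qed.

(** Differentiation raises the order by one.  The domination is uniform for the
    parameter in a neighbourhood of [c] away from 0. *)
Lemma is_derive_stj (s c : R) : 0 < c -> 0 <= s ->
  is_derive c 1 (stj f s) (- (1 + s) * stj f (s + 1) c).
Proof.
move=> c0 s0.
have dk (x y : R) : 0 < x -> is_derive x 1
    (fun c => f y * (coshR y + c) `^ (-1 - s))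
    (- (1 + s) * (f y * (coshR y + x) `^ (-1 - (s + 1)))).
  move=> x0; have cy := coshR_gt0 y.
  have cyx : 0 < coshR y + x by exact: addr_gt0.
  have h : is_derive x 1 (fun c => (coshR y + c) `^ (-1 - s)) _ :=
    is_derive_chain (f := fun a => a `^ (-1 - s)) (g := fun c => coshR y + c)
     (is_derive1_powR (-1 - s) cyx) _ erefl.
  apply: is_derive_eq.
  rewrite /GRing.scale/= (_ : -1 - s - 1 = -1 - (s + 1)); last by ring.
  ring.
rewrite /stj -RintegralZl//; last by apply: integrable_stj => //; lra.
apply: (@is_derive_integral R _ (fun c y => f y * (coshR y + c) `^ (-1 - s))
  (fun x y => - (1 + s) * (f y * (coshR y + x) `^ (-1 - (s + 1))))
  (fun y => (1 + s) * (2 * M) * expR (- y)) c (c / 2) (c + 1)) => //.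
- by lra.
- by move=> x ?; apply: integrable_stj => //; lra.
- by move=> x y ? _; apply: dk; lra.
- exact: integrable_scale integrable_expRN.
- move=> x y xc; rewrite /= in_itv/= andbT => y0.
  rewrite normrM normrN [`|1 + s|]ger0_norm; last lra.
  by rewrite -mulrA ler_wpM2l//; [lra|apply: stj_bound => //; lra].
Qed.

End Stieltjes.

(** * Sequences of iterated derivatives *)

Section DerivativeSequences.
Context {R : realType}.
Implicit Types (F H K : nat -> R -> R) (c q : R) (k : nat).

(** [F k] is the [k]-th derivative of [F 0] with the sign that makes all of them
    nonnegative for a completely monotone [F 0]. *)
Definition dseq F := forall k c, 1 < c -> is_derive c 1 (F k) (- F k.+1 c).

Definition seqshift F : nat -> R -> R := fun k => F k.+1.

(** The [k]-th derivative of the product of [F 0] and [H 0], up to the sign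
    [(-1)^k]; the binomial coefficients are left implicit in the recursion. *)
Fixpoint leibniz k F H : R -> R :=
  if k is k'.+1 then fun c => leibniz k' (seqshift F) H c + leibniz k' F (seqshift H) c
  else fun c => F 0%N c * H 0%N c.

Lemma leibnizS k F H c : leibniz k.+1 F H c =
  leibniz k (seqshift F) H c + leibniz k F (seqshift H) c.
Proof. by []. Qed.

Lemma dseq_seqshift F : dseq F -> dseq (seqshift F).
Proof. by move=> dF k c c1; exact: dF. Qed.

Lemma dseq_leibniz F H : dseq F -> dseq H -> dseq (fun k => leibniz k F H).
Proof.
move=> + + k; elim: k F H => [|k ih] F H dF dH c c1.
  have dF0 := dF 0%N c c1; have dH0 := dH 0%N c c1.
  apply: is_derive_eq (is_deriveM dF0 dH0) _.
  by rewrite /GRing.scale/= /seqshift; ring.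
have d1 := ih _ _ (dseq_seqshift dF) dH c c1.
have d2 := ih _ _ dF (dseq_seqshift dH) c c1.
apply: is_derive_eq; rewrite /=; ring.
Qed.

(** Equality propagates from order 0 because derivatives are local. *)
Lemma dseq_uniq F H : dseq F -> dseq H ->
  (forall c, 1 < c -> F 0%N c = H 0%N c) ->
  forall k c, 1 < c -> F k c = H k c.
Proof.
move=> dF dH FH0; elim=> [//|k ih] c c1.
apply: oppr_inj; have [_ <-] := dF k c c1; have [_ <-] := dH k c c1.
apply: near_eq_derive => //.
near=> y; apply: ih; near: y.
exact: lt_nbhsr.
Unshelve. all: by end_near. Qed.

Lemma dseqZ (a : R) F : dseq F -> dseq (fun k c => a * F k c).
Proof.
move=> dF k c c1; have dFk := dF k c c1.
by apply: is_derive_eq; rewrite /GRing.scale/=; ring.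
Qed.

Lemma leibniz_ge0 k F H c : (forall i, (i <= k)%N -> 0 <= F i c) ->
  (forall i, (i <= k)%N -> 0 <= H i c) -> 0 <= leibniz k F H c.
Proof.
elim: k F H => [|k ih] F H F0 H0 /=; first by rewrite mulr_ge0 ?F0 ?H0.
rewrite addr_ge0//; apply: ih => i ik; rewrite /seqshift ?F0 ?H0//;
  exact: leq_trans ik _.
Qed.

Lemma leibnizD k F K H (q c : R) :
  leibniz k (fun i c => F i c + q * K i c) H c =
  leibniz k F H c + q * leibniz k K H c.
Proof.
elim: k F K H => [|k ih] F K H /=; first by ring.
by rewrite [X in X + _ = _]ih ih; ring.
Qed.

Lemma leibnizN k F H c :
  leibniz k (fun i c => - F i c) H c = - leibniz k F H c.
Proof.
elim: k F H => [|k ih] F H /=; first by rewrite mulNr.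
by rewrite [X in X + _ = _]ih ih opprD.
Qed.

(** When all the derivatives of [F 0] have the sign opposite to that of a completely
    monotone function, only the term with the undifferentiated [F 0] can have either
    sign; the others are collected in a Leibniz sum of nonnegative terms. *)
Lemma leibniz_norm_le k F B H c :
  (forall i, F i.+1 = (fun c => - B i c)) ->
  (forall i, 0 <= B i c) -> (forall i, 0 <= H i c) ->
  `|leibniz k.+1 F H c| <= `|F 0%N c| * H k.+1 c + k.+1%:R * leibniz k B H c.
Proof.
move=> FB B0; have FB' : seqshift F = (fun i c => - B i c).
  by apply/funext => i; rewrite /seqshift FB.
elim: k H => [|k ih] H H0.
  rewrite /= /seqshift FB mul1r addrC (le_trans (ler_normD _ _))// lerD//.
    by rewrite normrM (ger0_norm (H0 _)).
  by rewrite normrM normrN (ger0_norm (H0 _)) (ger0_norm (B0 _)).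
rewrite leibnizS FB' leibnizN (le_trans (ler_normD _ _))// normrN ger0_norm; last first.
  exact: leibniz_ge0.
rewrite addrC [leibniz k.+1 B H c]leibnizS.
have := ih (seqshift H) (fun i => H0 i.+1).
have y0 : 0 <= leibniz k (seqshift B) H c by apply: leibniz_ge0 => i _; rewrite /seqshift.
have x0 : 0 <= leibniz k B (seqshift H) c.
  by apply: leibniz_ge0 => i _; rewrite /seqshift.
set X := `|leibniz _ _ _ _|; rewrite {1}/seqshift.
set x := leibniz k B _ c; set y := leibniz k _ H c => Xle.
rewrite (_ : k.+2%:R = k.+1%:R + 1); last by rewrite natr1.
have k0 : 0 <= k.+1%:R :> R by [].
have := mulr_ge0 k0 y0; rewrite -/y; lra.
Qed.

Lemma dseq_MVT F k (x y : R) : dseq F -> 1 < x -> x < y ->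
  exists2 z, x < z < y & F k x - F k y = F k.+1 z * (y - x).
Proof.
move=> dF x1 xy.
have dI z : z \in `]x, y[ -> is_derive z 1 (F k) (- F k.+1 z).
  by move=> zI; apply: dF; rewrite (lt_trans x1)// (itvP zI).
have cI : {within `[x, y], continuous (F k)}.
  apply: derivable_within_continuous => z zI.
  by have [] := dF k z _; rewrite ?(lt_le_trans x1)// (itvP zI).
have [z zI E] := MVT xy dI cI; exists z; first by rewrite !(itvP zI).
by rewrite -opprB E mulNr opprK.
Qed.

Lemma dseq_noninc F k (x y : R) : dseq F -> (forall c, 1 < c -> 0 <= F k.+1 c) ->
  1 < x -> x <= y -> F k y <= F k x.
Proof.
move=> dF F0 x1; rewrite le_eqVlt => /predU1P[->//|xy].
have [z /andP[xz zy] E] := dseq_MVT k dF x1 xy.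
by rewrite -subr_ge0 E mulr_ge0 ?F0 ?(lt_trans x1)// subr_ge0 ltW.
Qed.

(** Mean value theorem between the midpoint [1 + (c - 1) / 2] and [c]; the slope
    [F k.+1] is smallest at [c] by monotonicity. *)
Lemma dseq_step F k c : dseq F -> (forall i c, 1 < c -> 0 <= F i c) ->
  1 < c -> (c - 1) * F k.+1 c <= 2 * F k (1 + (c - 1) / 2).
Proof.
move=> dF F0 c1.
have x1 : 1 < 1 + (c - 1) / 2 by lra.
have xc : 1 + (c - 1) / 2 < c by lra.
have [z /andP[xz zc] E] := dseq_MVT k dF x1 xc.
have z1 : 1 < z by lra.
have := dseq_noninc dF (F0 k.+2) z1 (ltW zc) => Fz.
have := F0 k c c1.
have : (c - 1) / 2 * F k.+1 c <= (c - 1) / 2 * F k.+1 z by rewrite ler_wpM2l//; lra.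
rewrite (_ : c - (1 + (c - 1) / 2) = (c - 1) / 2) in E; last by field.
lra.
Qed.

Fixpoint step_cst (k : nat) : R := if k is k'.+1 then 2 ^+ k * step_cst k' else 1.

Lemma step_cst_ge0 k : 0 <= step_cst k.
Proof. by elim: k => //= k ih; rewrite mulr_ge0. Qed.

(** Iterating [dseq_step] trades powers of [c - 1] for derivatives, at the price of
    moving the point towards 1. *)
Lemma dseq_steps F k c : dseq F -> (forall i c, 1 < c -> 0 <= F i c) ->
  1 < c -> (c - 1) ^+ k * F k c <= step_cst k * F 0%N (1 + (c - 1) / 2 ^+ k).
Proof.
move=> dF F0; elim: k c => [|k ih] c c1.
  by rewrite !expr0 !mul1r divr1 addrCA subrr addr0.
have c'1 : 1 < 1 + (c - 1) / 2 by lra.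
have := ih _ c'1.
rewrite (_ : 1 + (c - 1) / 2 - 1 = (c - 1) / 2); last by ring.
rewrite [in X in _ <= X -> _](_ : (c - 1) / 2 / 2 ^+ k = (c - 1) / 2 ^+ k.+1); last first.
  by rewrite exprS; field; rewrite expf_neq0.
move=> h; rewrite exprSr -mulrA.
apply: (@le_trans _ _ ((c - 1) ^+ k * (2 * F k (1 + (c - 1) / 2)))).
  by rewrite ler_wpM2l ?dseq_step// exprn_ge0//; lra.
rewrite /= -mulrA.
apply: le_trans (ler_wpM2l (_ : 0 <= 2 ^+ k.+1) h) => //.
rewrite exprS expr_div_n le_eqVlt; apply/orP; left; apply/eqP.
by field; rewrite expf_neq0.
Qed.

End DerivativeSequences.

(** * The transform of the constant 1 *)

Section ConstantOne.
Context {R : realType}.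
Notation mu := (@lebesgue_measure R).

(** The factorial turns the coefficients [-(1 + s)] of [is_derive_stj] into [-1]. *)
Definition cmseq (f : R -> R) (k : nat) (c : R) : R := k`!%:R * stj f k%:R c.

Lemma is_derive_cmseq (f : R -> R) (M : R) (k : nat) (c : R) :
  measurable_fun [set: R] f -> (forall x, 0 < x -> `|f x| <= M) -> 0 < c ->
  is_derive c 1 (cmseq f k) (- cmseq f k.+1 c).
Proof.
move=> mf fM c0.
have d := is_derive_stj mf fM c0 (ler0n R k).
apply: is_derive_eq.
rewrite /GRing.scale/= /cmseq factS natrM -natr1 addrC; ring.
Qed.

Lemma dseq_cmseq (f : R -> R) (M : R) :
  measurable_fun [set: R] f -> (forall x, 0 < x -> `|f x| <= M) ->
  dseq (cmseq f).
Proof.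
by move=> mf fM k c c1; apply: (is_derive_cmseq _ mf fM); rewrite (lt_trans ltr01).
Qed.

Definition Aseq := cmseq (cst 1).

Lemma dseq_Aseq : dseq Aseq.
Proof. by apply: (@dseq_cmseq _ 1) => // x _; rewrite normr1. Qed.

Lemma Aseq_ge0 k c : 0 <= Aseq k c.
Proof.
rewrite mulr_ge0//; apply: Rintegral_ge0 => x _.
by rewrite mulr_ge0// powR_ge0.
Qed.

(** [(cosh x + c)^(-1) <= c^(-1)] under the integral. *)
Lemma Aseq_succ_le k (c : R) : 0 < c -> c * Aseq k.+1 c <= k.+1%:R * Aseq k c.
Proof.
move=> c0; rewrite /Aseq /cmseq factS natrM.
rewrite [leLHS](_ : _ = k.+1%:R * (k`!%:R * (c * stj (cst 1) k.+1%:R c))); last by ring.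
do 2 (rewrite ler_wpM2l//).
have iS : mu.-integrable `]0, +oo[ (EFin \o
    (fun x => (cst 1) x * (coshR x + c) `^ (-1 - k.+1%:R))).
  by apply: (@integrable_stj _ _ 1) => // x _; rewrite normr1.
rewrite /stj -RintegralZl//; apply: le_Rintegral => //.
- exact: integrable_scale.
- by apply: (@integrable_stj _ _ 1) => // x _; rewrite normr1.
move=> x _; rewrite /= !mul1r.
have cx : 0 < coshR x + c by rewrite addr_gt0// coshR_gt0.
apply: (@le_trans _ _ ((coshR x + c) * (coshR x + c) `^ (-1 - k.+1%:R))).
  by rewrite ler_wpM2r ?powR_ge0// lerDr ltW// coshR_gt0.
rewrite -{1}[coshR x + c]powRr1 ?(ltW cx)// -powRD ?(gt_eqF cx) ?implybT//.
by rewrite -natr1 le_eqVlt; apply/orP; left; apply/eqP; congr (_ `^ _); ring.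
Qed.

Lemma Aseq0E (r : R) : 0 < r -> Aseq 0 (coshR r) = r / sinhR r.
Proof.
move=> r0; have s0 := sinhR_gt0 r0.
rewrite /Aseq /cmseq fact0 mul1r /stj.
pose f (x : R) := (coshR x + coshR r)^-1.
have cx x : 0 < coshR x + coshR r by rewrite addr_gt0// coshR_gt0.
(* Partial fractions in [expR x] give this primitive, which vanishes at
   infinity. *)
pose P (x : R) := (ln (1 + expR (- x - r)) - ln (1 + expR (- x + r))) / sinhR r.
have e1 (b x : R) : 0 < 1 + expR (- x + b) by rewrite addr_gt0// expR_gt0.
have dl (b x : R) : is_derive x 1 (fun x => ln (1 + expR (- x + b)))
    (- expR (- x + b) / (1 + expR (- x + b))).
  have d1 : is_derive x 1 (fun x : R => 1 + expR (- x + b)) (- expR (- x + b)).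
    have d2 : is_derive x 1 (fun x : R => expR (- x + b)) (- expR (- x + b)).
      apply: (is_derive_chain (f := expR) (g := fun x : R => - x + b)).
      by rewrite addr0 mulrN1.
    by apply: is_derive_eq (is_deriveD (is_derive_cst (1 : R) x (1 : R)) d2) _; rewrite add0r.
  apply: (is_derive_chain (f := @ln R) (g := fun x => 1 + expR (- x + b))
    (is_derive1_ln (e1 b x)) d1).
  by rewrite mulrC.
have cf : continuous f.
  move=> x; apply: cvgV; first by rewrite gt_eqF.
  by apply: cvgD; [exact: continuous_coshR|exact: cvg_cst].
have dP (x : R) : is_derive x 1 P (f x).
  have d1 := dl (- r) x; have d2 := dl r x.
  rewrite /P; apply: is_derive_eq; rewrite /GRing.scale/= /f.
  have h1 := e1 r x; have h2 := e1 (- r) x.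
  move: (cx x) h1 h2; rewrite /coshR /sinhR !expRD.
  have := expRxMexpNx_1 x; have := expRxMexpNx_1 r.
  have := expR_gt0 x; have := expR_gt0 r.
  move: s0; rewrite /sinhR.
  set a := expR x; set a' := expR (- x); set b := expR r; set b' := expR (- r).
  move=> + b0 a0 hb ha + + +.
  have -> : a' = a^-1 by rewrite -[RHS]mul1r -ha mulrAC divff ?gt_eqF// mul1r.
  have -> : b' = b^-1 by rewrite -[RHS]mul1r -hb mulrAC divff ?gt_eqF// mul1r.
  move=> s0 hc h1 h2.
  have b1 : 1 < b by rewrite expR_gt1.
  have ab : 0 < a * b by rewrite mulr_gt0.
  have b2 : 1 < b * b by rewrite -[ltLHS]mul1r ltr_pM.
  field; rewrite (gt_eqF a0) (gt_eqF b0)/= !gt_eqF//; try lra.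
  by rewrite addr_gt0// mulr_gt0// addr_gt0// mulr_gt0.
have Pl : P x @[x --> +oo] --> (0 : R).
  rewrite -[0](mul0r (sinhR r)^-1); apply: cvgMl.
  rewrite -[X in _ --> X](subrr (ln 1)).
  have eb (b : R) : ln (1 + expR (- x + b)) @[x --> +oo] --> ln (1 : R).
    apply: (@cvg_comp _ _ _ (fun x => 1 + expR (- x + b)) (@ln R) _ (nbhs (1 : R))).
      have h : expR (- x) * expR b @[x --> +oo] --> 0 * expR b.
        by apply: cvgMl; exact: cvgr_expR.
      under eq_fun do rewrite expRD.
      have := cvgD (cvg_cst (1 : R)) h; rewrite mul0r addr0; exact.
    exact: continuous_ln.
  by apply: cvgB; exact: eb.
have H : (\int[mu]_(x in `]0%R, +oo[) (f x)%:E = (0 - P 0)%:E)%E.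
  apply: ge0_FTC => // x _; last exact: cf.
  by rewrite invr_ge0 ltW.
rewrite (_ : r / sinhR r = fine (0 - P 0)%:E); last first.
  rewrite /= /P sub0r oppr0 !add0r -mulNr opprB; congr (_ / _).
  rewrite -ln_div ?posrE ?addr_gt0 ?expR_gt0//.
  rewrite (_ : _ / _ = expR r) ?expRK//.
  apply: (mulIf (_ : 1 + expR (- r) != 0)).
    by rewrite gt_eqF// addr_gt0// expR_gt0.
  rewrite mulfVK; last by rewrite gt_eqF// addr_gt0// expR_gt0.
  by rewrite mulrDr mulr1 expRxMexpNx_1 addrC.
rewrite -H /Rintegral; congr fine; apply: eq_integral => x _.
by rewrite /= mul1r subr0 powR_inv1// ltW.
Qed.

Lemma Aseq0_arccosh (c : R) : 1 < c -> Aseq 0 c * sinhR (arccosh c) = arccosh c.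
Proof.
move=> c1; have r0 := arccosh_gt0 c1.
rewrite -{1}[c](coshR_arccosh (ltW c1)) Aseq0E// divfK//.
by rewrite gt_eqF// sinhR_gt0.
Qed.

Lemma Aseq1E (c : R) : 1 < c -> (c ^+ 2 - 1) * Aseq 1 c = c * Aseq 0 c - 1.
Proof.
move=> c1; have c21 : 0 < c ^+ 2 - 1 by rewrite subr_gt0 exprn_egt1.
have s0 : 0 < Num.sqrt (c ^+ 2 - 1) by rewrite sqrtr_gt0.
have ds : is_derive c 1 (fun x : R => Num.sqrt (x ^+ 2 - 1))
    (c / Num.sqrt (c ^+ 2 - 1)).
  apply: (is_derive_chain (f := @Num.sqrt R) (g := fun x => x ^+ 2 - 1)
    (is_derive1_sqrt c21)).
  by rewrite /GRing.scale/= invfM; field; rewrite gt_eqF.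
have dA := dseq_Aseq 0 c1.
have d1 : is_derive c 1 (fun x => Aseq 0 x * Num.sqrt (x ^+ 2 - 1))
  (- Aseq 1 c * Num.sqrt (c ^+ 2 - 1) + Aseq 0 c * (c / Num.sqrt (c ^+ 2 - 1))).
  by apply: is_derive_eq (is_deriveM dA ds) _; rewrite /GRing.scale/=; ring.
(* Differentiate [Aseq 0 * sinh = arccosh]. *)
have : 'D_1 (fun x => Aseq 0 x * Num.sqrt (x ^+ 2 - 1)) c = 'D_1 (@arccosh R) c.
  apply: near_eq_derive => //; near=> y.
  have y1 : 1 < y by near: y; exact: lt_nbhsr.
  by rewrite -sinhR_arccosh ?(ltW y1)// Aseq0_arccosh.
have [_ ->] := d1; have [_ ->] := is_derive_arccosh c1.
have s2 := sqr_sqrtr (ltW c21).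
set s := Num.sqrt _ in s0 s2 *; set x := Aseq 1 c; set y := Aseq 0 c => h.
have sn0 : s != 0 by rewrite gt_eqF.
have : s * (- x * s + y * (c / s)) = s * s^-1 by rewrite h.
rewrite divff// mulrDr [s * (y * _)](_ : _ = c * y); last by field.
move=> e; rewrite -s2 -e; ring.
Unshelve. all: by end_near. Qed.

Lemma expRN_coshRBsinhR (r : R) : coshR r - sinhR r = expR (- r).
Proof. by rewrite /coshR /sinhR; field. Qed.

(** [sinh^2 A_1 = r coth r - 1], which is at most [r]. *)
Lemma Aseq1_bound (r : R) : 0 < r -> sinhR r ^+ 2 * Aseq 1 (coshR r) <= r.
Proof.
move=> r0; have s0 := sinhR_gt0 r0.
have c1 : 1 < coshR r by rewrite -[ltLHS]coshR0 ltr_coshR.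
have := Aseq1E c1; rewrite coshR_sqr [1 + _]addrC addrK => ->.
rewrite Aseq0E// lerBlDr mulrA ler_pdivrMr//.
have := expRN_coshRBsinhR r; have : expR (- r) <= 1 by rewrite expR_le1; lra.
have := sinhR_ge_id (ltW r0) => rs e1 /(canRL (subrK _)) ->.
have := ler_wpM2l (ltW r0) e1; lra.
Qed.

(** Multiplied by [sinh r], the left-hand side is [cosh r - r / sinh r], and
    [cosh r - sinh r = e^(- r) <= r / sinh r]. *)
Lemma Bseq1_bound (r : R) : 0 < r ->
  sinhR r * (Aseq 0 (coshR r) - coshR r * Aseq 1 (coshR r)) <= 1.
Proof.
move=> r0; have s0 := sinhR_gt0 r0.
have c1 : 1 < coshR r by rewrite -[ltLHS]coshR0 ltr_coshR.
have := Aseq1E c1; have c2 := coshR_sqr r.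
rewrite c2 [1 + _]addrC addrK => A1.
have e : sinhR r * (sinhR r * (Aseq 0 (coshR r) - coshR r * Aseq 1 (coshR r))) =
    coshR r - Aseq 0 (coshR r).
  transitivity (sinhR r ^+ 2 * Aseq 0 (coshR r) - coshR r * (sinhR r ^+ 2 * Aseq 1 (coshR r))).
    by ring.
  rewrite A1 (_ : sinhR r ^+ 2 = coshR r ^+ 2 - 1); first by ring.
  by rewrite c2 addrAC subrr add0r.
rewrite -(ler_pM2l s0) mulr1 e lerBlDr Aseq0E// -lerBlDl expRN_coshRBsinhR.
rewrite ler_pdivlMr// /sinhR mulrA mulrBr -!expRD addNr expR0.
have := expR_ge1Dx (- r - r); lra.
Qed.

End ConstantOne.

(** * Elementary inequalities *)

Section ElementaryBounds.
Context {R : realType}.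
Implicit Types (x y z u v : R).

Lemma norm_sin_le x : `|sin x| <= `|x|.
Proof.
wlog x0 : x / 0 <= x => [H|].
  have [/H//|/ltW x0] := leP 0 x.
  by have := H (- x); rewrite sinN !normrN; apply; lra.
rewrite (ger0_norm x0); move: x0; rewrite le_eqVlt => /predU1P[<-|x0].
  by rewrite sin0 normr0.
have cI : {within `[0, x], continuous (@sin R)}.
  by apply: continuous_subspaceT; exact: continuous_sin.
have [c _] := MVT x0 (fun z _ => is_derive_sin z) cI.
rewrite sin0 !subr0 => ->; rewrite normrM (gtr0_norm x0).
by rewrite -[leRHS]mul1r ler_wpM2r ?cos_max// ltW.
Qed.

Lemma one_minus_cosE x : 1 - cos x = 2 * sin (x / 2) ^+ 2.
Proof.
have {1}-> : x = (x / 2) *+ 2 by rewrite -mulr_natr; field.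
by rewrite cos_mulr2n cos2sin2; ring.
Qed.

Lemma one_minus_cos_ub x : `|cos x - 1| <= `|x|.
Proof.
rewrite distrC one_minus_cosE normrM normrX (ger0_norm (ler0n _ 2)).
apply: (@le_trans _ _ (2 * (1 * `|x / 2|))).
  by rewrite ler_wpM2l// expr2 ler_pM ?sin_max ?norm_sin_le.
rewrite mul1r normrM [X in _ * (_ * X)]gtr0_norm// le_eqVlt; apply/orP; left.
by apply/eqP; field.
Qed.

Definition kap : R := cos 1 ^+ 2 / 2.

Lemma kap_gt0 : 0 < kap.
Proof. by rewrite divr_gt0// exprn_gt0// cos1_gt0. Qed.

Lemma kap_le : kap <= 2^-1.
Proof.
by rewrite /kap -[leRHS]mul1r ler_pM2r ?invr_gt0// exprn_ile1 ?cos_le1// ltW// cos1_gt0.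
Qed.

Lemma one_minus_cos_lb y : 0 <= y -> y <= 1 -> kap * y ^+ 2 <= 1 - cos y.
Proof.
rewrite le_eqVlt => /predU1P[<- _|y0 y1].
  by rewrite cos0 subrr expr0n mulr0.
have h0 : 0 < y / 2 by lra.
have cI : {within `[0, y / 2], continuous (@sin R)}.
  by apply: continuous_subspaceT; exact: continuous_sin.
have [c cI'] := MVT h0 (fun z _ => is_derive_sin z) cI.
rewrite sin0 !subr0 one_minus_cosE => ->.
have c01 : cos 1 <= cos c.
  have := @pihalf_ge1 R; move: cI'; rewrite in_itv/= => /andP[c0 c2] p1.
  rewrite leNgt; apply/negP; rewrite ltr_cos ?in_itv/=; lra.
have c10 := @cos1_gt0 R.
rewrite (_ : 2 * _ ^+ 2 = cos c ^+ 2 / 2 * y ^+ 2); last by field.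
by rewrite ler_wpM2r ?sqr_ge0// ler_pM2r// lerXn2r// nnegrE; lra.
Qed.

Lemma coshR_norm x : coshR `|x| = coshR x.
Proof. by case: (ger0P x) => // _; rewrite coshRN. Qed.

Lemma norm_sinhR_ge x : `|x| <= `|sinhR x|.
Proof.
wlog x0 : x / 0 <= x => [H|].
  have [/H//|/ltW x0] := leP 0 x.
  by have := H (- x); rewrite sinhRN !normrN; apply; lra.
by rewrite (ger0_norm x0) ger0_norm ?sinhR_ge0// sinhR_ge_id.
Qed.

Lemma norm_sinhR_le_id x : `|sinhR x| <= `|x| * coshR x.
Proof.
wlog x0 : x / 0 <= x => [H|].
  have [/H//|/ltW x0] := leP 0 x.
  by have := H (- x); rewrite sinhRN coshRN !normrN; apply; lra.
rewrite (ger0_norm x0) ger0_norm ?sinhR_ge0//; move: x0.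
rewrite le_eqVlt => /predU1P[<-|x0]; first by rewrite sinhR0 mul0r.
have cI : {within `[0, x], continuous (@sinhR R)}.
  by apply: continuous_subspaceT; exact: continuous_sinhR.
have [c] := MVT x0 (fun z _ => is_derive_sinhR z) cI.
rewrite in_itv/= => /andP[c0 cx].
rewrite sinhR0 !subr0 => ->; rewrite mulrC ler_wpM2l ?ler_coshR//; lra.
Qed.

Lemma coshR_le_expR x : coshR x <= expR `|x|.
Proof.
rewrite -coshR_norm -coshRDsinhR lerDl sinhR_ge0//.
Qed.

(** A quadratic lower bound that keeps an exponentially large factor. *)
Lemma coshR_sub1_ge x : (x * coshR (x / 4)) ^+ 2 / 2 <= coshR x - 1.
Proof.
have -> : coshR x - 1 = 2 * sinhR (x / 2) ^+ 2.
  have {1}-> : x = x / 2 + x / 2 by field.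
  by rewrite coshRD -!expr2 coshR_sqr; ring.
have -> : x / 2 = x / 4 + x / 4 by field.
rewrite sinhRD.
have h : (x / 4) ^+ 2 <= sinhR (x / 4) ^+ 2.
  by rewrite -[leLHS]real_normK ?num_real// -[leRHS]real_normK ?num_real//
    lerXn2r ?nnegrE ?norm_sinhR_ge.
rewrite (_ : 2 * _ ^+ 2 = 8 * coshR (x / 4) ^+ 2 * sinhR (x / 4) ^+ 2); last by ring.
rewrite (_ : _ / 2 = 8 * coshR (x / 4) ^+ 2 * (x / 4) ^+ 2); last by field.
by rewrite ler_wpM2l// mulr_ge0// sqr_ge0.
Qed.

Lemma expRN_lip u v : 0 <= u -> 0 <= v -> `|expR (- u) - expR (- v)| <= `|u - v :> R|.
Proof.
wlog uv : u v / u <= v => [H u0 v0|].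
  have [uv|/ltW vu] := leP u v; first exact: H.
  by rewrite distrC [leRHS]distrC; exact: H.
move=> u0 v0; rewrite ger0_norm; last by rewrite subr_ge0 ler_expR; lra.
rewrite ler0_norm; last lra.
have -> : - v = - u + - (v - u) by ring.
rewrite expRD -{1}[expR (- u)]mulr1 -mulrBr.
have := expR_ge1Dx (- (v - u)) => h.
apply: (@le_trans _ _ (1 * (v - u))); last lra.
rewrite ler_pM ?expR_ge0//; [|by rewrite expR_le1; lra|lra].
by rewrite subr_ge0 expR_le1; lra.
Qed.

Lemma expR_sub1_le (u : R) : 0 <= u -> expR u - 1 <= u * expR u.
Proof.
move=> u0; have := expR_ge1Dx (- u); have := expRxMexpNx_1 u; have := expR_gt0 u.
set e := expR u; set e' := expR (- u) => e0 ee h.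
have := ler_wpM2l (ltW e0) h; rewrite ee; lra.
Qed.

Lemma poly_exp_le x : (1 + `|x|) / coshR (x / 4) <= 16 * expR (- (`|x| / 8)).
Proof.
have h1 : (coshR (x / 4))^-1 <= 2 * expR (- (`|x| / 4)).
  by rewrite -coshR_norm normrM (gtr0_norm (_ : 0 < 4^-1)) ?coshRV_le// invr_gt0.
have h2 : 1 + `|x| <= 8 * expR (`|x| / 8).
  have := expR_ge1Dx (`|x| / 8); lra.
apply: (@le_trans _ _ (8 * expR (`|x| / 8) * (2 * expR (- (`|x| / 4))))).
  by rewrite ler_pM// ?invr_ge0 ?(ltW (coshR_gt0 _))// addr_ge0.
rewrite (_ : 8 * _ * _ = 16 * (expR (`|x| / 8) * expR (- (`|x| / 4)))); last by ring.
by rewrite -expRD ler_wpM2l// ler_expR; lra.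
Qed.

End ElementaryBounds.

(** * Contour shift *)

Lemma is_derive_div (R : realType) (f g : R -> R) (x a b : R) :
  is_derive x 1 f a -> is_derive x 1 g b -> g x != 0 ->
  is_derive x 1 (fun y => f y / g y) ((a * g x - f x * b) / g x ^+ 2).
Proof.
move=> df dg gx0.
have dV : is_derive x 1 (fun y => (g y)^-1) (- (g x) ^- 2 * b).
  exact: is_deriveV.
apply: is_derive_eq (is_deriveM df dV) _.
by rewrite /GRing.scale/=; field.
Qed.

Lemma is_derive_scalel (R : realType) (k x : R) :
  is_derive x 1 (fun y : R => k * y) k.
Proof. by apply: is_derive_eq; rewrite /GRing.scale/= mulr1. Qed.

Section Contour.
Context {R : realType}.
Notation mu := (@lebesgue_measure R).
Variable a : R.
Implicit Types (r x y : R).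

(** With [z = x + i y], these are the ingredients of
    [e^(- a z^2) coth((z - r) / 2) = kf - i hf]:
    [cP] and [cphi] are the modulus and minus the argument of the Gaussian, [cD] is the
    denominator of [coth((z - r) / 2) = (sinh(x - r) - i sin y) / (cosh(x - r) - cos y)],
    [cM] and [- cN] the real and imaginary parts of the numerator. *)
Definition cP y x : R := expR (- (a * x ^+ 2)) * expR (a * y ^+ 2).

Definition cphi y x : R := 2 * a * y * x.

Definition cD r y x : R := coshR (x - r) - cos y.

Definition cN r y x : R :=
  cos (cphi y x) * sin y + sin (cphi y x) * sinhR (x - r).

Definition cM r y x : R :=
  cos (cphi y x) * sinhR (x - r) - sin (cphi y x) * sin y.

(** The derivative of [cN] in [y]. *)
Definition cNy r y x : R :=
  - (2 * a * x) * sin (cphi y x) * sin y + cos (cphi y x) * cos y +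
  2 * a * x * cos (cphi y x) * sinhR (x - r).

Definition hf r y x : R := cP y x * cN r y x / cD r y x.

Definition kf r y x : R := cP y x * cM r y x / cD r y x.

Definition df r y x : R :=
  cP y x * (2 * a * y * cN r y x + cNy r y x) / cD r y x -
  cP y x * cN r y x * sin y / cD r y x ^+ 2.

Lemma is_derive_cPy x y : is_derive y 1 (cP ^~ x) (2 * a * y * cP y x).
Proof.
have d : is_derive y 1 (fun y => expR (a * y ^+ 2)) (expR (a * y ^+ 2) * (a * (2 * y))).
  apply: (is_derive_chain (f := expR) (g := fun y => a * y ^+ 2)).
  by rewrite /GRing.scale/=; ring.
by apply: is_derive_eq; rewrite /GRing.scale/= /cP; ring.
Qed.

Lemma is_derive_cPx x y : is_derive x 1 (cP y) (- (2 * a * x) * cP y x).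
Proof.
have d : is_derive x 1 (fun y => expR (- (a * y ^+ 2))) (expR (- (a * x ^+ 2)) * (- (a * (2 * x)))).
  apply: (is_derive_chain (f := expR) (g := fun y => - (a * y ^+ 2))).
  by rewrite /GRing.scale/=; ring.
by apply: is_derive_eq; rewrite /GRing.scale/= /cP; ring.
Qed.

Lemma is_derive_trig_y (f f' : R -> R) x y : (forall z : R, is_derive z 1 f (f' z)) ->
  is_derive y 1 (fun y => f (cphi y x)) (f' (cphi y x) * (2 * a * x)).
Proof.
move=> df; apply: (is_derive_chain (f := f) (g := fun y => cphi y x)).
by rewrite /GRing.scale/= /cphi; ring.
Qed.

Lemma is_derive_trig_x (f f' : R -> R) x y : (forall z : R, is_derive z 1 f (f' z)) ->
  is_derive x 1 (fun x => f (cphi y x)) (f' (cphi y x) * (2 * a * y)).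
Proof.
move=> df; apply: (is_derive_chain (f := f) (g := fun x => cphi y x)).
by rewrite /GRing.scale/= /cphi; ring.
Qed.

Lemma is_derive_subr (f f' : R -> R) r x : (forall z : R, is_derive z 1 f (f' z)) ->
  is_derive x 1 (fun x => f (x - r)) (f' (x - r)).
Proof.
move=> df; apply: (is_derive_chain (f := f) (g := fun x => x - r)).
by rewrite subr0 mulr1.
Qed.

Lemma is_derive_hf r x y : cD r y x != 0 -> is_derive y 1 (hf r ^~ x) (df r y x).
Proof.
move=> D0.
have dc := @is_derive_trig_y cos (fun x => - sin x) x y (@is_derive_cos R).
have ds := @is_derive_trig_y sin cos x y (@is_derive_sin R).
have dP := is_derive_cPy x y.
have dN : is_derive y 1 (cN r ^~ x) (cNy r y x).
  by apply: is_derive_eq; rewrite /GRing.scale/= /cNy; ring.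
have dD : is_derive y 1 (cD r ^~ x) (sin y).
  have -> : cD r ^~ x = (fun y => cst (coshR (x - r)) y - cos y) by [].
  by apply: is_derive_eq; ring.
have dPN : is_derive y 1 (fun y => cP y x * cN r y x) _ := is_deriveM dP dN.
apply: is_derive_eq (is_derive_div dPN dD D0) _.
by rewrite /GRing.scale/= /df; field.
Qed.

(** With [is_derive_hf], this is one of the Cauchy-Riemann equations. *)
Lemma is_derive_kf r x y : cD r y x != 0 -> is_derive x 1 (kf r y) (- df r y x).
Proof.
move=> D0.
have dc := @is_derive_trig_x cos (fun x => - sin x) x y (@is_derive_cos R).
have ds := @is_derive_trig_x sin cos x y (@is_derive_sin R).
have dsh := @is_derive_subr _ _ r x (@is_derive_sinhR R).
have dch := @is_derive_subr _ _ r x (@is_derive_coshR R).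
have dP := is_derive_cPx x y.
have dM : is_derive x 1 (cM r y)
   (- sin (cphi y x) * (2 * a * y) * sinhR (x - r) + cos (cphi y x) * coshR (x - r)
    - cos (cphi y x) * (2 * a * y) * sin y).
  by apply: is_derive_eq; rewrite /GRing.scale/=; ring.
have dD : is_derive x 1 (cD r y) (sinhR (x - r)).
  by apply: is_derive_eq; rewrite subr0.
have dPM : is_derive x 1 (fun x => cP y x * cM r y x) _ := is_deriveM dP dM.
apply: is_derive_eq (is_derive_div dPM dD D0) _.
rewrite /GRing.scale/= /df /cNy /cN /cM.
have c2 := coshR_sqr (x - r); have s2 := cos2Dsin2 y.
move: D0; rewrite /cD.
move: c2 s2; move: (coshR (x - r)) (sinhR (x - r)) (cos y) (sin y).
move: (cos (cphi y x)) (sin (cphi y x)) (cP y x) => C S P ch sh c s c2 s2 D0.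
(* The only relation needed: both Pythagorean identities at once. *)
have e : s ^+ 2 + sh ^+ 2 = (ch - c) * (ch + c).
  by transitivity (ch ^+ 2 - c ^+ 2); [rewrite c2 -s2|]; ring.
apply: (mulIf (_ : (ch - c) ^+ 2 != 0)); first by rewrite expf_neq0.
transitivity (P * ((ch - c) * ((-(2 * a * x)) * (C * sh - S * s) +
  (- S * (2 * a * y) * sh + C * ch - C * (2 * a * y) * s)) - (C * sh - S * s) * sh)).
  by field.
transitivity (- (P * ((ch - c) * (2 * a * y * (C * s + S * sh) + (- (2 * a * x) * S * s + C * c + 2 * a * x * C * sh))
   - (C * s + S * sh) * s))); last by field.
transitivity (P * ((ch - c) * ((-(2 * a * x)) * (C * sh - S * s) +
  (- S * (2 * a * y) * sh + C * ch - C * (2 * a * y) * s)) + S * s * sh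
   - C * ((ch - c) * (ch + c) - s ^+ 2))); first by rewrite -e; ring.
ring.
Qed.

End Contour.

Section FTCDominated.
Context {R : realType}.
Notation mu := (@lebesgue_measure R).

Lemma integrable_add (D : set R) (f g : R -> R) : measurable D ->
  mu.-integrable D (EFin \o f) -> mu.-integrable D (EFin \o g) ->
  mu.-integrable D (EFin \o (fun x => f x + g x)).
Proof. by move=> mD; exact: integrableD. Qed.

Lemma is_derive_expRN (x : R) : is_derive x 1 (fun x => expR (- x)) (- expR (- x)).
Proof.
apply: (is_derive_chain (f := expR) (g := fun x : R => - x)).
by rewrite mulrN1.
Qed.

(** The fundamental theorem on a half-line for an integrand of variable sign. *)
Lemma dominated_FTC (f F : R -> R) (C l : R) :
  (forall x : R, 0 <= x -> `|f x| <= C * expR (- x)) ->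
  (forall x : R, 0 <= x -> is_derive x 1 F (f x)) ->
  (forall x : R, 0 <= x -> {for x, continuous f}) ->
  F x @[x --> +oo] --> l ->
  \int[mu]_(x in `]0, +oo[) f x = l - F 0.
Proof.
move=> fC dF cf Fl.
(* Adding the dominating exponential reduces to a nonnegative integrand. *)
pose g (x : R) := C * expR (- x).
have g0 x : 0 <= x -> 0 <= g x by move=> x0; apply: le_trans (fC x x0).
have dg (x : R) : is_derive x 1 (fun x => - C * expR (- x)) (g x).
  have d := is_derive_expRN x.
  by apply: is_derive_eq; rewrite /GRing.scale/= /g; ring.
have cg (x : R) : {for x, continuous g}.
  have d := is_derive_expRN x.
  by apply: (@is_derive_continuous _ _ _ (C * - expR (- x))); apply: is_derive_eq.
have gl : - C * expR (- x) @[x --> +oo] --> (0 : R).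
  by rewrite -(mulr0 (- C)); apply: cvgMr; exact: cvgr_expR.
have Ig : (\int[mu]_(x in `]0%R, +oo[) (g x)%:E = (0 - (- C * expR (- 0)))%:E)%E.
  by apply: ge0_FTC => // x _.
have fg0 x : 0 <= x -> 0 <= f x + g x.
  by move=> x0; have := fC x x0; rewrite ler_norml -/(g x) => /andP[]; lra.
have Ifg : (\int[mu]_(x in `]0%R, +oo[) (f x + g x)%:E =
    (l + 0 - (F 0 + - C * expR (- 0)))%:E)%E.
  apply: (@ge0_FTC _ (fun x => f x + g x) (fun x => F x + - C * expR (- x))).
  - exact: fg0.
  - move=> x x0; have d1 := dF x x0; have d2 := dg x.
    exact: is_deriveD.
  - by move=> x x0; apply: continuousD; [exact: cf|exact: cg].
  - exact: cvgD.
have mf : measurable_fun (`]0, +oo[ : set R) f.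
  apply: open_continuous_measurable_fun => // x; rewrite inE/= in_itv/= andbT.
  by move=> /ltW; exact: cf.
have ig : mu.-integrable `]0, +oo[ (EFin \o g).
  exact: integrable_scale integrable_expRN.
have if_ : mu.-integrable `]0, +oo[ (EFin \o f).
  apply: (integrable_le (measurable_itv _) mf ig) => x.
  by rewrite /= in_itv/= andbT => /ltW; exact: fC.
have : (\int[mu]_(x in `]0, +oo[) (f x + g x) =
    \int[mu]_(x in `]0, +oo[) f x + \int[mu]_(x in `]0, +oo[) g x)%R.
  exact: RintegralD.
rewrite {1 3}/Rintegral Ifg Ig /= => /esym /(canRL (addrK _)) ->.
ring.
Qed.

End FTCDominated.

Section ContourBounds.
Context {R : realType}.
Notation mu := (@lebesgue_measure R).
Variable a : R.
Hypothesis a0 : 0 < a.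
Implicit Types (r x y d : R).

Lemma norm_sinhR_le x : `|sinhR x| <= coshR x.
Proof.
rewrite /sinhR /coshR normrM [X in _ * X]ger0_norm// ler_pM2r//.
rewrite (le_trans (ler_normB _ _))// !ger0_norm ?expR_ge0//.
Qed.

Lemma norm_trig_le (u v s t c : R) : `|u| <= 1 -> `|v| <= 1 -> `|s| <= c ->
  `|t| <= c -> `|u * s + v * t| <= 2 * c.
Proof.
move=> u1 v1 sc tc; rewrite (le_trans (ler_normD _ _))// !normrM.
by rewrite (_ : 2 * c = 1 * c + 1 * c) ?lerD ?ler_pM//; ring.
Qed.

Local Opaque coshR sinhR.

Lemma cD_lb r y x d : 0 <= d -> d <= 1 -> d <= 1 - cos y ->
  d * coshR (x - r) <= cD r y x.
Proof.
move=> d0 d1 dy; rewrite /cD; have := coshR_ge1 (x - r) => c1.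
by have := ler_wpM2l (_ : 0 <= 1 - d) c1; rewrite subr_ge0 => /(_ d1); lra.
Qed.

Lemma cN_ub r y x : `|cN a r y x| <= 2 * coshR (x - r).
Proof.
by rewrite /cN norm_trig_le ?cos_max ?sin_max ?norm_sinhR_le//
  (le_trans (sin_max _))// coshR_ge1.
Qed.

Lemma cM_ub r y x : `|cM a r y x| <= 2 * coshR (x - r).
Proof.
by rewrite /cM -mulrN norm_trig_le ?cos_max ?sin_max ?norm_sinhR_le// normrN
  (le_trans (sin_max _))// coshR_ge1.
Qed.

Lemma cNy_ub r y x : 0 <= x -> `|cNy a r y x| <= (4 * a * x + 1) * coshR (x - r).
Proof.
move=> x0; have ax : 0 <= 2 * a * x by rewrite !mulr_ge0// ltW.
have h1 := coshR_ge1 (x - r).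
rewrite (_ : cNy a r y x = 2 * a * x * (cos (cphi a y x) * sinhR (x - r) +
    sin (cphi a y x) * - sin y) + cos (cphi a y x) * cos y); last first.
  by rewrite /cNy; ring.
rewrite (_ : _ * coshR (x - r) = 2 * a * x * (2 * coshR (x - r)) + coshR (x - r));
  last by ring.
rewrite (le_trans (ler_normD _ _))// lerD//.
  rewrite normrM (ger0_norm ax) ler_wpM2l// norm_trig_le ?cos_max ?sin_max//.
    exact: norm_sinhR_le.
  by rewrite normrN (le_trans (sin_max _)).
rewrite normrM (le_trans _ h1)// -[leRHS]mulr1.
by rewrite ler_pM ?cos_max.
Qed.

(** Exponentials of the maxima of [a y^2] for [y] in [0, 8] and of [2 x - a x^2]; the
    bound 8 leaves room for the whole period [2 pi]. *)
Definition cK : R := expR (64 * a) * expR a^-1.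

Lemma cP_ub y x : 0 <= y <= 8 -> 0 <= x ->
  cP a y x * (1 + x) <= cK * expR (- x).
Proof.
move=> /andP[y0 y8] x0; rewrite /cP /cK.
apply: (@le_trans _ _ (expR (- (a * x ^+ 2)) * expR (a * y ^+ 2) * expR x)).
  by rewrite ler_wpM2l ?expR_ge1Dx// mulr_ge0// expR_ge0.
rewrite -!expRD ler_expR.
have : a * y ^+ 2 <= a * 64.
  rewrite ler_wpM2l ?(ltW a0)//.
    rewrite (_ : (64 : R) = 8 ^+ 2); last by ring.
    by rewrite lerXn2r// nnegrE.
have : 0 <= a * (x - a^-1) ^+ 2 by rewrite mulr_ge0 ?sqr_ge0// ltW.
rewrite (_ : a * (x - _) ^+ 2 = a * x ^+ 2 - 2 * x + a^-1); last first.
  by field; rewrite gt_eqF.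
lra.
Qed.

Lemma cP_ge0 y x : 0 <= cP a y x.
Proof. by rewrite mulr_ge0// expR_ge0. Qed.

Lemma hkf_ub (N : R) r y x d : 0 < d -> d <= 1 -> d <= 1 - cos y ->
  0 <= y <= 8 -> 0 <= x -> `|N| <= 2 * coshR (x - r) ->
  `|cP a y x * N / cD r y x| <= cK * (2 / d) * expR (- x).
Proof.
move=> d0 d1 dy y8 x0 NU.
have c0 := coshR_gt0 (x - r); have D1 := @cD_lb r y x d (ltW d0) d1 dy.
have D0 : 0 < cD r y x by apply: lt_le_trans D1; rewrite mulr_gt0.
rewrite -mulrA normrM (ger0_norm (cP_ge0 _ _)).
apply: (@le_trans _ _ (cP a y x * (1 + x) * (2 / d))); last first.
  by rewrite [leRHS]mulrAC ler_wpM2r ?cP_ub// divr_ge0// ltW.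
rewrite -mulrA ler_wpM2l ?cP_ge0//.
apply: (@le_trans _ _ (2 / d)); last first.
  by rewrite ler_peMl ?divr_ge0 ?(ltW d0)//; lra.
rewrite normrM normfV (gtr0_norm D0) ler_pdivrMr// (le_trans NU)//.
rewrite (_ : 2 * coshR (x - r) = 2 / d * (d * coshR (x - r))).
  by rewrite ler_wpM2l ?divr_ge0 ?(ltW d0).
by field; rewrite gt_eqF.
Qed.

Lemma hf_ub r y x d : 0 < d -> d <= 1 -> d <= 1 - cos y ->
  0 <= y <= 8 -> 0 <= x -> `|hf a r y x| <= cK * (2 / d) * expR (- x).
Proof. by move=> *; apply: hkf_ub => //; exact: cN_ub. Qed.

Lemma kf_ub r y x d : 0 < d -> d <= 1 -> d <= 1 - cos y ->
  0 <= y <= 8 -> 0 <= x -> `|kf a r y x| <= cK * (2 / d) * expR (- x).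
Proof. by move=> *; apply: hkf_ub => //; exact: cM_ub. Qed.

Lemma df_ub r y x d : 0 < d -> d <= 1 -> d <= 1 - cos y ->
  0 <= y <= 8 -> 0 <= x ->
  `|df a r y x| <= cK * ((36 * a + 1) / d + 2 / d ^+ 2) * expR (- x).
Proof.
move=> d0 d1 dy y8 x0.
have c0 := coshR_gt0 (x - r); have c1 := coshR_ge1 (x - r).
have D1 := @cD_lb r y x d (ltW d0) d1 dy.
have dc : 0 < d * coshR (x - r) by rewrite mulr_gt0.
have D0 : 0 < cD r y x by apply: lt_le_trans D1.
have P0 := cP_ge0 y x.
apply: (@le_trans _ _ (cP a y x * (1 + x) * ((36 * a + 1) / d + 2 / d ^+ 2))); last first.
  rewrite [leRHS]mulrAC ler_wpM2r ?cP_ub// addr_ge0// divr_ge0//.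
  - by have := ltW a0; lra.
  - exact: ltW.
  - by rewrite exprn_ge0// ltW.
have Nub := cN_ub r y x; have Nyub := cNy_ub r y x0.
rewrite /df; move: P0 D1 D0 Nub Nyub.
set P := cP a y x; set D := cD r y x; set N := cN a r y x; set Ny := cNy a r y x.
set c := coshR (x - r) in c0 c1 dc *; move=> P0 D1 D0 Nub Nyub.
rewrite (le_trans (ler_normB _ _))// [leRHS]mulrDr lerD//.
  rewrite -!(mulrA P) normrM (ger0_norm P0) ler_wpM2l// normrM normfV (gtr0_norm D0).
  rewrite ler_pdivrMr//.
  apply: (@le_trans _ _ ((36 * a + 1) * (1 + x) * c)).
    rewrite (le_trans (ler_normD _ _))//.
    apply: (@le_trans _ _ (2 * a * 8 * (2 * c) + (4 * a * x + 1) * c)).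
      rewrite lerD// normrM ler_pM//.
      case/andP: y8 => y0 y8; rewrite ger0_norm; last by rewrite !mulr_ge0// ltW.
      by rewrite ler_wpM2l// mulr_ge0// ltW.
    rewrite (_ : 2 * a * 8 * _ + _ = (32 * a + 4 * a * x + 1) * c); last by ring.
    rewrite ler_pM2r// (_ : _ * (1 + x) = 36 * a + 36 * (a * x) + 1 + x); last by ring.
    have := ltW a0; have := mulr_ge0 (ltW a0) x0; lra.
  rewrite [leRHS](_ : _ = ((36 * a + 1) * (1 + x)) * (d^-1 * D)); last by ring.
  rewrite ler_wpM2l ?mulr_ge0//; [by have := ltW a0; lra|by lra|].
  by rewrite mulrC ler_pdivlMr// mulrC.
rewrite -!(mulrA P) normrM (ger0_norm P0) ler_wpM2l// !normrM normfV.
rewrite (gtr0_norm (exprn_gt0 2 D0)).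
apply: (@le_trans _ _ (2 / d ^+ 2)); last first.
  by rewrite ler_peMl ?divr_ge0 ?exprn_ge0 ?(ltW d0)//; lra.
rewrite ler_pdivrMr ?exprn_gt0//.
apply: (@le_trans _ _ (2 * c ^+ 2)).
  rewrite expr2 mulrA ler_pM// (le_trans (sin_max _))//.
rewrite (_ : 2 * c ^+ 2 = 2 / d ^+ 2 * (d * c) ^+ 2); last first.
  by field; rewrite gt_eqF.
rewrite ler_wpM2l ?divr_ge0 ?exprn_ge0 ?(ltW d0)//.
by rewrite lerXn2r ?nnegrE ?(ltW dc) ?(ltW D0).
Qed.

End ContourBounds.

(* Kept folded so that unification and arithmetic do not see the exponentials. *)
Local Opaque coshR sinhR.

Section ContourConstant.
Context {R : realType}.
Notation mu := (@lebesgue_measure R).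
Variable a : R.
Hypothesis a0 : 0 < a.
Implicit Types (r x y d : R).

Lemma one_minus_cos_gt0 y : 0 < y -> y < 2 * pi -> 0 < 1 - cos y.
Proof.
move=> y0 y2; have -> : y = (y / 2) *+ 2 by rewrite -mulr_natr; field.
rewrite cos_mulr2n cos2sin2.
have s0 : 0 < sin (y / 2) by apply: sin_gt0_pi; lra.
have := exprn_gt0 2 s0; rewrite -mulr_natr; lra.
Qed.

Lemma cD_gt0 r y x : 0 < y -> y < 2 * pi -> 0 < cD r y x.
Proof.
move=> y0 y2; have := one_minus_cos_gt0 y0 y2; have := coshR_ge1 (x - r).
rewrite /cD; lra.
Qed.

Lemma continuous_cP y : continuous (cP a y).
Proof. by move=> x; exact: is_derive_continuous (is_derive_cPx a x y). Qed.

Lemma continuous_ccos y : continuous (fun x => cos (cphi a y x)).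
Proof.
move=> x.
exact: is_derive_continuous (@is_derive_trig_x R a cos (fun x => - sin x) x y (@is_derive_cos R)).
Qed.

Lemma continuous_csin y : continuous (fun x => sin (cphi a y x)).
Proof.
move=> x.
exact: is_derive_continuous (@is_derive_trig_x R a sin cos x y (@is_derive_sin R)).
Qed.

Lemma continuous_csinh r : continuous (fun x => sinhR (x - r)).
Proof.
move=> x.
have d := @is_derive_subr R (@sinhR R) (@coshR R) r x (@is_derive_sinhR R).
exact: is_derive_continuous d.
Qed.

Lemma continuous_ccosh r : continuous (fun x => coshR (x - r)).
Proof.
move=> x.
have d := @is_derive_subr R (@coshR R) (@sinhR R) r x (@is_derive_coshR R).
exact: is_derive_continuous d.
Qed.

Lemma continuous_cN r y : continuous (cN a r y).
Proof.
move=> x; apply: cvgD.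
  by apply: cvgM; [exact: continuous_ccos|exact: cvg_cst].
by apply: cvgM; [exact: continuous_csin|exact: continuous_csinh].
Qed.

Lemma continuous_cNy r y : continuous (cNy a r y).
Proof.
have cx : continuous (fun x => 2 * a * x).
  by move=> x; exact: is_derive_continuous (is_derive_scalel (2 * a) x).
move=> x; apply: cvgD.
  apply: cvgD; last first.
    by apply: cvgM; [exact: continuous_ccos|exact: cvg_cst].
  apply: cvgM; last exact: cvg_cst.
  by apply: cvgM; [apply: cvgN; exact: cx|exact: continuous_csin].
apply: cvgM; last exact: continuous_csinh.
by apply: cvgM; [exact: cx|exact: continuous_ccos].
Qed.

Lemma continuous_cDV r y : 0 < y -> y < 2 * pi -> continuous (fun x => (cD r y x)^-1).
Proof.
move=> y0 y2 x; apply: cvgV; first by rewrite gt_eqF// cD_gt0.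
by apply: cvgB; [exact: continuous_ccosh|exact: cvg_cst].
Qed.

Lemma continuous_hf r y : 0 < y -> y < 2 * pi -> continuous (hf a r y).
Proof.
move=> y0 y2 x; apply: cvgM; last exact: continuous_cDV.
by apply: cvgM; [exact: continuous_cP|exact: continuous_cN].
Qed.

Lemma continuous_df r y : 0 < y -> y < 2 * pi -> continuous (df a r y).
Proof.
move=> y0 y2 x; apply: cvgB.
  apply: cvgM; last exact: continuous_cDV.
  apply: cvgM; first exact: continuous_cP.
  apply: cvgD; last exact: continuous_cNy.
  by apply: cvgM; [exact: cvg_cst|exact: continuous_cN].
rewrite (_ : (fun x => _) = (fun x => cP a y x * cN a r y x * sin y * ((cD r y x)^-1 * (cD r y x)^-1))); last first.
  by apply/funext => z; rewrite expr2 invfM.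
rewrite /continuous_at expr2 invfM.
apply: (@cvgM _ _ _ _ _ (fun z => (cD r y z)^-1 * (cD r y z)^-1)); last first.
  by apply: cvgM; exact: continuous_cDV.
apply: cvgM; last exact: cvg_cst.
by apply: cvgM; [exact: continuous_cP|exact: continuous_cN].
Qed.

Lemma hf_integrable r y : 0 < y -> y < 2 * pi ->
  mu.-integrable `]0, +oo[ (EFin \o hf a r y).
Proof.
move=> y0 y2; pose d := Num.min 1 (1 - cos y).
have d0 : 0 < d by rewrite lt_min ltr01 one_minus_cos_gt0.
have mh : measurable_fun (`]0, +oo[ : set R) (hf a r y).
  apply: measurable_funTS; apply: continuous_measurable_fun.
  exact: continuous_hf.
apply: (integrable_le (measurable_itv _) mh
  (integrable_scale (cK a * (2 / d)) (measurable_itv _) integrable_expRN)).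
move=> x; rewrite /= in_itv/= andbT => x0.
have := @pihalf_lt2 R; have := @pi_ge0 R => p0 p2.
apply: hf_ub => //; rewrite ?ge_min ?lexx ?orbT//; [lra|exact: ltW].
Qed.

(** The integral of [hf a r y] over the whole line, folded at 0: [hf] satisfies
    [hf r y (- x) = hf (- r) y x]. *)
Definition Jf r y : R := \int[mu]_(x in `]0, +oo[) (hf a r y x + hf a (- r) y x).

Lemma kf_cvg r y : 0 < y -> y < 2 * pi -> kf a r y x @[x --> +oo] --> (0 : R).
Proof.
move=> y0 y2; pose d := Num.min 1 (1 - cos y).
have d0 : 0 < d by rewrite lt_min ltr01 one_minus_cos_gt0.
have h : cK a * (2 / d) * expR (- x) @[x --> +oo] --> (0 : R).
  by rewrite -(mulr0 (cK a * (2 / d))); apply: cvgMr; exact: cvgr_expR.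
apply: norm_cvg0; apply: (@squeeze_cvgr _ _ _ _ (cst 0) _ _ _ _ _ h); last exact: cvg_cst.
near=> x; rewrite normr_ge0/=.
have := @pihalf_lt2 R; have := @pi_ge0 R => p0 p2.
by apply: kf_ub => //; rewrite ?ge_min ?lexx ?orbT//; lra.
Unshelve. all: by end_near. Qed.

Lemma integral_df r y : 0 < y -> y < 2 * pi ->
  \int[mu]_(x in `]0, +oo[) (df a r y x + df a (- r) y x) = 0.
Proof.
move=> y0 y2; pose d := Num.min 1 (1 - cos y).
have d0 : 0 < d by rewrite lt_min ltr01 one_minus_cos_gt0.
have := @pihalf_lt2 R; have := @pi_ge0 R => p0 p2.
pose C := cK a * ((36 * a + 1) / d + 2 / d ^+ 2).
pose F (x : R) := - (kf a r y x + kf a (- r) y x).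
transitivity (0 - F 0); last first.
  (* On the imaginary axis the two conjugates for [r] and [- r] cancel. *)
  rewrite /F sub0r opprK /kf /cM /cphi mulr0 sin0 cos0 !mul1r !mul0r !subr0.
  by rewrite /cD !sub0r opprK coshRN sinhRN mulrN mulNr addNr.
have H1 (x : R) : 0 <= x ->
    `|df a r y x + df a (- r) y x| <= (C + C) * expR (- x).
  move=> x0; rewrite mulrDl (le_trans (ler_normD _ _))// lerD// /C;
  by apply: df_ub => //; rewrite ?ge_min ?lexx ?orbT//; lra.
have H2 (x : R) : 0 <= x -> is_derive x 1 F (df a r y x + df a (- r) y x).
  move=> x0.
  have d1 := @is_derive_kf R a r x y (lt0r_neq0 (cD_gt0 _ _ y0 y2)).
  have d2 := @is_derive_kf R a (- r) x y (lt0r_neq0 (cD_gt0 _ _ y0 y2)).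
  apply: is_derive_eq (is_deriveN (is_deriveD d1 d2)) _.
  by rewrite opprD !opprK.
have H3 (x : R) : 0 <= x ->
    {for x, continuous (fun x => df a r y x + df a (- r) y x)}.
  by move=> _; apply: cvgD; exact: continuous_df.
have H4 : F x @[x --> +oo] --> (0 : R).
  rewrite -oppr0 -(addr0 (0 : R)); apply: cvgN.
  by apply: cvgD; exact: kf_cvg.
exact: dominated_FTC H1 H2 H3 H4.
Qed.

(** Moving the contour: the [y]-derivative of the integrand is an [x]-derivative, whose
    integral vanishes by [integral_df]. *)
Lemma is_derive_Jf r y : 0 < y -> y < 2 * pi -> is_derive y 1 (Jf r) 0.
Proof.
move=> y0 y2; have := @pihalf_lt2 R; have := @pi_ge0 R => p0 p2.
(* Any lower bound of [1 - cos z] valid in a neighbourhood of [y] serves to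
   dominate the derivatives there. *)
pose d := Num.min 1 ((1 - cos y) / 2).
have c0 := one_minus_cos_gt0 y0 y2.
have d0 : 0 < d by rewrite lt_min ltr01 divr_gt0.
have [e e0 He] : exists2 e : R, 0 < e & forall z, y - e < z < y + e ->
    [/\ 0 < z, z < 2 * pi & d <= 1 - cos z].
  have : \forall z \near y, [/\ 0 < z, z < 2 * pi & d <= 1 - cos z].
    near=> z; split.
    - by near: z; exact: lt_nbhsr.
    - by near: z; exact: lt_nbhsl.
    - rewrite ge_min; apply/orP; right; apply: ltW; near: z.
      have cc : 1 - cos z @[z --> y] --> 1 - cos y.
        by apply: cvgB; [exact: cvg_cst|exact: continuous_cos].
      by apply: (cvgr_gt _ cc); lra.
  move=> /nbhs_ballP[e /= e0 H]; exists e => // z ze; apply: H.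
  by rewrite /ball/= ltr_norml; lra.
pose C := cK a * ((36 * a + 1) / d + 2 / d ^+ 2).
rewrite -(integral_df r y0 y2).
have H1 : y - e < y < y + e by lra.
have H2 (z : R) : y - e < z < y + e -> mu.-integrable `]0, +oo[
    (EFin \o (fun x => hf a r z x + hf a (- r) z x)).
  move=> /He[z0 z2 _].
  by apply: integrable_add => //; exact: hf_integrable.
have H3 (z x : R) : y - e < z < y + e -> `]0, +oo[%classic x ->
    is_derive z 1 (fun z => hf a r z x + hf a (- r) z x)
      (df a r z x + df a (- r) z x).
  move=> /He[z0 z2 _] _.
  have d1 := @is_derive_hf R a r x z (lt0r_neq0 (cD_gt0 _ _ z0 z2)).
  have d2 := @is_derive_hf R a (- r) x z (lt0r_neq0 (cD_gt0 _ _ z0 z2)).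
  exact: is_deriveD.
have H4 : mu.-integrable `]0, +oo[ (EFin \o (fun x : R => (C + C) * expR (- x))).
  exact: integrable_scale integrable_expRN.
have H5 (z x : R) : y - e < z < y + e -> `]0, +oo[%classic x ->
    `|df a r z x + df a (- r) z x| <= (C + C) * expR (- x).
  move=> /He[z0 z2 dz]; rewrite /= in_itv/= andbT => x0.
  rewrite mulrDl (le_trans (ler_normD _ _))// lerD// /C;
  by apply: df_ub => //; rewrite ?ge_min ?lexx ?orbT//; lra.
exact: (is_derive_integral (measurable_itv _) H1 H2 H3 H4 H5).
Unshelve. all: by end_near. Qed.

Lemma Jf_const r y : 0 < y -> y <= pi -> Jf r y = Jf r pi.
Proof.
move=> y0; rewrite le_eqVlt => /predU1P[->//|yp].
have := @pi_gt0 R => p0.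
have dI z : z \in `]y, pi[ -> is_derive z 1 (Jf r) ((fun=> 0) z).
  by rewrite in_itv/= => /andP[yz zp]; apply: is_derive_Jf; lra.
have cI : {within `[y, pi], continuous (Jf r)}.
  apply: derivable_within_continuous => z; rewrite in_itv/= => /andP[yz zp].
  by have [] : is_derive z 1 (Jf r) 0 by apply: is_derive_Jf; lra.
have [z _] := MVT yp dI cI.
by rewrite mul0r => /eqP; rewrite subr_eq0 => /eqP.
Qed.

End ContourConstant.

(** * The limit of the contour on the real axis *)

Section PoissonKernel.
Local Transparent coshR sinhR.
Context {R : realType}.
Notation mu := (@lebesgue_measure R).
Implicit Types (r x y : R).

Lemma is_derive_poisson y x : 0 < y -> y < pi ->
  is_derive x 1 (fun x => 2 * atan ((expR x - cos y) / sin y))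
    (sin y / (coshR x - cos y)).
Proof.
move=> y0 yp; have s0 : 0 < sin y by apply: sin_gt0_pi; rewrite y0.
have d1 : is_derive x 1 (fun x => (expR x - cos y) / sin y) (expR x / sin y).
  by apply: is_derive_eq; rewrite /GRing.scale/=; field; rewrite gt_eqF.
have d2 : is_derive x 1 (fun x => atan ((expR x - cos y) / sin y)) _ :=
  is_derive_chain (g := fun x => (expR x - cos y) / sin y) (is_derive1_atan _) d1 erefl.
apply: is_derive_eq; rewrite /GRing.scale/=.
have D0 : 0 < coshR x - cos y.
  by rewrite subr_gt0 (lt_le_trans _ (coshR_ge1 x))// -subr_gt0 one_minus_cos_gt0//; lra.
move: D0; rewrite /coshR expRN; have := expR_gt0 x; have := cos2Dsin2 y.
set e := expR x; set c := cos y; set s := sin y in s0 *; move=> cs e0 D0.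
have D1 : 0 < s ^+ 2 + (e - c) ^+ 2 by rewrite ltr_wpDr ?sqr_ge0// exprn_gt0.
have D2 : 0 < e ^+ 2 + 1 - 2 * c * e.
  rewrite [ltRHS](_ : _ = (e + e^-1) / 2 * (2 * e) - c * (2 * e)).
    by rewrite -mulrBl mulr_gt0// mulr_gt0.
  by field; rewrite gt_eqF.
have E : s ^+ 2 + (e - c) ^+ 2 = e ^+ 2 + 1 - 2 * c * e.
  by transitivity (c ^+ 2 + s ^+ 2 + e ^+ 2 - 2 * c * e); [|rewrite cs]; ring.
have -> : 1 + ((e - c) / s) ^+ 2 = (e ^+ 2 + 1 - 2 * c * e) / s ^+ 2.
  by rewrite -E; field; rewrite gt_eqF.
have -> : (e + e^-1) / 2 - c = (e ^+ 2 + 1 - 2 * c * e) / (2 * e).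
  by field; rewrite gt_eqF.
move: D2; set W := _ - 2 * c * e => D2.
by field; rewrite (gt_eqF s0) (gt_eqF D2) (gt_eqF e0).
Qed.

(** The left-hand side does not depend on [r], by differentiation; take [r = 0]. *)
Lemma poisson_at0 y r : 0 < y -> y < pi ->
  2 * atan ((expR r - cos y) / sin y) + 2 * atan ((expR (- r) - cos y) / sin y) = 2 * y.
Proof.
move=> y0 yp; have s0 : 0 < sin y by apply: sin_gt0_pi; rewrite y0.
pose Q (r : R) := 2 * atan ((expR r - cos y) / sin y) + 2 * atan ((expR (- r) - cos y) / sin y).
have dQ (x : R) : is_derive x 1 Q 0.
  have d1 := is_derive_poisson x y0 yp.
  have d2 := is_derive_poisson (- x) y0 yp.
  have d3 : is_derive x 1 (fun x => 2 * atan ((expR (- x) - cos y) / sin y))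
     (- (sin y / (coshR x - cos y))).
    apply: (is_derive_chain (f := fun x => 2 * atan ((expR x - cos y) / sin y))
      (g := fun x : R => - x) d2).
    by rewrite coshRN mulrN1.
  by apply: is_derive_eq (is_deriveD d1 d3) _; rewrite subrr.
have := is_derive_0_is_cst r 0 dQ; rewrite /Q => ->.
rewrite oppr0 expR0 -mulrDr -mulr2n.
have p2 : 0 < cos (y / 2) by apply: cos_gt0_pihalf; lra.
have q2 : 0 < sin (y / 2) by apply: sin_gt0_pi; lra.
have -> : (1 - cos y) / sin y = tan (y / 2).
  have {1 2}-> : y = (y / 2) *+ 2 by rewrite -mulr_natr; field.
  move: (y / 2) p2 q2 => h p2 q2.
  rewrite cos_mulr2n sin_mulr2n cos2sin2 /tan; field.
  by rewrite (gt_eqF p2) gt_eqF.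
rewrite tanK; last by rewrite in_itv/=; lra.
by rewrite -mulr_natr; field.
Qed.

(** The Poisson kernel of the strip, which carries the singularity of [hf] at [x = r] as
    [y] tends to 0. *)
Definition Vf r y x : R := sin y / cD r y x.

Lemma Vf_ge0 r y x : 0 < y -> y < pi -> 0 <= Vf r y x.
Proof.
move=> y0 yp; rewrite divr_ge0// ltW//; last by apply: cD_gt0 => //; lra.
by apply: sin_gt0_pi; rewrite y0.
Qed.

Lemma continuous_Vf r y : 0 < y -> y < pi -> continuous (Vf r y).
Proof.
move=> y0 yp x; apply: cvgM; first exact: cvg_cst.
by apply: continuous_cDV => //; lra.
Qed.

Lemma Vf_ub r y x d : 0 < d -> d <= 1 -> d <= 1 - cos y ->
  `|Vf r y x| <= 2 / d * expR r * expR (- x).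
Proof.
move=> d0 d1 dy.
have D1 := @cD_lb R r y x d (ltW d0) d1 dy.
have c0 := coshR_gt0 (x - r).
have dc : 0 < d * coshR (x - r) by rewrite mulr_gt0.
have D0 : 0 < cD r y x by exact: lt_le_trans D1.
rewrite normrM normfV (gtr0_norm D0).
apply: (@le_trans _ _ (1 * (d * coshR (x - r))^-1)).
  by rewrite ler_pM ?sin_max ?invr_ge0 ?(ltW D0)// lef_pV2 ?posrE.
rewrite mul1r invfM -!mulrA -expRD mulrCA ler_wpM2l ?invr_ge0 ?(ltW d0)//.
have := coshRV_le (x - r).
by rewrite (_ : - (x - r) = r - x)//; ring.
Qed.

Lemma Vf_integrable r y : 0 < y -> y < pi -> mu.-integrable `]0, +oo[ (EFin \o Vf r y).
Proof.
move=> y0 yp; pose d := Num.min 1 (1 - cos y).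
have d0 : 0 < d by rewrite lt_min ltr01 one_minus_cos_gt0//; lra.
have mh : measurable_fun (`]0, +oo[ : set R) (Vf r y).
  apply: measurable_funTS; apply: continuous_measurable_fun.
  exact: continuous_Vf.
apply: (integrable_le (measurable_itv _) mh
  (integrable_scale (2 / d * expR r) (measurable_itv _) integrable_expRN)).
by move=> x _; apply: Vf_ub => //; rewrite ge_min ?lexx ?orbT.
Qed.

Lemma integral_Vf r y : 0 < y -> y < pi ->
  \int[mu]_(x in `]0, +oo[) (Vf r y x + Vf (- r) y x) = 2 * (pi - y).
Proof.
move=> y0 yp; have s0 : 0 < sin y by apply: sin_gt0_pi; rewrite y0.
pose G (r x : R) := 2 * atan ((expR (x - r) - cos y) / sin y).
have dG (s x : R) : is_derive x 1 (G s) (Vf s y x).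
  apply: (is_derive_chain (f := fun x => 2 * atan ((expR x - cos y) / sin y))
    (g := fun x : R => x - s) (is_derive_poisson (x - s) y0 yp)).
  by rewrite subr0 mulr1.
have Gl s : G s x @[x --> +oo] --> 2 * (pi / 2 : R).
  apply: cvgMr.
  apply: (@cvg_comp _ _ _ (fun x => (expR (x - s) - cos y) / sin y) (@atan R) _ (pinfty_nbhs R)).
    apply/cvgryPge => A; near=> z.
    rewrite ler_pdivlMr//; have := expR_ge1Dx (z - s); have := cos_le1 y.
    have : A * sin y + s <= z by near: z; apply: nbhs_pinfty_ge; exact: num_real.
    lra.
  exact: cvgy_atan.
have H1 (x : R) : 0 <= x -> 0 <= Vf r y x + Vf (- r) y x.
  by move=> _; rewrite addr_ge0// Vf_ge0.
have H2 (x : R) : 0 <= x -> is_derive x 1 (fun x => G r x + G (- r) x) (Vf r y x + Vf (- r) y x).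
  by move=> _; exact: is_deriveD.
have H3 (x : R) : 0 <= x -> {for x, continuous (fun x => Vf r y x + Vf (- r) y x)}.
  by move=> _; apply: cvgD; exact: continuous_Vf.
have H4 : G r x + G (- r) x @[x --> +oo] --> 2 * (pi / 2) + 2 * (pi / 2 : R).
  by apply: cvgD.
rewrite /Rintegral (ge0_FTC H1 H2 H3 H4)/= /G !sub0r opprK addrC.
rewrite (addrC (2 * atan _)) poisson_at0//; field.
Unshelve. all: by end_near. Qed.

End PoissonKernel.

Section ContourLimit.
Context {R : realType}.
Notation mu := (@lebesgue_measure R).
Variable a : R.
Hypothesis a0 : 0 < a.
Implicit Types (r x y : R).

(** What is left of [hf] when the contribution of its pole is removed; it converges to 0
    outside [r] and is dominated uniformly in the height. *)
Definition gf r y x : R := hf a r y x - expR (- (a * r ^+ 2)) * Vf r y x.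

Lemma gfE r y x : cD r y x != 0 ->
  gf r y x = (cP a y x * cos (cphi a y x) - expR (- (a * r ^+ 2))) * sin y / cD r y x
    + cP a y x * sin (cphi a y x) * sinhR (x - r) / cD r y x.
Proof. by move=> D0; rewrite /gf /hf /Vf /cN; field. Qed.

(** Near the pole [cD] is of size [(x - r)^2 + y^2], and it grows exponentially away
    from it; the factor [cosh((x - r) / 4)] keeps enough of that growth. *)
Lemma cD_lbs r y x : 0 < y -> y <= 1 ->
  (`|x - r| + y) * y * coshR ((x - r) / 4) <= 2 / kap * cD r y x /\
  y * `|x - r| <= (2 * kap)^-1 * cD r y x.
Proof.
move=> y0 y1; set z := x - r; set h := coshR (z / 4).
have k0 := @kap_gt0 R; have k2 := @kap_le R.
have h1 : 1 <= h := coshR_ge1 _.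
have ch : h <= coshR z.
  rewrite /h -(coshR_norm z) -(coshR_norm (z / 4)) ler_coshR// normrM.
  by rewrite (gtr0_norm (_ : 0 < 4^-1)) ?invr_gt0// -ler_pdivlMr// ; have := normr_ge0 z; lra.
have D1 : kap * y ^+ 2 + (coshR z - 1) <= cD r y x.
  by rewrite /cD -/z; have := one_minus_cos_lb (ltW y0) y1; lra.
have D2 := coshR_sub1_ge z; rewrite -/h in D2.
have zh : (`|z| * h) ^+ 2 = (z * h) ^+ 2 by rewrite !exprMn real_normK ?num_real.
have kK : kap * kap^-1 = 1 :> R by rewrite divff// gt_eqF.
have D0 : 0 <= cD r y x.
  by have := sqr_ge0 (z * h); have := mulr_ge0 (ltW k0) (sqr_ge0 y); lra.
have A : y * (`|z| * h) <= (2 * kap)^-1 * cD r y x.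
  have e : kap * (2 * (y * (`|z| * h))) <= cD r y x.
    apply: (@le_trans _ _ (kap * (y ^+ 2 + (`|z| * h) ^+ 2))).
      by rewrite ler_wpM2l ?(ltW k0)//; have := sqr_ge0 (y - `|z| * h); lra.
    have := ler_wpM2r (sqr_ge0 (z * h)) k2; rewrite zh; lra.
  have k20 : 0 < 2 * kap :> R by rewrite pmulr_rgt0.
  rewrite [leRHS]mulrC ler_pdivlMr//.
  by apply: le_trans e; rewrite le_eqVlt; apply/orP; left; apply/eqP; ring.
have B : y * y * h <= kap^-1 * cD r y x.
  rewrite [leRHS]mulrC ler_pdivlMr//.
  have y2 : y ^+ 2 <= 1 by rewrite exprn_ile1// ltW.
  have ky : kap * y ^+ 2 <= 1.
    by have := ler_pM (ltW k0) (sqr_ge0 y) k2 y2; lra.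
  have := mulr_ge0 (_ : 0 <= 1 - kap * y ^+ 2) (_ : 0 <= coshR z - 1).
  rewrite !subr_ge0 coshR_ge1 => /(_ ky isT) p.
  have := ler_wpM2l (mulr_ge0 (ltW k0) (sqr_ge0 y)) ch.
  rewrite (_ : y * y * h * kap = kap * y ^+ 2 * h); last by ring.
  lra.
split.
  rewrite (_ : (`|z| + y) * y * h = y * (`|z| * h) + y * y * h); last by ring.
  rewrite invfM in A.
  by have := mulr_ge0 (ltW (_ : 0 < kap^-1 :> R)) D0; rewrite invr_gt0 => /(_ k0); lra.
apply: le_trans A; rewrite ler_wpM2l ?(ltW y0)// -[leLHS]mulr1 ler_wpM2l//.
Qed.

Definition cC0 r : R := a * expR a * (1 + 2 * `|r|) + a * expR a + 2 * a * (1 + `|r|).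

Lemma cphi_ub r y x : 0 < y -> `|cphi a y x| <= 2 * a * y * (`|x - r| + `|r|).
Proof.
move=> y0; have ay : 0 <= 2 * a * y by rewrite !mulr_ge0 ?(ltW a0)// ltW.
rewrite /cphi normrM (ger0_norm ay) ler_wpM2l//.
by rewrite -{1}(subrK r x) ler_normD.
Qed.

(** The Gaussian differs from its value at the pole by a multiple of the distance to the
    pole, which compensates one factor of the denominator. *)
Lemma cE_ub r y x : 0 < y -> y <= 1 ->
  `|cP a y x * cos (cphi a y x) - expR (- (a * r ^+ 2))| <=
  cC0 r * ((`|x - r| + y) * (1 + `|x - r|)).
Proof.
move=> y0 y1; have z0 := normr_ge0 (x - r); set z := `|x - r| in z0 *.
have r0 := normr_ge0 r; have a1 := ltW a0.
have ea := expR_gt0 a; have e1 : 1 <= expR a.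
  by have := expR_ge1Dx a; lra.
set Ex := expR (- (a * x ^+ 2)); set p := expR (- (a * r ^+ 2)).
set Ey := expR (a * y ^+ 2); set C := cos (cphi a y x).
have p0 : 0 < p := expR_gt0 _.
have p1 : p <= 1 by rewrite expR_le1 oppr_le0 mulr_ge0// sqr_ge0.
have y2 : y ^+ 2 <= y by rewrite expr2 -[leRHS]mul1r ler_wpM2r// ltW.
have Eya : Ey <= expR a.
  by rewrite ler_expR -[leRHS]mulr1 ler_wpM2l//; lra.
have b1 : `|Ex - p| <= a * (z * (z + 2 * `|r|)).
  have ax := mulr_ge0 a1 (sqr_ge0 x); have ar := mulr_ge0 a1 (sqr_ge0 r).
  apply: (le_trans (expRN_lip ax ar)).
  rewrite -mulrBr normrM (gtr0_norm a0) ler_wpM2l//.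
  rewrite (_ : x ^+ 2 - r ^+ 2 = (x - r) * ((x - r) + 2 * r)); last by ring.
  rewrite normrM ler_wpM2l// (le_trans (ler_normD _ _))// normrM.
  by rewrite (ger0_norm (ler0n _ 2)).
have b2 : `|Ey * C| <= expR a.
  rewrite normrM (gtr0_norm (expR_gt0 _)) -[leRHS]mulr1.
  by rewrite ler_pM ?expR_ge0 ?cos_max.
have b3 : `|Ey - 1| <= a * expR a * y.
  rewrite ger0_norm; last by have := expR_ge1Dx (a * y ^+ 2); have := mulr_ge0 a1 (sqr_ge0 y); rewrite -/Ey; lra.
  apply: (le_trans (expR_sub1_le (mulr_ge0 a1 (sqr_ge0 y)))).
  rewrite [leRHS]mulrAC; apply: ler_pM => //; last by rewrite ler_wpM2l.
  by rewrite mulr_ge0// sqr_ge0.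
have b4 : `|C - 1| <= 2 * a * y * (z + `|r|).
  exact: le_trans (one_minus_cos_ub _) (cphi_ub r x y0).
(* The three factors [Ex], [Ey], [C] tend to [p], 1 and 1 separately. *)
have -> : cP a y x * C - p = (Ex - p) * (Ey * C) + p * ((Ey - 1) * C + (C - 1)).
  by rewrite /cP -/Ex -/Ey; ring.
apply: (@le_trans _ _ (a * (z * (z + 2 * `|r|)) * expR a + (a * expR a * y + 2 * a * y * (z + `|r|)))).
  rewrite (le_trans (ler_normD _ _))// lerD//.
    by rewrite normrM ler_pM.
  rewrite normrM (gtr0_norm p0) (le_trans (_ : _ <= 1 * `|(Ey - 1) * C + (C - 1)|))//.
    by rewrite ler_wpM2r.
  rewrite mul1r (le_trans (ler_normD _ _))// lerD// normrM.
  by rewrite -[leRHS]mulr1 ler_pM ?cos_max.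
rewrite [leRHS](_ : _ = a * expR a * (1 + 2 * `|r|) * ((z + y) * (1 + z)) +
  (a * expR a * ((z + y) * (1 + z)) + 2 * a * (1 + `|r|) * ((z + y) * (1 + z))));
  last by rewrite /cC0; ring.
apply: lerD; last apply: lerD.
- rewrite (_ : _ * expR a = a * expR a * (z * (z + 2 * `|r|))); last by ring.
  rewrite -[leRHS]mulrA ler_wpM2l ?mulr_ge0// ?(ltW ea)//.
  have : 0 <= y * (1 + z) by rewrite mulr_ge0; lra.
  have := mulr_ge0 r0 (_ : 0 <= y * (1 + z)); have := mulr_ge0 r0 (mulr_ge0 z0 z0).
  rewrite (_ : (1 + 2 * `|r|) * _ = z + z * z + y * (1 + z) +
     2 * (`|r| * z) + 2 * (`|r| * (z * z)) + 2 * (`|r| * (y * (1 + z)))); last by ring.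
  move=> h1 h2 h3; have := h2 h3; lra.
- rewrite ler_wpM2l ?mulr_ge0// ?(ltW ea)//.
  by have := mulr_ge0 (ltW y0) z0; have := mulr_ge0 z0 z0; lra.
- rewrite -[leLHS]mulrA -[leRHS]mulrA ler_wpM2l ?mulr_ge0//.
  have yz := mulr_ge0 (ltW y0) z0; have zz := mulr_ge0 z0 z0.
  have := mulr_ge0 r0 yz; have := mulr_ge0 r0 zz; have := mulr_ge0 r0 z0.
  have := mulr_ge0 r0 (ltW y0); lra.
Qed.

Definition cCg r : R := cC0 r * (2 / kap * (16 * expR (`|r| / 8))) +
  a * expR a / kap * expR (9 / (4 * a) + `|r|).

Lemma gf_ub r y x : 0 < y -> y <= 1 -> 0 <= x ->
  `|gf r y x| <= cCg r * expR (- (x / 8)).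
Proof.
move=> y0 y1 x0; have k0 := @kap_gt0 R; have a1 := ltW a0.
have p2 := @pi_ge2 R.
have D0 : 0 < cD r y x by apply: cD_gt0; lra.
have [D1 D2] := cD_lbs r x y0 y1.
rewrite gfE ?gt_eqF// (le_trans (ler_normD _ _))//.
have C00 : 0 <= cC0 r.
  have ea := ltW (expR_gt0 a).
  by rewrite /cC0 !addr_ge0 ?mulr_ge0 ?addr_ge0 ?mulr_ge0.
set z := x - r in D1 D2 *; have z0 := normr_ge0 z.
have xz : x <= `|z| + `|r| by rewrite -{1}(ger0_norm x0) -{1}(subrK r x) ler_normD.
have zx : `|z| <= x + `|r| by rewrite -{1}(ger0_norm x0) ler_normB.
have h1 := coshR_ge1 (z / 4).
rewrite [leRHS]mulrDl lerD//.
  apply: (@le_trans _ _ (cC0 r * ((`|z| + y) * (1 + `|z|)) * y / cD r y x)).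
    rewrite normrM normfV (gtr0_norm D0) ler_pM2r ?invr_gt0// normrM.
    rewrite ler_pM ?cE_ub// (le_trans (norm_sin_le _))//.
    by rewrite gtr0_norm.
  rewrite -!mulrA ler_wpM2l//.
  apply: (@le_trans _ _ (2 / kap * ((1 + `|z|) / coshR (z / 4)))).
    rewrite [leLHS](_ : _ = (1 + `|z|) * ((`|z| + y) * y / cD r y x)); last by ring.
    rewrite [leRHS]mulrCA ler_wpM2l ?addr_ge0// ler_pdivrMr// mulrAC.
    by rewrite ler_pdivlMr// (lt_le_trans ltr01 h1).
  rewrite -mulrA ler_wpM2l// ler_wpM2l ?invr_ge0 ?(ltW k0)//.
  apply: (le_trans (poly_exp_le _)); rewrite ler_wpM2l// -expRD ler_expR; lra.
apply: (@le_trans _ _ (expR a * expR (- (a * x ^+ 2)) * (2 * a * y * x) * (`|z| * coshR z) / cD r y x)).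
  rewrite normrM normfV (gtr0_norm D0) ler_pM2r ?invr_gt0// normrM.
  rewrite ler_pM ?norm_sinhR_le_id// normrM ler_pM//.
    rewrite /cP ger0_norm ?mulr_ge0 ?expR_ge0// mulrC ler_wpM2r ?expR_ge0//.
    by rewrite ler_expR -[leRHS]mulr1 ler_wpM2l// exprn_ile1// ltW.
  apply: (le_trans (norm_sin_le _)); rewrite ger0_norm// /cphi.
  by rewrite !mulr_ge0// ltW.
rewrite (_ : _ / cD r y x = expR a * (2 * a) * (expR (- (a * x ^+ 2)) * x * coshR z) * (y * `|z| / cD r y x)); last by ring.
apply: (@le_trans _ _ (expR a * (2 * a) * (expR (9 / (4 * a) + `|r|) * expR (- (x / 8))) * (2 * kap)^-1)); last first.
  rewrite le_eqVlt; apply/orP; left; apply/eqP; field.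
  by rewrite gt_eqF.
rewrite ler_pM//.
- by rewrite !mulr_ge0 ?expR_ge0// ltW// coshR_gt0.
- by rewrite !mulr_ge0 ?invr_ge0// ltW.
- rewrite ler_wpM2l ?mulr_ge0 ?expR_ge0//.
  apply: (@le_trans _ _ (expR (- (a * x ^+ 2)) * expR x * expR `|z|)).
    rewrite ler_pM ?mulr_ge0 ?expR_ge0 ?coshR_le_expR ?(ltW (coshR_gt0 _))//.
    by rewrite ler_wpM2l ?expR_ge0//; have := expR_ge1Dx x; lra.
  rewrite -!expRD ler_expR.
  (* [a x^2 >= 3 x - 9 / (4 a)] pays for [x], for [cosh] and for the decay. *)
  have : 0 <= a * (x - 3 / (2 * a)) ^+ 2 by rewrite mulr_ge0// sqr_ge0.
  rewrite (_ : a * _ ^+ 2 = a * x ^+ 2 - 3 * x + 9 / (4 * a)); last first.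
    by field; rewrite gt_eqF.
  lra.
- by rewrite ler_pdivrMr.
Qed.

End ContourLimit.

(** * Closed form of the transform of order zero *)

Section ClosedForm.
Context {R : realType}.
Notation mu := (@lebesgue_measure R).
Variable a : R.
Hypothesis a0 : 0 < a.
Implicit Types (r x y : R).

Lemma integrable_expRN8 :
  mu.-integrable `]0, +oo[ (EFin \o (fun x : R => expR (- (x / 8)))).
Proof.
have r0 : 0 < 8^-1 :> R by rewrite invr_gt0.
have h := @integrable_exponential_pdf R _ r0.
have h2 : mu.-integrable `]0, +oo[ (EFin \o (fun x => 8 * exponential_pdf 8^-1 x)).
  by apply: integrable_scale => //; apply: integrableS h.
apply: eq_integrable h2 => // x; rewrite inE/= in_itv/= andbT => x0.
rewrite /= exponential_pdfE ?(ltW x0)// mulrA divff// mul1r.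
by congr (expR _)%:E; ring.
Qed.

Lemma gf_integrable r y : 0 < y -> y < pi ->
  mu.-integrable `]0, +oo[ (EFin \o gf a r y).
Proof.
move=> y0 yp.
have h1 : mu.-integrable `]0, +oo[ (EFin \o hf a r y).
  by apply: hf_integrable => //; lra.
have h2 : mu.-integrable `]0, +oo[ (EFin \o (fun x => - expR (- (a * r ^+ 2)) * Vf r y x)).
  by apply: integrable_scale => //; exact: Vf_integrable.
have := integrable_add (measurable_itv _) h1 h2.
by apply: eq_integrable => // x _; rewrite /= /gf mulNr.
Qed.

Lemma Jf_gf r y : 0 < y -> y < pi ->
  \int[mu]_(x in `]0, +oo[) (gf a r y x + gf a (- r) y x) =
  Jf a r y - expR (- (a * r ^+ 2)) * (2 * (pi - y)).
Proof.
move=> y0 yp; rewrite /Jf -(integral_Vf r y0 yp).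
have iV : mu.-integrable `]0, +oo[ (EFin \o (fun x => Vf r y x + Vf (- r) y x)).
  by apply: integrable_add => //; exact: Vf_integrable.
have ih : mu.-integrable `]0, +oo[ (EFin \o (fun x => hf a r y x + hf a (- r) y x)).
  by apply: integrable_add => //; apply: hf_integrable => //; lra.
rewrite -RintegralZl// -RintegralB//; last exact: integrable_scale.
by apply: eq_Rintegral => x _; rewrite /gf sqrrN; ring.
Qed.

Lemma gf_cvg r x : x != r ->
  gf a r (@harmonic R n) x @[n --> \oo] --> (0 : R).
Proof.
move=> xr.
have D0 : cD r 0 x != 0.
  rewrite /cD cos0 subr_eq0 gt_eqF// -coshR_norm -coshR0 ltr_coshR//.
  by rewrite normr_gt0 subr_eq0.
have dV : is_derive (0 : R) 1 (Vf r ^~ x) ((cos 0 * cD r 0 x - sin 0 * sin 0) / cD r 0 x ^+ 2).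
  have dD : is_derive (0 : R) 1 (cD r ^~ x) (sin 0).
    have -> : cD r ^~ x = (fun y => cst (coshR (x - r)) y - cos y) by [].
    by apply: is_derive_eq; ring.
  exact: is_derive_div.
have dh := is_derive_hf a D0.
have c : {for 0, continuous (fun y => hf a r y x - expR (- (a * r ^+ 2)) * Vf r y x)}.
  apply: cvgB; first exact: is_derive_continuous dh.
  by apply: cvgM; [exact: cvg_cst|exact: is_derive_continuous dV].
have g0 : hf a r 0 x - expR (- (a * r ^+ 2)) * Vf r 0 x = 0.
  by rewrite /hf /cN /Vf /cphi; do 9 rewrite ?(mulr0, mul0r, sin0, addr0, subr0).
have := @cvg_comp _ _ _ (@harmonic R) (fun y => gf a r y x) _ _ _ cvg_harmonic c.
by rewrite /= g0.
Qed.

(** Let [y] tend to 0 in [Jf a r y]: [gf] disappears by dominated convergence, and the two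
    Poisson kernels have total mass [2 (pi - y)]. *)
Lemma Jf_pi r : 0 < r -> Jf a r pi = 2 * pi * expR (- (a * r ^+ 2)).
Proof.
move=> r0; set p := expR _.
(* Heights [1 / (n + 1)]: a sequence is what dominated convergence takes. *)
pose I n := \int[mu]_(x in `]0, +oo[) (gf a r (@harmonic R n) x + gf a (- r) (@harmonic R n) x).
have hn n : 0 < @harmonic R n <= 1.
  by rewrite /harmonic invr_gt0 ltr0n/= invf_le1 ?ltr0n// ler1n.
have p2 := @pi_ge2 R.
have IE n : I n = Jf a r pi - p * (2 * (pi - @harmonic R n)).
  have /andP[h0 h1] := hn n.
  by rewrite /I Jf_gf ?(Jf_const a0 r h0)//; lra.
have c1 : I n @[n --> \oo] --> Jf a r pi - p * (2 * (pi - 0)).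
  rewrite (funext IE); apply: cvgB; first exact: cvg_cst.
  apply: cvgM; first exact: cvg_cst.
  apply: cvgM; first exact: cvg_cst.
  by apply: cvgB; [exact: cvg_cst|exact: cvg_harmonic].
have ig n : mu.-integrable `]0, +oo[ (EFin \o
   (fun x => gf a r (@harmonic R n) x + gf a (- r) (@harmonic R n) x)).
  have /andP[h0 h1] := hn n.
  by apply: integrable_add => //; apply: gf_integrable => //; lra.
(* Pointwise convergence fails only at the pole [x = r]. *)
have c2 : I n @[n --> \oo] --> (0 : R).
  pose G (x : R) := (cCg a r + cCg a (- r)) * expR (- (x / 8)).
  have iG : mu.-integrable `]0, +oo[ (EFin \o G).
    exact: integrable_scale integrable_expRN8.
  have [] := @dominated_convergence _ _ _ mu `]0, +oo[%classic (measurable_itv _)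
    (fun n x => (gf a r (@harmonic R n) x + gf a (- r) (@harmonic R n) x)%:E)
    (cst 0%E) (EFin \o G) _ _ _ iG _.
  - by move=> n; exact: measurable_int (ig n).
  - exact: measurable_cst.
  - exists [set r]; split => //; first exact: lebesgue_measure_set1.
    move=> x /= xP; apply: contrapT => xr; apply: xP.
    rewrite in_itv/= andbT => x0; apply: cvg_EFin; first exact: nearW.
    rewrite /comp/= -(addr0 (0 : R)); apply: cvgD; apply: gf_cvg.
      exact/eqP.
    by rewrite gt_eqF//; lra.
  - apply: aeW => x n; rewrite /= in_itv/= andbT => /ltW x0.
    have /andP[h0 h1] := hn n.
    rewrite lee_fin /G mulrDl (le_trans (ler_normD _ _))// lerD//; exact: gf_ub.
  move=> _ _; rewrite integral0 => h.
  exact: (fine_cvg h).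
have := cvg_lim (@Rhausdorff R) c1; rewrite (cvg_lim (@Rhausdorff R) c2).
rewrite subr0 => /(_ _)/esym/eqP; rewrite subr_eq0 => /eqP ->; ring.
Qed.

(** The weight in the theta-integral of the kernel, where [a = 1 / (4 t)]. *)
Definition hw x : R := sinhR x * sin (2 * a * pi * x) * expR (- (a * x ^+ 2)).

Lemma measurable_hw : measurable_fun [set: R] hw.
Proof.
apply: measurable_funM; last first.
  apply: (measurableT_comp (f := expR)) => //.
  apply: measurableT_comp => //; apply: measurable_funM => //.
apply: measurable_funM; first exact: measurable_sinhR.
apply: continuous_measurable_fun => x.
apply: is_derive_continuous (@is_derive_trig_x R a (@sin R) (@cos R) x pi (@is_derive_sin R)).
Qed.

Lemma hw_ub x : 0 < x -> `|hw x| <= expR (4 * a)^-1.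
Proof.
move=> x0; rewrite /hw normrM (ger0_norm (expR_ge0 _)) normrM.
apply: (@le_trans _ _ (expR x * 1 * expR (- (a * x ^+ 2)))).
  rewrite ler_wpM2r ?expR_ge0// ler_pM ?sin_max//.
  rewrite ger0_norm ?sinhR_ge0 ?(ltW x0)//.
  by rewrite -coshRDsinhR lerDr ltW// coshR_gt0.
rewrite mulr1 -expRD ler_expR.
have : 0 <= a * (x - 1 / (2 * a)) ^+ 2 by rewrite mulr_ge0 ?sqr_ge0// ltW.
rewrite (_ : a * (x - _) ^+ 2 = a * x ^+ 2 - x + (4 * a)^-1); last first.
  by field; rewrite gt_eqF.
lra.
Qed.

(** At height [pi] the function [coth] becomes [tanh], and
    [tanh((x - r) / 2) + tanh((x + r) / 2) = 2 sinh x / (cosh x + cosh r)]. *)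
Lemma stj_hw0 r : 0 < r ->
  expR (a * pi ^+ 2) * stj hw 0 (coshR r) = pi * expR (- (a * r ^+ 2)).
Proof.
move=> r0.
have iS := @integrable_stj _ hw _ measurable_hw hw_ub 0 (coshR r) (coshR_gt0 r) (lexx 0).
have : Jf a r pi = 2 * expR (a * pi ^+ 2) * stj hw 0 (coshR r).
  rewrite /Jf /stj -RintegralZl//; apply: eq_Rintegral => x _.
  have c1 := coshR_gt0 (x - r); have c2 := coshR_gt0 (x + r).
  have c3 : 0 < coshR x + coshR r by rewrite addr_gt0 ?coshR_gt0.
  rewrite /hf /cN /cD sinpi cospi !mulr0 !add0r !opprK /hw /cphi subr0.
  rewrite powRN powRr1 ?(ltW c3)//.
  have e1 : sinhR (x - r) = sinhR x * coshR r - coshR x * sinhR r.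
    by rewrite sinhRD sinhRN coshRN mulrN.
  have e2 : coshR (x - r) = coshR x * coshR r - sinhR x * sinhR r.
    by rewrite coshRD sinhRN coshRN mulrN.
  move: c1 c2; rewrite e1 e2 sinhRD coshRD.
  have hx := coshR_sqr x; have hr := coshR_sqr r.
  move: c3 hx hr; rewrite /cP.
  move: (coshR x) (sinhR x) (coshR r) (sinhR r) => C S c s.
  move: (sin _) (expR _) (expR _) => sn E1 E2.
  move=> c3 hx hr c1 c2.
  have D12 : (C * c - S * s + 1) * (C * c + S * s + 1) = (C + c) ^+ 2.
    transitivity (C ^+ 2 * c ^+ 2 - S ^+ 2 * s ^+ 2 + 2 * C * c + 1); first by ring.
    have -> : S ^+ 2 = C ^+ 2 - 1 by rewrite hx; ring.
    have -> : s ^+ 2 = c ^+ 2 - 1 by rewrite hr; ring.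
    ring.
  have n1 : C * c - S * s + 1 != 0 by rewrite gt_eqF//; lra.
  have n2 : C * c + S * s + 1 != 0 by rewrite gt_eqF//; lra.
  apply: (mulIf n1); apply: (mulIf n2).
  rewrite -[RHS]mulrA D12.
  transitivity (E1 * E2 * sn * ((S * c - C * s) * (C * c + S * s + 1) + (S * c + C * s) * (C * c - S * s + 1))).
    move: n1 n2; set u := C * c - S * s + 1; set v := C * c + S * s + 1 => n1 n2.
    by field; rewrite n1 n2.
  transitivity (E1 * E2 * sn * (2 * S * (C + c))); last by field; rewrite gt_eqF.
  congr (_ * _).
  transitivity (2 * S * C * (c ^+ 2 - s ^+ 2) + 2 * S * c); first by ring.
  by rewrite hr; ring.
rewrite Jf_pi// => h.
have n2 : (2 : R) != 0 by [].
by apply: (mulfI n2); rewrite mulrA -h -mulrA.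
Qed.

End ClosedForm.

(** * Positivity of the derivatives of the Gaussian *)

Section GaussianSequence.
Context {R : realType}.
Variable a : R.
Hypothesis a0 : 0 < a.
Implicit Types (r c q u : R) (k : nat).

(** Normalized so that [Gs 0] is exactly the Gaussian in the distance. *)
Definition Gs k c : R := expR (a * pi ^+ 2) / pi * cmseq (hw a) k c.

Lemma dseq_Gs : dseq Gs.
Proof. exact: dseqZ (dseq_cmseq (measurable_hw a) (hw_ub a0)). Qed.

Lemma Gs0E c : 1 < c -> Gs 0 c = expR (- (a * arccosh c ^+ 2)).
Proof.
move=> c1; rewrite /Gs /cmseq fact0 mul1r -{1}[c](coshR_arccosh (ltW c1)).
by rewrite mulrAC stj_hw0 ?arccosh_gt0// mulrAC divff ?mul1r// gt_eqF// pi_gt0.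
Qed.

(** [arccosh' = 1 / sinh] and [Aseq 0 = arccosh / sinh]. *)
Lemma Gs1E c : 1 < c -> Gs 1 c = 2 * a * (Aseq 0 c * Gs 0 c).
Proof.
move=> c1; have dG := dseq_Gs 0%N c1.
have da := is_derive_arccosh c1.
have de : is_derive c 1 (fun c => expR (- (a * arccosh c ^+ 2)))
    (expR (- (a * arccosh c ^+ 2)) * - (2 * a * arccosh c / Num.sqrt (c ^+ 2 - 1))).
  apply: (is_derive_chain (f := expR) (g := fun c => - (a * arccosh c ^+ 2))).
  by rewrite /GRing.scale/=; ring.
apply: oppr_inj; have [_ <-] := dG.
transitivity ('D_1 (fun c => expR (- (a * arccosh c ^+ 2))) c).
  apply: near_eq_derive => //; near=> y.
  by apply: Gs0E; near: y; exact: lt_nbhsr.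
have [_ ->] := de; rewrite Gs0E// -sinhR_arccosh ?(ltW c1)//.
have := Aseq0_arccosh c1; have := sinhR_gt0 (arccosh_gt0 c1).
set r := arccosh c; set s := sinhR r => s0 <-; field.
by rewrite gt_eqF.
Unshelve. all: by end_near. Qed.

Lemma GsS k c : 1 < c -> Gs k.+1 c = 2 * a * leibniz k Aseq Gs c.
Proof.
apply: (dseq_uniq (dseq_seqshift dseq_Gs)
  (dseqZ (2 * a) (dseq_leibniz dseq_Aseq dseq_Gs))).
exact: Gs1E.
Qed.

(** By strong induction along [GsS], whose right-hand side only involves [Aseq] and the
    [Gs i] with [i <= k].  The integrals defining [Gs] have an oscillating integrand, so
    this sign is not visible on them. *)
Lemma Gs_ge0 k c : 1 < c -> 0 <= Gs k c.
Proof.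
move=> c1; elim/ltn_ind: k => -[|k] ih; first by rewrite Gs0E// expR_ge0.
rewrite GsS// mulr_ge0//; first by rewrite mulr_ge0// ltW.
by apply: leibniz_ge0 => i ik; [exact: Aseq_ge0|exact: ih].
Qed.

(** Derivatives, up to sign, of [(c - q) * Gs 1 c]. *)
Definition Eseq q k c : R := (c - q) * Gs k.+1 c - k%:R * Gs k c.

(** Derivatives, up to sign, of [(c - q) * Aseq 0 c].  At [k = 0] the predecessor is
    harmless, its coefficient being 0. *)
Definition betaseq q k c : R := (c - q) * Aseq k c - k%:R * Aseq k.-1 c.

(** Minus the [k + 1]-st term of [betaseq 0]; [KB] and [KA] collect, in the Leibniz
    expansion of [Eseq], the part independent of [q] and the part linear in it. *)
Definition B0seq k c : R := k.+1%:R * Aseq k c - c * Aseq k.+1 c.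

Lemma dseq_twist (F : nat -> R -> R) q : dseq F -> forall k c, 1 < c ->
  is_derive c 1 (fun c => (c - q) * F k.+1 c - k%:R * F k c)
    (- ((c - q) * F k.+2 c - k.+1%:R * F k.+1 c)).
Proof.
move=> dF k c c1; have d1 := dF k c c1; have d2 := dF k.+1 c c1.
by apply: is_derive_eq; rewrite /GRing.scale/= -natr1; ring.
Qed.

Lemma dseq_Eseq q : dseq (Eseq q).
Proof. exact: dseq_twist dseq_Gs. Qed.

Lemma dseq_betaseq q : dseq (betaseq q).
Proof.
move=> [|k] c c1; rewrite /betaseq /=.
  have d1 := dseq_Aseq 0 c1.
  by apply: is_derive_eq; rewrite /GRing.scale/=; ring.
have d1 := dseq_Aseq k c1; have d2 := dseq_Aseq k.+1 c1.
by apply: is_derive_eq; rewrite /GRing.scale/= -[k.+2%:R]natr1; ring.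
Qed.

Lemma Eseq_leibniz q k c : 1 < c ->
  Eseq q k c = 2 * a * leibniz k (betaseq q) Gs c.
Proof.
apply: (dseq_uniq (dseq_Eseq q)
  (dseqZ (2 * a) (dseq_leibniz (dseq_betaseq q) dseq_Gs))) => {}c c1.
by rewrite /Eseq /betaseq/= Gs1E//; ring.
Qed.

Lemma dseq_B0seq : dseq B0seq.
Proof.
move=> k c c1; have d1 := dseq_Aseq k c1; have d2 := dseq_Aseq k.+1 c1.
rewrite /B0seq; apply: is_derive_eq.
by rewrite /GRing.scale/= -[k.+2%:R]natr1; ring.
Qed.

Lemma B0seq_ge0 k c : 1 < c -> 0 <= B0seq k c.
Proof. by move=> c1; rewrite subr_ge0 Aseq_succ_le// (lt_trans ltr01). Qed.

Definition KB k c : R := leibniz k B0seq Gs c.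

Definition KA k c : R := leibniz k (seqshift Aseq) Gs c.

Lemma dseq_KB : dseq KB.
Proof. exact: dseq_leibniz dseq_B0seq dseq_Gs. Qed.

Lemma dseq_KA : dseq KA.
Proof. exact: dseq_leibniz (dseq_seqshift dseq_Aseq) dseq_Gs. Qed.

Lemma KB_ge0 k c : 1 < c -> 0 <= KB k c.
Proof. by move=> c1; apply: leibniz_ge0 => i _; [exact: B0seq_ge0|exact: Gs_ge0]. Qed.

Lemma KA_ge0 k c : 1 < c -> 0 <= KA k c.
Proof. by move=> c1; apply: leibniz_ge0 => i _; [exact: Aseq_ge0|exact: Gs_ge0]. Qed.

Lemma Eseq_ub q k c : 0 <= q -> 1 < c ->
  `|Eseq q k.+1 c| <= 2 * a * (`|c - q| * Aseq 0 c * Gs k.+1 c +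
    k.+1%:R * (KB k c + q * KA k c)).
Proof.
move=> q0 c1; rewrite Eseq_leibniz// normrM ger0_norm; last by rewrite mulr_ge0// ltW.
rewrite ler_wpM2l//; first by rewrite mulr_ge0// ltW.
have bB i : betaseq q i.+1 = (fun c => - (B0seq i c + q * seqshift Aseq i c)).
  by apply/funext => x; rewrite /betaseq /B0seq /seqshift/=; ring.
have := @leibniz_norm_le R k (betaseq q) (fun i c => B0seq i c + q * seqshift Aseq i c) Gs c bB.
rewrite leibnizD /betaseq mul0r subr0 normrM (ger0_norm (Aseq_ge0 _ _)).
apply=> i; last exact: Gs_ge0.
by rewrite addr_ge0 ?B0seq_ge0// mulr_ge0// Aseq_ge0.
Qed.

(** Since [Aseq 0 c = arccosh c / sinh (arccosh c)], this says that
    [(c - e^u)^2 <= c^2 - 1], that is [e^(2 u) + 1 <= 2 c e^u], which is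
    [cosh u <= c]. *)
Lemma horocycle_le u c : 1 < c -> coshR u <= c ->
  `|c - expR u| * Aseq 0 c <= arccosh c.
Proof.
move=> c1 uc.
rewrite -[leRHS](Aseq0_arccosh c1) mulrC ler_wpM2l ?Aseq_ge0//.
have s0 := sinhR_ge0 (arccosh_ge0 (ltW c1)).
rewrite -[leRHS]ger0_norm// -(@ler_pXn2r _ 2)// ?nnegrE// !real_normK ?num_real//.
have := coshR_sqr (arccosh c); rewrite coshR_arccosh ?(ltW c1)// => e.
have -> : sinhR (arccosh c) ^+ 2 = c ^+ 2 - 1 by rewrite e; ring.
have : expR u * (2 * coshR u) <= expR u * (2 * c).
  by rewrite ler_wpM2l ?expR_ge0// ler_wpM2l.
have -> : expR u * (2 * coshR u) = expR u ^+ 2 + 1.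
  rewrite -[coshR u]/((expR u + expR (- u)) / 2).
  by transitivity (expR u ^+ 2 + expR u * expR (- u));
    [field|rewrite expRxMexpNx_1].
lra.
Qed.

End GaussianSequence.

(** * Radial integrals uniform in time *)

Section RadialBound.
Context {R : realType}.
Notation mu := (@lebesgue_measure R).
Implicit Types (r c s : R) (k : nat).

Definition gcst (j : nat) (l : R) : R := j`!%:R * expR ((l + 2) ^+ 2).

Lemma gcst_ge0 j l : 0 <= gcst j l.
Proof. by rewrite mulr_ge0// expR_ge0. Qed.

(** The constants come from [y^j <= j! e^y] and from completing the square. *)
Lemma pow_gauss_le (j : nat) (l y : R) : 0 <= y ->
  y ^+ j * expR (l * y) * expR (- (y ^+ 2 / 4)) <= gcst j l * expR (- y).
Proof.
move=> y0; have h : y ^+ j <= j`!%:R * expR y.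
  case: j => [|j]; first by rewrite expr0 fact0 mul1r; have := expR_ge1Dx y; lra.
  have f0 : 0 < j.+1`!%:R :> R by rewrite ltr0n fact_gt0.
  have := expR_ge1Dxn j y0; rewrite -ler_pdivrMl//.
  by rewrite mulrC; lra.
rewrite -mulrA -expRD.
apply: (le_trans (ler_wpM2r (expR_ge0 _) h)).
rewrite /gcst -!mulrA -!expRD ler_wpM2l// ler_expR.
by have := sqr_ge0 (y / 2 - (l + 2)); lra.
Qed.

(** [cosh (2 r') = 2 c'^2 - 1 >= 2 c' - 1 = c] for [c' = cosh r' >= 1]. *)
Lemma arccosh_half c : 1 <= c -> arccosh c <= 2 * arccosh (1 + (c - 1) / 2).
Proof.
move=> c1; set c' := 1 + (c - 1) / 2.
have c'1 : 1 <= c' by rewrite /c'; lra.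
have r0 := arccosh_ge0 c1; have r'0 := arccosh_ge0 c'1.
rewrite leNgt; apply/negP => h.
have : coshR (2 * arccosh c') < coshR (arccosh c) by rewrite ltr_coshR// mulr_ge0.
rewrite coshR_arccosh// (_ : 2 * arccosh c' = arccosh c' + arccosh c'); last by ring.
rewrite coshRD -!expr2; have := coshR_sqr (arccosh c'); rewrite coshR_arccosh//.
have c2 : c' <= c' ^+ 2 by rewrite expr2 -{1}[c']mulr1 ler_wpM2l//; lra.
by rewrite /c' in c2 *; lra.
Qed.

Lemma arccosh_scale k c : 1 <= c ->
  arccosh c <= 2 ^+ k * arccosh (1 + (c - 1) / 2 ^+ k).
Proof.
elim: k c => [|k ih] c c1.
  by rewrite !expr0 mul1r divr1 addrCA subrr addr0.
apply: (le_trans (arccosh_half c1)).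
rewrite exprS -mulrA ler_wpM2l//.
have c'1 : 1 <= 1 + (c - 1) / 2 by lra.
have := ih _ c'1.
rewrite (_ : (1 + (c - 1) / 2 - 1) / 2 ^+ k = (c - 1) / (2 * 2 ^+ k))//.
by field; rewrite expf_neq0.
Qed.

Lemma sinhR_arccosh_scale N c : 1 <= N -> 1 <= c ->
  sinhR (arccosh c) <= N * sinhR (arccosh (1 + (c - 1) / N)).
Proof.
move=> N1 c1; have N0 : 0 < N by lra.
have c'1 : 1 <= 1 + (c - 1) / N by rewrite lerDl divr_ge0//; lra.
rewrite !sinhR_arccosh//; set X := (X in N * Num.sqrt X).
have -> : N * Num.sqrt X = Num.sqrt (N ^+ 2 * X).
  by rewrite sqrtrM ?sqr_ge0// sqrtr_sqr ger0_norm// ltW.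
rewrite ler_wsqrtr// /X.
rewrite (_ : N ^+ 2 * _ = (c - 1) * (2 * N + (c - 1))); last first.
  by field; rewrite gt_eqF.
have := mulr_ge0 (_ : 0 <= c - 1) (_ : 0 <= N - 1); rewrite !subr_ge0.
move=> /(_ c1 N1); lra.
Qed.

(** The common majorant of all radial integrands: if [cosh r' = 1 + (c - 1) / N], then
    [hbar s N c dc = (N / s) e^(- r' / s) dr']. *)
Definition hbar (s N c : R) : R :=
  s^-1 * expR (- (arccosh (1 + (c - 1) / N) / s)) / sinhR (arccosh (1 + (c - 1) / N)).

(** Lower the order [k] to 0 with [dseq_steps]; at the shrunk point [F 0] is controlled by
    a Gaussian in [r / s], which absorbs the exponential weight and all powers of
    [r / s].  The exponents [i] and [l] come from the integration over [u] and from the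
    shape of [F 0]. *)
Lemma dseq_reduce (F : nat -> R -> R) (k i j l : nat) (eps s D c : R) :
  dseq F -> (forall k c, 1 < c -> 0 <= F k c) -> 0 < s -> 0 <= eps -> 0 <= D ->
  (forall r, 0 < r -> F 0%N (coshR r) * sinhR r ^+ l.+1 <=
     D * (r / s) ^+ j * expR (- ((r / s) ^+ 2 / 4))) ->
  1 < c ->
  expR (eps * arccosh c / s) * arccosh c ^+ i * sinhR (arccosh c) ^+ l *
    ((c - 1) ^+ k * F k c) <=
  (2 ^+ k) ^+ i * (2 ^+ k) ^+ l * @step_cst R k * gcst (i + j) (eps * 2 ^+ k) *
   D * s ^+ i.+1 * hbar s (2 ^+ k) c.
Proof.
move=> dF F0 s0 e0 D0 H c1; set N := 2 ^+ k.
have N1 : 1 <= N by rewrite exprn_ege1// ler1n.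
have N0 : 0 < N by lra.
have c'1 : 1 < 1 + (c - 1) / N by rewrite ltrDl divr_gt0//; lra.
rewrite /hbar; set c' := 1 + (c - 1) / N in c'1 *.
set r := arccosh c'; have r0 : 0 < r := arccosh_gt0 c'1.
have sh0 : 0 < sinhR r := sinhR_gt0 r0.
have rc0 := arccosh_ge0 (ltW c1).
have b1 : arccosh c <= N * r := arccosh_scale k (ltW c1).
have b2 : sinhR (arccosh c) <= N * sinhR r := sinhR_arccosh_scale N1 (ltW c1).
have b3 : (c - 1) ^+ k * F k c <= step_cst k * F 0%N c' := dseq_steps k dF F0 c1.
have cr : coshR r = c' := coshR_arccosh (ltW c'1).
have Hr := H r r0; rewrite cr in Hr.
have F0c : 0 <= F 0%N c' := F0 _ _ c'1.
have sc := @step_cst_ge0 R k.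
pose y := r / s; have y0 : 0 <= y by rewrite divr_ge0// ltW.
have b0 : expR (eps * arccosh c / s) <= expR (eps * N * y).
  rewrite ler_expR /y mulrA ler_pM2r ?invr_gt0// -mulrA ler_wpM2l//.
have b4 : arccosh c ^+ i <= (N * r) ^+ i.
  by rewrite lerXn2r ?nnegrE// mulr_ge0// ltW.
have b5 : sinhR (arccosh c) ^+ l <= (N * sinhR r) ^+ l.
  by rewrite lerXn2r ?nnegrE ?sinhR_ge0// mulr_ge0// ltW.
apply: (@le_trans _ _ (expR (eps * N * y) * (N * r) ^+ i * (N * sinhR r) ^+ l * (step_cst k * F 0%N c'))).
  rewrite ler_pM// ?mulr_ge0 ?expR_ge0 ?exprn_ge0 ?sinhR_ge0 ?F0//; first lra.
  rewrite ler_pM// ?mulr_ge0 ?expR_ge0 ?exprn_ge0 ?sinhR_ge0//.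
  by rewrite ler_pM// ?expR_ge0 ?exprn_ge0.
have rE : r = s * y by rewrite /y mulrCA divff ?mulr1// gt_eqF.
have Fle : F 0%N c' * sinhR r ^+ l <= D * y ^+ j * expR (- (y ^+ 2 / 4)) / sinhR r.
  rewrite ler_pdivlMr//; apply: le_trans Hr.
  by rewrite exprS le_eqVlt; apply/orP; left; apply/eqP; ring.
have := pow_gauss_le (i + j) (eps * N) y0; set G := gcst _ _ => hG.
rewrite (exprMn _ N r) (exprMn _ N (sinhR r)) (_ : r ^+ i = s ^+ i * y ^+ i); last by rewrite rE exprMn.
rewrite (_ : _ * (step_cst k * F 0%N c') = N ^+ i * N ^+ l * step_cst k * s ^+ i *
  (y ^+ i * expR (eps * N * y)) * (F 0%N c' * sinhR r ^+ l)); last by ring.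
apply: (@le_trans _ _ (N ^+ i * N ^+ l * step_cst k * s ^+ i *
  (y ^+ i * expR (eps * N * y)) * (D * y ^+ j * expR (- (y ^+ 2 / 4)) / sinhR r))).
  by rewrite ler_wpM2l// !mulr_ge0 ?exprn_ge0 ?expR_ge0 ?(ltW N0) ?(ltW s0).
rewrite (_ : _ * _ = N ^+ i * N ^+ l * step_cst k * s ^+ i * D / sinhR r *
  (y ^+ (i + j) * expR (eps * N * y) * expR (- (y ^+ 2 / 4)))); last by rewrite exprD; ring.
apply: (@le_trans _ _ (N ^+ i * N ^+ l * step_cst k * s ^+ i * D / sinhR r *
  (G * expR (- y)))).
  by rewrite ler_wpM2l// !mulr_ge0 ?exprn_ge0 ?invr_ge0 ?(ltW N0) ?(ltW s0) ?(ltW sh0).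
rewrite le_eqVlt; apply/orP; left; apply/eqP.
by rewrite -/y exprSr; field; rewrite !gt_eqF.
Qed.

Lemma hbar_arg_gt1 (N c : R) : 1 <= N -> 1 < c -> 1 < 1 + (c - 1) / N.
Proof. by move=> N1 c1; rewrite ltrDl divr_gt0//; lra. Qed.

Lemma sinhR_hbar_arg_gt0 (N c : R) : 1 <= N -> 1 < c ->
  0 < sinhR (arccosh (1 + (c - 1) / N)).
Proof. by move=> N1 c1; rewrite sinhR_gt0// arccosh_gt0// hbar_arg_gt1. Qed.

Lemma is_derive_hbar_arg (N c : R) : 1 <= N -> 1 < c ->
  is_derive c 1 (fun c => arccosh (1 + (c - 1) / N))
    ((sinhR (arccosh (1 + (c - 1) / N)))^-1 / N).
Proof.
move=> N1 c1; have h1 := is_derive_arccosh (hbar_arg_gt1 N1 c1).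
rewrite -sinhR_arccosh ?(ltW (hbar_arg_gt1 N1 c1))// in h1.
have h2 : is_derive c 1 (fun c : R => 1 + (c - 1) / N) N^-1.
  by apply: is_derive_eq; rewrite /GRing.scale/=; ring.
exact: (@is_derive_chain R (@arccosh R) _ c _ _ _ h1 h2 erefl).
Qed.

Lemma continuous_hbar (s N c : R) : 1 <= N -> 1 < c ->
  {for c, continuous (hbar s N)}.
Proof.
move=> N1 c1; have h1 := is_derive_continuous (is_derive_hbar_arg N1 c1).
pose rr (c : R) := arccosh (1 + (c - 1) / N).
rewrite /hbar; apply: cvgM.
  apply: cvgM; first exact: cvg_cst.
  apply: (continuous_comp (f := fun c => - (rr c / s)) (g := expR)); last exact: continuous_expR.
  by apply: cvgN; apply: cvgM h1 _; exact: cvg_cst.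
apply: cvgV; first by rewrite gt_eqF// sinhR_hbar_arg_gt0.
by apply: (continuous_comp (f := rr) (g := @sinhR R)) => //; exact: continuous_sinhR.
Qed.

Lemma hbar_ge0 (s N c : R) : 0 < s -> 1 <= N -> 1 < c -> 0 <= hbar s N c.
Proof.
move=> s0 N1 c1.
by rewrite /hbar !mulr_ge0 ?expR_ge0 ?invr_ge0 ?(ltW s0)// ltW// sinhR_hbar_arg_gt0.
Qed.

(** The integrand is the derivative of
    [- N e^(- arccosh(1 + (c - 1) / N) / s)], so the bound does not depend on [s]. *)
Lemma integral_hbar (s N : R) : 0 < s -> 1 <= N ->
  (\int[mu]_(c in `]1%R, +oo[) (hbar s N c)%:E <= N%:E)%E.
Proof.
move=> s0 N1; have N0 : 0 < N by lra.
pose H (c : R) := - (N * expR (- (arccosh (1 + (c - 1) / N) / s))).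
have c'1 c : 1 < c -> 1 < 1 + (c - 1) / N := hbar_arg_gt1 N1.
pose rr (c : R) := arccosh (1 + (c - 1) / N).
have dr c : 1 < c -> is_derive c 1 rr ((sinhR (rr c))^-1 / N) := is_derive_hbar_arg N1.
have r0 c : 1 < c -> 0 < sinhR (rr c) := sinhR_hbar_arg_gt0 N1.
have A1 c : 1 < c -> 0 <= hbar s N c := hbar_ge0 s0 N1.
have A2 (c : R) : 1 < c -> is_derive c 1 H (hbar s N c).
  move=> c1; have h1 := dr _ c1.
  have h2 : is_derive c 1 (fun c => - (rr c / s)) (- ((sinhR (rr c))^-1 * N^-1 / s)).
    (by apply: is_derive_eq; rewrite /GRing.scale/=; ring).
  have h3 : is_derive c 1 (fun c => expR (- (rr c / s)))
      (expR (- (rr c / s)) * - ((sinhR (rr c))^-1 * N^-1 / s)).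
    exact: is_derive_chain (is_derive_expR _) h2 erefl.
  apply: is_derive_eq; rewrite /GRing.scale/= /hbar -/(rr c).
  by have := r0 _ c1; set w := sinhR _ => w0; field; rewrite !gt_eqF.
have A3 (c : R) : 1 < c -> {for c, continuous (hbar s N)} := @continuous_hbar s N c N1.
have A4 : H x @[x --> +oo] --> (0 : R).
  rewrite /H -[X in _ --> X]oppr0; apply: cvgN.
  rewrite -[X in _ --> X](mulr0 N); apply: cvgM; first exact: cvg_cst.
  have h : rr c / s @[c --> +oo] --> +oo.
    apply/cvgryPge => A; near=> c.
    rewrite ler_pdivlMr//.
    have [A0|A0] := leP (A * s) 0.
      by rewrite (le_trans A0)// arccosh_ge0// ltW// c'1//; near: c; exact: nbhs_pinfty_gt.
    rewrite -(arccosh_coshR (ltW A0)) ler_arccosh ?coshR_ge1//.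
    rewrite -lerBlDl ler_pdivlMr// lerBrDr.
    by near: c; apply: nbhs_pinfty_ge; rewrite num_real.
  by apply: (cvg_comp (fun c => rr c / s) (fun y : R => expR (- y)) h); exact: cvgr_expR.
have A5 c : 1 < c -> - H c <= N.
  move=> c1; rewrite opprK -[leRHS]mulr1 ler_wpM2l ?(ltW N0)//.
  rewrite -[leRHS]expR0 ler_expR oppr_le0 divr_ge0 ?(ltW s0)//.
  exact: arccosh_ge0 (ltW (c'1 _ c1)).
exact: ge0_FTC_open A1 A2 A3 A4 A5.
Unshelve. all: by end_near. Qed.

End RadialBound.

(** * The heat kernel as a Stieltjes transform *)

Section IteratedIntegrals.
Context {R : realType} d1 d2 (T1 : measurableType d1) (T2 : measurableType d2).
Context (m1 : {sigma_finite_measure set T1 -> \bar R}).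
Context (m2 : {sigma_finite_measure set T2 -> \bar R}).
Variables (D1 : set T1) (D2 : set T2).
Local Open Scope ereal_scope.

(** Extending by 0 outside a rectangle reduces iterated integrals over subsets to
    iterated integrals over the whole spaces. *)
Lemma iterated_restrict12 (g : T1 * T2 -> \bar R) :
  \int[m1]_x \int[m2]_y (g \_ (D1 `*` D2)) (x, y) =
  \int[m1]_(x in D1) \int[m2]_(y in D2) g (x, y).
Proof.
rewrite [RHS]integral_mkcond; apply: eq_integral => x _.
rewrite patchE; case: ifPn => xD.
  rewrite [RHS]integral_mkcond; apply: eq_integral => y _.
  by rewrite !patchE in_setX/= xD.
by rewrite integral0_eq// => y _; rewrite patchE in_setX/= (negbTE xD).
Qed.

Lemma iterated_restrict21 (g : T1 * T2 -> \bar R) :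
  \int[m2]_y \int[m1]_x (g \_ (D1 `*` D2)) (x, y) =
  \int[m2]_(y in D2) \int[m1]_(x in D1) g (x, y).
Proof.
rewrite [RHS]integral_mkcond; apply: eq_integral => y _.
rewrite patchE; case: ifPn => yD.
  rewrite [RHS]integral_mkcond; apply: eq_integral => x _.
  by rewrite !patchE in_setX/= yD andbT.
by rewrite integral0_eq// => x _; rewrite patchE in_setX/= (negbTE yD) andbF.
Qed.

Hypotheses (mD1 : measurable D1) (mD2 : measurable D2).

Lemma measurable_restrict_box (g : T1 * T2 -> \bar R) :
  measurable_fun [set: T1 * T2] g ->
  measurable_fun [set: T1 * T2] (g \_ (D1 `*` D2)).
Proof.
by move=> mg; apply/(measurable_restrictT _ (measurableX mD1 mD2)); exact: measurable_funTS.
Qed.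

Lemma fubini_on (g : T1 -> T2 -> R) :
  measurable_fun [set: T1 * T2] (fun z => g z.1 z.2) ->
  (forall x, D1 x -> m2.-integrable D2 (EFin \o g x)) ->
  (forall y, D2 y -> m1.-integrable D1 (EFin \o g ^~ y)) ->
  \int[m2]_(y in D2) \int[m1]_(x in D1) `|g x y|%:E < +oo ->
  (\int[m1]_(x in D1) \int[m2]_(y in D2) g x y =
   \int[m2]_(y in D2) \int[m1]_(x in D1) g x y)%R.
Proof.
move=> mg i1 i2 lty; rewrite /Rintegral; congr fine.
transitivity (\int[m1]_(x in D1) \int[m2]_(y in D2) (g x y)%:E).
  apply: eq_integral => x; rewrite inE => xD; rewrite fineK//.
  by apply: integrable_fin_num => //; exact: i1.
transitivity (\int[m2]_(y in D2) \int[m1]_(x in D1) (g x y)%:E); last first.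
  apply: eq_integral => y; rewrite inE => yD; rewrite fineK//.
  by apply: integrable_fin_num => //; exact: i2.
pose G (z : T1 * T2) := (g z.1 z.2)%:E.
have mG : measurable_fun [set: T1 * T2] G by exact/measurable_EFinP.
have mGr := measurable_restrict_box mG.
have := iterated_restrict12 G => /= <-; have := iterated_restrict21 G => /= <-.
apply: Fubini; apply/(integrable21ltyP _ _ mGr).
apply: le_lt_trans lty; rewrite le_eqVlt; apply/orP; left; apply/eqP.
rewrite -(iterated_restrict21 (fun z => `|g z.1 z.2|%:E)).
apply: eq_integral => y _; apply: eq_integral => x _; rewrite !patchE.
by case: ifPn => // _; rewrite abse0.
Qed.

End IteratedIntegrals.

Section IntegrableFubini.
Context {R : realType} d1 d2 (T1 : measurableType d1) (T2 : measurableType d2).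
Context (m1 : {sigma_finite_measure set T1 -> \bar R}).
Context (m2 : {sigma_finite_measure set T2 -> \bar R}).
Local Open Scope ereal_scope.

Lemma integrable_fubini_on (D1 : set T1) (D2 : set T2) (g : T1 -> T2 -> R) :
  measurable D1 -> measurable D2 ->
  measurable_fun [set: T1 * T2] (fun z => g z.1 z.2) ->
  (forall x, D1 x -> m2.-integrable D2 (EFin \o g x)) ->
  \int[m2]_(y in D2) \int[m1]_(x in D1) `|g x y|%:E < +oo ->
  m1.-integrable D1 (EFin \o (fun x => (\int[m2]_(y in D2) g x y)%R)).
Proof.
move=> mD1 mD2 mg i1 lty.
pose G (z : T1 * T2) := (g z.1 z.2)%:E.
have mG : measurable_fun [set: T1 * T2] G by exact/measurable_EFinP.
have mGr := measurable_restrict_box mD1 mD2 mG.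
have iG : (m1 \x m2).-integrable [set: T1 * T2] (G \_ (D1 `*` D2)).
  apply/(integrable21ltyP _ _ mGr).
  apply: le_lt_trans lty; rewrite le_eqVlt; apply/orP; left; apply/eqP.
  rewrite -(iterated_restrict21 _ _ _ _ (fun z => `|g z.1 z.2|%:E)).
  apply: eq_integral => y _; apply: eq_integral => x _; rewrite !patchE.
  by case: ifPn => // _; rewrite abse0.
have := integrable_fubini_F iG.
have -> : fubini_F m2 (G \_ (D1 `*` D2)) =
    (EFin \o (fun x => (\int[m2]_(y in D2) g x y)%R)) \_ D1.
  apply/funext => x; rewrite /fubini_F patchE; case: ifPn => xD.
    rewrite /Rintegral /= fineK; last first.
      by apply: integrable_fin_num => //; apply: i1; rewrite inE in xD.
    rewrite [RHS]integral_mkcond; apply: eq_integral => y _.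
    by rewrite !patchE in_setX/= xD.
  by rewrite integral0_eq// => y _; rewrite patchE in_setX/= (negbTE xD).
by move=> h; apply/(integrable_mkcond _ mD1).
Qed.

End IntegrableFubini.

Section InverseGamma.
Context {R : realType}.
Notation mu := (@lebesgue_measure R).
Implicit Types (s A x : R).

(** Up to the constant, an inverse Gamma density. *)
Definition igk s A x : R := x `^ (-2 - s) * expR (- (A * x `^ (-1))).

Lemma measurable_igk2 s (h : R -> R) : measurable_fun [set: R] h ->
  measurable_fun [set: R * R] (fun z => igk s (h z.2) z.1).
Proof.
move=> mh; apply: measurable_funM.
  by apply: (measurableT_comp (f := fun a : R => a `^ (-2 - s))) => //; exact: measurable_powR.
apply: (measurableT_comp (f := expR)) => //; apply: measurableT_comp => //.
apply: measurable_funM; first exact: measurableT_comp.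
by apply: (measurableT_comp (f := fun a : R => a `^ (-1))) => //; exact: measurable_powR.
Qed.

Lemma measurable_igk s A : measurable_fun [set: R] (igk s A).
Proof.
have := @measurable_igk2 s (fun=> A) (measurable_cst _).
move=> /(@measurable_fun_pair1 _ _ _ _ _ _ _ (0 : R)) /=; exact.
Qed.

Lemma igk_ge0 s A x : 0 <= igk s A x.
Proof. by rewrite mulr_ge0 ?powR_ge0 ?expR_ge0. Qed.

Lemma powR_le_expR s x : 0 <= s -> 0 < x -> x `^ s <=
  (1 + 2 ^+ (Num.truncn s).+1 * ((Num.truncn s).+1)`!%:R) * expR (x / 2).
Proof.
move=> s0 x0; set n := (Num.truncn s).+1.
have sn : s <= n%:R by exact/ltW/truncnS_gt.
have e1 : 1 <= expR (x / 2) by rewrite -[leLHS]expR0 ler_expR divr_ge0// ltW.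
have n0 : 0 <= 2 ^+ n * n`!%:R :> R by rewrite mulr_ge0// exprn_ge0.
have [x1|x1] := leP x 1.
  apply: (@le_trans _ _ 1); first by rewrite -(powRr0 x) ger_powR// x0 x1.
  by rewrite -[leLHS]mulr1 ler_pM// lerDl.
apply: (@le_trans _ _ (x ^+ n)).
  by rewrite -powR_mulrn ?(ltW x0)// ler_powR// ltW.
have f0 : 0 < n`!%:R :> R by rewrite ltr0n fact_gt0.
have x20 : 0 <= x / 2 by rewrite divr_ge0// ltW.
have := expR_ge1Dxn (Num.truncn s) x20; rewrite -/n => h.
have {}h : (x / 2) ^+ n <= n`!%:R * expR (x / 2) by rewrite -ler_pdivrMl// mulrC; lra.
rewrite (_ : x = 2 * (x / 2)) ?exprMn; last by field.
rewrite (_ : 2 * (x / 2) = x); last by field.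
rewrite mulrDl mul1r -mulrA -[leLHS]add0r lerD ?expR_ge0//.
by rewrite -[x ^+ n * _]exprMn ler_wpM2l// exprn_ge0.
Qed.

Lemma integral_igk1_lty s : 0 <= s -> (\int[mu]_(x in `]0%R, +oo[) (igk s 1 x)%:E < +oo)%E.
Proof.
move=> s0; set C := (1 + 2 ^+ (Num.truncn s).+1 * ((Num.truncn s).+1)`!%:R : R).
have C0 : 0 <= C by rewrite addr_ge0// mulr_ge0// exprn_ge0.
(* Half of the exponential absorbs the power [x^-s]; what is left has an explicit
   primitive. *)
pose G (x : R) := C * (x ^- 2 * expR (- (x^-1 / 2))).
pose F (x : R) := 2 * C * (expR (- (x^-1 / 2)) - 1).
have G0 x : 0 < x -> 0 <= G x by move=> x0; rewrite !mulr_ge0 ?expR_ge0// invr_ge0 sqr_ge0.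
have dF (x : R) : 0 < x -> is_derive x 1 F (G x).
  move=> x0; have xn0 : x != 0 by rewrite gt_eqF.
  have h1 : is_derive x 1 (fun x => - (x^-1 / 2)) (x ^- 2 / 2).
    have h0 : is_derive x 1 (fun x : R => x^-1) (- x ^- 2 *: 1) := is_deriveV xn0 (is_derive_id x 1).
    by apply: is_derive_eq; rewrite /GRing.scale/=; ring.
  have h2 := is_derive_chain (is_derive_expR _) h1 erefl.
  by apply: is_derive_eq; rewrite /GRing.scale/= /G; field.
have cG (x : R) : 0 < x -> {for x, continuous G}.
  move=> x0; have xn0 : x != 0 by rewrite gt_eqF.
  apply: cvgM; first exact: cvg_cst.
  apply: cvgM; first by apply: cvgV; [rewrite expf_neq0|exact: exprn_continuous].
  apply: (continuous_comp (f := fun x : R => - (x^-1 / 2)) (g := expR)); last exact: continuous_expR.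
  by apply: cvgN; apply: cvgM; [exact: inv_continuous|exact: cvg_cst].
have F0 : F x @[x --> +oo] --> (0 : R).
  rewrite -[X in _ --> X](mulr0 (2 * C)); apply: cvgM; first exact: cvg_cst.
  rewrite -[X in _ --> X](subrr (1 : R)); apply: cvgB; last exact: cvg_cst.
  rewrite -[X in _ --> X]expR0; apply: (cvg_comp _ expR); last exact: continuous_expR.
  suff hh : - (x^-1 / 2) @[x --> +oo] --> (0 : R) by exact: hh.
  rewrite -[X in _ --> X]oppr0; apply: cvgN.
  rewrite -[X in _ --> X](mul0r 2^-1); apply: cvgM; last exact: cvg_cst.
  by apply/(gtr0_cvgV0 (f := id)); [exact: nbhs_pinfty_gt|exact: cvg_id].
have F1 (x : R) : 0 < x -> - F x <= 2 * C.
  move=> x0; rewrite /F -mulrN -[leRHS]mulr1 ler_wpM2l ?mulr_ge0//.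
apply: (@le_lt_trans _ _ (\int[mu]_(x in `]0%R, +oo[) (G x)%:E)%E).
  apply: le_ge0_integral => x /=; rewrite in_itv/= andbT => x0; rewrite lee_fin ?igk_ge0//.
  rewrite /igk /G powR_inv1 ?(ltW x0)// mul1r.
  have iv0 : 0 < x^-1 by rewrite invr_gt0.
  have := powR_le_expR s0 iv0; rewrite -/C => h.
  have -> : x `^ (-2 - s) = x ^- 2 * x^-1 `^ s.
    rewrite powRD; last by rewrite (gt_eqF x0) implybT.
    congr (_ * _); first by rewrite powRN powR_mulrn// ltW.
    by rewrite -(powR_inv1 (ltW x0)) -powRrM mulN1r.
  rewrite -mulrA [C * _]mulrCA ler_wpM2l ?invr_ge0 ?sqr_ge0//.
  apply: (le_trans (ler_wpM2r (expR_ge0 _) h)).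
  rewrite -mulrA -expRD ler_wpM2l// ler_expR; lra.
exact: le_lt_trans (ge0_FTC_open G0 dF cG F0 F1) (ltry _).
Unshelve. all: by end_near. Qed.

Definition igcst s : R := \int[mu]_(x in `]0, +oo[) igk s 1 x.

(** Substitute [x = A x'], after extending by 0 to the whole line. *)
Lemma integral_igk s A : 0 <= s -> 0 < A ->
  (\int[mu]_(x in `]0%R, +oo[) (igk s A x)%:E = (igcst s * A `^ (-1 - s))%:E)%E.
Proof.
move=> s0 A0.
pose g B := (EFin \o igk s B) \_ `]0%R, +oo[.
have g0 B x : (0 <= g B x)%E.
  by rewrite /g patchE; case: ifPn => // _; rewrite lee_fin igk_ge0.
have mg B : measurable_fun [set: R] (g B).
  apply: (iffLR (measurable_restrictT (EFin \o igk s B) (measurable_itv _))).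
  apply: measurable_funTS.
  by apply/measurable_EFinP; exact: measurable_igk.
rewrite integral_mkcond -/(g A) (ge0_integral_affine 0 A0 (mg A) (g0 A)).
have -> : (\int[mu]_x g A (A * x + 0)%R = \int[mu]_x ((A `^ (-2 - s))%:E * g 1%R x))%E.
  apply: eq_integral => x _; rewrite /g !patchE addr0 !mem_setE !in_itv/= !andbT.
  rewrite pmulr_rgt0//; case: ifPn => [x0|_]; last by rewrite mule0.
  rewrite /= -EFinM; congr EFin; rewrite /igk powRM ?ltW//.
  rewrite mulrA; congr (_ * expR (- _)); rewrite ?mul1r.
  by rewrite !powR_inv1 ?mulr_ge0 ?(ltW A0) ?(ltW x0)//; field; rewrite !gt_eqF.
rewrite ge0_integralZl//; last by rewrite lee_fin powR_ge0.
rewrite /g -integral_mkcond /igcst /Rintegral.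
rewrite -[X in (_ * (_ * X))%E = _]fineK; last first.
  rewrite ge0_fin_numE ?integral_igk1_lty//.
  by apply: integral_ge0 => x _; rewrite lee_fin igk_ge0.
rewrite -!EFinM; congr EFin; rewrite mulrA mulrC; congr (_ * _).
rewrite (_ : -1 - s = 1 + (-2 - s)); last by ring.
rewrite (@powRD _ A 1 (-2 - s)); last by rewrite (gt_eqF A0) implybT.
  by rewrite powRr1 ?(ltW A0).
exact: mg.
Qed.

Lemma expRN_leV x : 0 < x -> expR (- x) <= x^-1.
Proof.
move=> x0; rewrite expRN lef_pV2 ?posrE ?expR_gt0//.
by have := expR_ge1Dx x; lra.
Qed.

Lemma expRN_coshR_le c xi x : 0 <= c -> 0 < xi ->
  expR (- ((coshR x + c) * xi `^ (-1))) <= 2 * xi * expR (- x).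
Proof.
move=> c0 xi0; rewrite powR_inv1 ?(ltW xi0)//.
have cx := coshR_gt0 x; have A0 : 0 < coshR x + c by lra.
apply: (@le_trans _ _ ((coshR x + c) / xi)^-1).
  by rewrite expRN_leV// divr_gt0.
rewrite invf_div [2 * xi]mulrC -mulrA ler_pM2l//.
apply: le_trans (coshRV_le x).
by rewrite lef_pV2 ?posrE//; lra.
Qed.

Variables (f : R -> R) (M : R).
Hypotheses (mf : measurable_fun [set: R] f)
  (fM : forall x, 0 < x -> `|f x| <= M).

Lemma integrable_expRN_coshR c xi : 0 <= c -> 0 < xi ->
  mu.-integrable `]0, +oo[ (EFin \o (fun x => f x * expR (- ((coshR x + c) * xi `^ (-1))))).
Proof.
move=> c0 xi0; apply: (integrable_le (measurable_itv _) _
   (integrable_scale (2 * M * xi) (measurable_itv _) integrable_expRN)).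
  apply: measurable_funTS; apply: measurable_funM => //.
  apply: (measurableT_comp (f := expR)) => //; apply: measurableT_comp => //.
  apply: measurable_funM => //; apply: measurable_funD => //; exact: measurable_coshR.
move=> x /=; rewrite in_itv/= andbT => x0.
rewrite normrM (ger0_norm (expR_ge0 _)) (_ : _ * expR (- x) = M * (2 * xi * expR (- x))); last by ring.
by rewrite ler_pM ?expR_ge0 ?fM// expRN_coshR_le.
Qed.

(** The subordination integral in [xi] turns exponentials of [cosh x + c] into powers;
    Fubini applies because [f] is bounded. *)
Lemma integral_stj s c : 0 <= s -> 0 < c ->
  \int[mu]_(xi in `]0, +oo[) (xi `^ (-2 - s) *
    \int[mu]_(x in `]0, +oo[) (f x * expR (- ((coshR x + c) * xi `^ (-1)))))
  = igcst s * stj f s c.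
Proof.
move=> s0 c0.
have cx x : 0 < coshR x + c by rewrite addr_gt0// coshR_gt0.
pose g xi x := f x * igk s (coshR x + c) xi.
transitivity (\int[mu]_(xi in `]0, +oo[) \int[mu]_(x in `]0, +oo[) g xi x).
  apply: eq_Rintegral => xi; rewrite inE/= in_itv/= andbT => xi0.
  rewrite -RintegralZl//; last exact: integrable_expRN_coshR (ltW c0) xi0.
  by apply: eq_Rintegral => x _; rewrite /g /igk; ring.
have ig A : 0 < A -> mu.-integrable `]0, +oo[ (EFin \o igk s A).
  move=> A0; apply/integrableP; split.
    by apply: measurable_funTS; apply/measurable_EFinP; exact: measurable_igk.
  under eq_integral do rewrite /= ger0_norm ?igk_ge0//.
  by rewrite integral_igk// ltry.
have gE x : \int[mu]_(xi in `]0, +oo[) igk s (coshR x + c) xi = igcst s * (coshR x + c) `^ (-1 - s).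
  by rewrite /Rintegral integral_igk.
have iS := integrable_stj mf fM c0 s0.
rewrite fubini_on//.
- rewrite /stj -RintegralZl//; apply: eq_Rintegral => x _.
  by rewrite RintegralZl//; [rewrite gE; ring|exact: ig].
- apply: measurable_funM; first by apply: measurableT_comp.
  apply: (@measurable_igk2 s (fun x => coshR x + c)).
  by apply: measurable_funD => //; exact: measurable_coshR.
- move=> xi /=; rewrite in_itv/= andbT => xi0.
  have := integrable_scale (xi `^ (-2 - s)) (measurable_itv _) (integrable_expRN_coshR (ltW c0) xi0).
  by apply: eq_integrable => // x _; rewrite /= /g /igk; congr EFin; ring.
- by move=> x _; exact: integrable_scale (measurable_itv _) (ig _ (cx x)).
have := integrable_scale (igcst s) (measurable_itv _) iS => /integrableP[_].
apply: le_lt_trans; rewrite le_eqVlt; apply/orP; left; apply/eqP.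
apply: eq_integral => x _ /=.
transitivity (\int[mu]_(xi in `]0%R, +oo[) (`|f x|%:E * (igk s (coshR x + c) xi)%:E))%E.
  by apply: eq_integral => xi _; rewrite /g normrM (ger0_norm (igk_ge0 _ _ _)).
rewrite ge0_integralZl//; last 2 first.
- by apply: measurable_funTS; apply/measurable_EFinP; exact: measurable_igk.
- by move=> xi _; rewrite lee_fin igk_ge0.
rewrite integral_igk// -EFinM !normrM [`|_ `^ _|]ger0_norm ?powR_ge0//.
rewrite ger0_norm; first by congr EFin; ring.
by apply: Rintegral_ge0 => xi _; exact: igk_ge0.
Qed.

End InverseGamma.

Section HeatKernel.
Context {R : realType}.
Notation mu := (@lebesgue_measure R).
Implicit Types (nu t x u : R).

(** The hyperbolic cosine of the distance from the identity. *)
Definition coshrho x u : R := coshR u + expR (- u) * x ^+ 2 / 2.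

Lemma coshrho_gt0 x u : 0 < coshrho x u.
Proof.
by rewrite ltr_pwDl ?coshR_gt0// divr_ge0// mulr_ge0 ?expR_ge0// sqr_ge0.
Qed.

Definition hkcst nu t : R := 2 / Gamma (nu / 2) *
  (expR ((4 * t)^-1 * pi ^+ 2) / Num.sqrt (4 * pi ^+ 3 * t)) * 2 `^ (- (nu / 2)) *
  igcst (nu / 2).

(** All exponents of the kernel are multiples of [1 / xi] and add up to
    [cosh theta + coshrho x u]; what remains is the integral of [integral_stj]. *)
Lemma heat_kernelE nu t x u : 0 <= nu -> 0 < t ->
  heat_kernel nu t (x, u) = hkcst nu t * expR (- (nu / 2 * u)) *
    stj (hw (4 * t)^-1) (nu / 2) (coshrho x u).
Proof.
move=> nu0 t0; rewrite /heat_kernel/=; set a := (4 * t)^-1; set al := nu / 2.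
have a0 : 0 < a by rewrite invr_gt0 mulr_gt0.
have al0 : 0 <= al by rewrite divr_ge0.
pose K := expR (a * pi ^+ 2) / Num.sqrt (4 * pi ^+ 3 * t) * 2 `^ (- al) * expR (- (al * u)).
have mKf : measurable_fun [set: R] (fun th => K * hw a th).
  by apply: measurable_funM => //; exact: measurable_hw.
have KM th : 0 < th -> `|K * hw a th| <= `|K| * expR (4 * a)^-1.
  by move=> th0; rewrite normrM ler_wpM2l// hw_ub.
transitivity (2 / Gamma al * (igcst al * stj (fun th => K * hw a th) al (coshrho x u))).
  congr (_ * _); rewrite -(integral_stj mKf KM al0 (coshrho_gt0 x u)).
  apply: eq_Rintegral => xi; rewrite inE/= in_itv/= andbT => xi0.
  have -> : (2 * xi * expR u) `^ (- al) = 2 `^ (- al) * xi `^ (- al) * expR (- (al * u)).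
    rewrite !powRM ?expR_ge0 ?mulr_ge0 ?(ltW xi0)//; congr (_ * _).
    by rewrite /powR gt_eqF ?expR_gt0// expRK mulNr.
  have c0 : (0 : R) <= 0 by [].
  have iw := integrable_expRN_coshR (measurable_hw a) (hw_ub a0) c0 xi0.
  have -> : Psi t xi = expR (a * pi ^+ 2) / Num.sqrt (4 * pi ^+ 3 * t) * xi `^ (-2) *
      \int[mu]_(th in `]0, +oo[) (hw a th * expR (- ((coshR th + 0) * xi `^ (-1)))).
    rewrite /Psi; congr (_ * _).
      rewrite (_ : xi `^ (-2) = (xi ^+ 2)^-1); last by rewrite powRN powR_mulrn// ltW.
      rewrite (_ : pi ^+ 2 / (4 * t) = a * pi ^+ 2); last by rewrite /a mulrC.
      by rewrite invfM; ring.
    apply: eq_Rintegral => th _; rewrite /hw powR_inv1 ?(ltW xi0)// addr0 expRD mulrA.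
    congr (_ * sin _ * expR _ * _); rewrite /a; first by field; rewrite gt_eqF.
    by field; rewrite gt_eqF.
  rewrite powRD; last by rewrite (gt_eqF xi0) implybT.
  rewrite [RHS](_ : _ = xi `^ (-2) * xi `^ (- al) * (K * expR (- (coshrho x u * xi `^ (-1))) * \int[mu]_(th in `]0, +oo[) (hw a th *
    expR (- ((coshR th + 0) * xi `^ (-1)))))).
    rewrite /K (_ : expR (- (coshR u / xi) - x ^+ 2 / (2 * xi * expR u)) =
      expR (- (coshrho x u * xi `^ (-1)))); first by ring.
    congr expR; rewrite powR_inv1 ?(ltW xi0)// /coshrho expRN; field.
    by rewrite !gt_eqF ?expR_gt0.
  congr (_ * _); rewrite -RintegralZl//.
  by apply: eq_Rintegral => th _; rewrite addr0 mulrDl opprD expRD; ring.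
rewrite /hkcst -/al -/a.
have -> : stj (fun th => K * hw a th) al (coshrho x u) = K * stj (hw a) al (coshrho x u).
  have iS := integrable_stj (measurable_hw a) (hw_ub a0) (coshrho_gt0 x u) al0.
  by rewrite /stj -RintegralZl//; apply: eq_Rintegral => th _; rewrite mulrA.
by rewrite /K; ring.
Qed.

End HeatKernel.

(** * Weyl fractional integrals *)

Section Beta.
Context {R : realType}.
Notation mu := (@lebesgue_measure R).
Implicit Types (p q A c v y : R).

(** Euler's second integral for the beta function, with parameters [p] and
    [1 + q - p]. *)
Definition betak p q y : R := y `^ (p - 1) * (1 + y) `^ (-1 - q).

Definition betaI p q : R := \int[mu]_(y in `]0, +oo[) betak p q y.

Lemma measurable_powR_affine (A B r : R) :
  measurable_fun [set: R] (fun v : R => (A * v + B) `^ r).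
Proof.
apply: (measurableT_comp (f := fun a : R => a `^ r)) => //.
by apply: measurable_funD => //; exact: measurable_funM.
Qed.

Lemma powR_antitone (a b r : R) : 0 < a -> a <= b -> r <= 0 -> b `^ r <= a `^ r.
Proof.
move=> a0 ab r0; rewrite -[r]opprK !(powRN _ (- r)).
have b0 : 0 < b by exact: lt_le_trans ab.
by rewrite lef_pV2 ?posrE ?powR_gt0// ge0_ler_powR ?nnegrE ?oppr_ge0// ltW.
Qed.

Lemma is_derive_addl (A y : R) : is_derive y 1 (fun y : R => A + y) 1.
Proof.
by apply: is_derive_eq (is_deriveD (is_derive_cst A y 1) (is_derive_id y 1)) _; rewrite add0r.
Qed.

Lemma measurable_betak p q : measurable_fun [set: R] (betak p q).
Proof.
apply: measurable_funM; first exact: measurable_powR.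
have := measurable_powR_affine 1 1 (-1 - q).
by congr measurable_fun; apply/funext => v; rewrite mul1r addrC.
Qed.

Lemma betak_ge0 p q y : 0 <= betak p q y.
Proof. by rewrite mulr_ge0 ?powR_ge0. Qed.

Lemma integral_betak_lty p q : 1 <= p -> p <= q ->
  (\int[mu]_(y in `]0%R, +oo[) (betak p q y)%:E < +oo)%E.
Proof.
move=> p1 pq.
apply: (@le_lt_trans _ _ (\int[mu]_(y in `]0%R, +oo[) ((1 + y) ^- 2)%:E)%E).
  apply: le_ge0_integral => y /=; rewrite in_itv/= andbT => y0; rewrite lee_fin ?betak_ge0//.
  have y1 : 0 < 1 + y by lra.
  apply: (@le_trans _ _ ((1 + y) `^ (p - 1) * (1 + y) `^ (-1 - q))).
    rewrite ler_wpM2r ?powR_ge0// ge0_ler_powR ?nnegrE//; lra.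
  rewrite -powRD; last by rewrite (gt_eqF y1) implybT.
  by rewrite -powR_mulrn ?(ltW y1)// -powRN ler_powR//; lra.
pose F (y : R) := - (1 + y)^-1.
have y1 (y : R) : 0 <= y -> 1 + y != 0 by move=> y0; rewrite gt_eqF//; lra.
have f0 (y : R) : 0 <= y -> 0 <= (1 + y) ^- 2 by move=> _; rewrite invr_ge0 sqr_ge0.
have dF (y : R) : 0 <= y -> is_derive y 1 F ((1 + y) ^- 2).
  move=> y0; have h := is_derive_addl 1 y.
  have h0 : is_derive y 1 (fun y : R => (1 + y)^-1) (- (1 + y) ^- 2 *: 1) :=
    is_deriveV (y1 _ y0) h.
  by apply: is_derive_eq; rewrite /GRing.scale/=; ring.
have cf (y : R) : 0 <= y -> {for y, continuous (fun y : R => (1 + y) ^- 2)}.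
  move=> y0; apply: cvgV; first by rewrite expf_neq0// y1.
  apply: (continuous_comp (f := fun y : R => 1 + y) (g := fun z : R => z ^+ 2)); last exact: exprn_continuous.
  by apply: cvgD; [exact: cvg_cst|exact: cvg_id].
have Fl : F y @[y --> +oo] --> (0 : R).
  rewrite -[X in _ --> X]oppr0; apply: cvgN.
  apply/(gtr0_cvgV0 (f := fun y : R => 1 + y)).
    by near=> y; apply: addr_gt0 => //; near: y; exact: nbhs_pinfty_gt.
  apply/cvgryPge => A; near=> y; rewrite -lerBlDl.
  by near: y; apply: nbhs_pinfty_ge; rewrite num_real.
by rewrite (ge0_FTC f0 dF cf Fl) ltry.
Unshelve. all: by end_near. Qed.

Lemma integrable_betak p q : 1 <= p -> p <= q -> mu.-integrable `]0, +oo[ (EFin \o betak p q).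
Proof.
move=> p1 pq; apply/integrableP; split.
  by apply: measurable_funTS; apply/measurable_EFinP; exact: measurable_betak.
under eq_integral do rewrite /= ger0_norm ?betak_ge0//.
exact: integral_betak_lty.
Qed.

Lemma betaI_gt0 p q : 1 <= p -> p <= q -> 0 < betaI p q.
Proof.
move=> p1 pq; pose e : R := 3 `^ (-1 - q).
have e0 : 0 < e by rewrite powR_gt0.
rewrite -lte_fin /betaI /Rintegral fineK; last by apply: integrable_fin_num => //; exact: integrable_betak.
apply: (@lt_le_trans _ _ (\int[mu]_(y in `]1%R, 2%R[) e%:E)%E).
  rewrite integral_cst//= lebesgue_measure_itv/= lte_fin ifT; last by lra.
  by rewrite -EFinD -EFinM lte_fin mulr_gt0//; lra.
apply: (@le_trans _ _ (\int[mu]_(y in `]1%R, 2%R[) (betak p q y)%:E)%E).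
  apply: le_ge0_integral => y /=; rewrite in_itv/= => /andP[y1 y2]; rewrite lee_fin ?(ltW e0)//.
  rewrite -[leLHS]mul1r ler_pM// ?(ltW e0)//.
    by rewrite -[leLHS](powRr0 y) ler_powR//; lra.
  by rewrite /e powR_antitone//; lra.
apply: ge0_subset_integral => //.
- by apply: measurable_funTS; apply/measurable_EFinP; exact: measurable_betak.
- by move=> y _; rewrite lee_fin betak_ge0.
- by move=> y /=; rewrite !in_itv/= => /andP[y1 y2]; rewrite andbT; lra.
Qed.

(** Substitute [v = (A + c) y + c]. *)
Lemma integral_betak_scale p q A c : 1 <= p -> p <= q -> 0 < A + c ->
  (\int[mu]_(v in `]c, +oo[) ((v - c) `^ (p - 1) * (A + v) `^ (-1 - q))%:E =
   (betaI p q * (A + c) `^ (-1 - (q - p)))%:E)%E.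
Proof.
move=> p1 pq Ac.
pose g := (fun v => ((v - c) `^ (p - 1) * (A + v) `^ (-1 - q))%:E) \_ `]c, +oo[.
have g0 v : (0 <= g v)%E.
  by rewrite /g patchE; case: ifPn => // _; rewrite lee_fin mulr_ge0 ?powR_ge0.
have mg : measurable_fun [set: R] g.
  apply: (iffLR (measurable_restrictT _ (measurable_itv _))).
  apply: measurable_funTS; apply/measurable_EFinP; apply: measurable_funM.
    have := measurable_powR_affine 1 (- c) (p - 1).
    by congr measurable_fun; apply/funext => v; rewrite mul1r.
  have := measurable_powR_affine 1 A (-1 - q).
  by congr measurable_fun; apply/funext => v; rewrite mul1r addrC.
rewrite integral_mkcond -/g (ge0_integral_affine c Ac mg g0).
have -> : (\int[mu]_y g ((A + c) * y + c)%R =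
    \int[mu]_y (((A + c) `^ (p - 1) * (A + c) `^ (-1 - q))%:E *
       ((EFin \o betak p q) \_ `]0%R, +oo[) y))%E.
  apply: eq_integral => y _; rewrite /g !patchE !mem_setE !in_itv/= !andbT.
  rewrite ltrDr pmulr_rgt0//; case: ifPn => [y0|_]; last by rewrite mule0.
  rewrite /= -EFinM; congr EFin; rewrite /betak addrK powRM ?(ltW Ac) ?(ltW y0)//.
  rewrite (_ : A + ((A + c) * y + c) = (A + c) * (1 + y)); last by ring.
  by rewrite powRM ?(ltW Ac)//; [ring|lra].
rewrite ge0_integralZl//.
- rewrite -integral_mkcond /betaI /Rintegral.
  rewrite -[X in (_ * (_ * X))%E = _]fineK; last first.
    by apply: integrable_fin_num => //; exact: integrable_betak.
  rewrite -!EFinM; congr EFin; rewrite mulrA mulrC; congr (_ * _).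
  rewrite -{1}[A + c](powRr1 (ltW Ac)) -!powRD ?(gt_eqF Ac) ?implybT//.
  by congr (_ `^ _); ring.
- apply: (iffLR (measurable_restrictT _ (measurable_itv _))).
  by apply: measurable_funTS; apply/measurable_EFinP; exact: measurable_betak.
- by move=> y _; rewrite patchE; case: ifPn => // _; rewrite lee_fin betak_ge0.
- by rewrite lee_fin mulr_ge0 ?powR_ge0.
Qed.

Lemma integrable_betak_scale p q A c : 1 <= p -> p <= q -> 0 < A + c ->
  mu.-integrable `]c, +oo[ (EFin \o (fun v => (v - c) `^ (p - 1) * (A + v) `^ (-1 - q))).
Proof.
move=> p1 pq Ac; apply/integrableP; split.
  apply: measurable_funTS; apply/measurable_EFinP; apply: measurable_funM.
    have := measurable_powR_affine 1 (- c) (p - 1).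
    by congr measurable_fun; apply/funext => v; rewrite mul1r.
  have := measurable_powR_affine 1 A (-1 - q).
  by congr measurable_fun; apply/funext => v; rewrite mul1r addrC.
under eq_integral do rewrite /= ger0_norm ?mulr_ge0 ?powR_ge0//.
by rewrite integral_betak_scale// ltry.
Qed.

Lemma betaI_add p q : 1 <= p -> p <= q ->
  betaI (p + 1) (q + 1) + betaI p (q + 1) = betaI p q.
Proof.
move=> p1 pq.
have i1 : mu.-integrable `]0, +oo[ (EFin \o betak (p + 1) (q + 1)).
  by apply: integrable_betak; lra.
have i2 : mu.-integrable `]0, +oo[ (EFin \o betak p (q + 1)).
  by apply: integrable_betak; lra.
rewrite /betaI -RintegralD//; apply: eq_Rintegral => y; rewrite inE/= in_itv/= andbT => y0.
rewrite /betak; have y1 : 0 < 1 + y by lra.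
rewrite (_ : p + 1 - 1 = p - 1 + 1); last by ring.
rewrite (_ : -1 - q = -1 - (q + 1) + 1); last by ring.
rewrite (@powRD _ y (p - 1) 1); last by rewrite (gt_eqF y0) implybT.
rewrite (@powRD _ (1 + y) (-1 - (q + 1)) 1); last by rewrite (gt_eqF y1) implybT.
by rewrite !powRr1 ?(ltW y0) ?(ltW y1)//; ring.
Qed.

(** Instead of integrating by parts, differentiate the scaling identity
    [int y^(p-1) (c + y)^(-1-q) dy = betaI p q * c^(-1-(q-p))] in [c]. *)
Lemma betaI_deriv p q : 1 <= p -> p <= q ->
  (q + 1) * betaI p (q + 1) = (1 + (q - p)) * betaI p q.
Proof.
move=> p1 pq.
pose f (c y : R) := (y - 0) `^ (p - 1) * (c + y) `^ (-1 - q).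
pose df (c y : R) := - (1 + q) * ((y - 0) `^ (p - 1) * (c + y) `^ (-1 - (q + 1))).
have I (c : R) : 0 < c -> \int[mu]_(y in `]0, +oo[) f c y = betaI p q * c `^ (-1 - (q - p)).
  by move=> c0; rewrite /Rintegral integral_betak_scale ?addr0.
(* [c = 1] is as good as any other point; the integral of [f c] is known in two
   ways for all [c] near it. *)
have D1 : is_derive (1 : R) 1 (fun c => \int[mu]_(y in `]0, +oo[) f c y)
    (\int[mu]_(y in `]0, +oo[) df 1 y).
  have ic (x : R) : 2^-1 < x < 2 -> mu.-integrable `]0, +oo[ (EFin \o f x).
    by move=> x2; apply: integrable_betak_scale => //; lra.
  have dk (x y : R) : 2^-1 < x < 2 -> [set` `]0, +oo[%R] y -> is_derive x 1 (f ^~ y) (df x y).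
    move=> x2; rewrite /= in_itv/= andbT => y0.
    have cyx : 0 < x + y by lra.
    have h0 : is_derive x 1 (fun c : R => c + y) 1.
      by apply: is_derive_eq; rewrite addr0.
    have h := is_derive_chain (g := fun c : R => c + y) (is_derive1_powR (-1 - q) cyx) h0 erefl.
    apply: is_derive_eq.
    rewrite /GRing.scale/= /df (_ : -1 - q - 1 = -1 - (q + 1)); last by ring.
    ring.
  have iG : mu.-integrable `]0, +oo[ (EFin \o
     (fun y => (1 + q) * ((y - 0) `^ (p - 1) * (2^-1 + y) `^ (-1 - (q + 1))))).
    apply: integrable_scale => //; apply: integrable_betak_scale => //; lra.
  have bG (x y : R) : 2^-1 < x < 2 -> [set` `]0, +oo[%R] y -> `|df x y| <=
      (1 + q) * ((y - 0) `^ (p - 1) * (2^-1 + y) `^ (-1 - (q + 1))).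
    move=> x2; rewrite /= in_itv/= andbT => y0.
    rewrite normrM normrN [`|1 + q|]ger0_norm; last lra.
    rewrite ger0_norm ?mulr_ge0 ?powR_ge0// ler_wpM2l//; first lra.
    rewrite ler_wpM2l ?powR_ge0//.
    by rewrite powR_antitone//; lra.
  have auv : 2^-1 < (1 : R) < 2 by apply/andP; split; [rewrite invf_lt1 ?ltr1n|rewrite ltr1n].
  exact: (is_derive_integral (measurable_itv _) auv ic dk iG bG).
have D2 : is_derive (1 : R) 1 (fun c : R => betaI p q * c `^ (-1 - (q - p)))
    (betaI p q * (-1 - (q - p))).
  have h := is_derive1_powR (-1 - (q - p)) (@ltr01 R).
  by apply: is_derive_eq; rewrite /GRing.scale/= powR1 mulr1.
have D3 : is_derive (1 : R) 1 (fun c => \int[mu]_(y in `]0, +oo[) f c y)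
    (betaI p q * (-1 - (q - p))).
  apply: near_eq_is_derive D2; near=> c; apply/esym/I.
  by near: c; exact: lt_nbhsr.
have E : \int[mu]_(y in `]0, +oo[) df 1 y = - ((q + 1) * betaI p (q + 1)).
  rewrite /df RintegralZl//; last by apply: integrable_betak_scale => //; lra.
  rewrite /betaI [q + 1]addrC mulNr; congr (- (_ * _)).
  by apply: eq_Rintegral => y _; rewrite subr0.
have := @derive_val _ _ _ _ _ _ _ D1; rewrite (@derive_val _ _ _ _ _ _ _ D3) E.
lra.
Unshelve. all: by end_near. Qed.

End Beta.

(** The Weyl fractional integral of order [p] lowers the order of a Stieltjes transform
    by [p]; under the integral over [x] this is the scaling of [betaI].  The order [q]
    will be an integer, where the transform has a sign. *)
Section Weyl.
Context {R : realType}.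
Notation mu := (@lebesgue_measure R).
Variables (f : R -> R) (M : R).
Hypotheses (mf : measurable_fun [set: R] f)
  (fM : forall x, 0 < x -> `|f x| <= M).
Variables (p q c : R).
Hypotheses (p1 : 1 <= p) (pq : p <= q) (c0 : 0 < c).

Let g (v x : R) := (v - c) `^ (p - 1) * (f x * (coshR x + v) `^ (-1 - q)).

Let q0 : 0 <= q. Proof. exact: le_trans (le_trans ler01 p1) pq. Qed.

Let qp0 : 0 <= q - p. Proof. by rewrite subr_ge0. Qed.

Let cx x : 0 < coshR x + c. Proof. by rewrite addr_gt0 ?coshR_gt0. Qed.

Let mg : measurable_fun [set: R * R] (fun z => g z.1 z.2).
Proof.
apply: measurable_funM.
  apply: (measurableT_comp (f := fun a : R => a `^ (p - 1))) => //.
  exact: measurable_funB.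
apply: measurable_funM; first exact: measurableT_comp.
apply: (measurableT_comp (f := fun a : R => a `^ (-1 - q))) => //.
apply: measurable_funD => //; apply: measurableT_comp => //; exact: measurable_coshR.
Qed.

Let i1 v : c < v -> mu.-integrable `]0, +oo[ (EFin \o g v).
Proof.
move=> cv; apply: integrable_scale => //; apply: (integrable_stj mf fM); last exact: q0.
exact: lt_trans cv.
Qed.

Let i2 x : mu.-integrable `]c, +oo[ (EFin \o g ^~ x).
Proof.
have := integrable_scale (f x) (measurable_itv _) (integrable_betak_scale p1 pq (cx x)).
by apply: eq_integrable => // v _; rewrite /= /g; congr EFin; ring.
Qed.

Let gE x : \int[mu]_(v in `]c, +oo[) g v x =
  betaI p q * (f x * (coshR x + c) `^ (-1 - (q - p))).
Proof.
transitivity (f x * \int[mu]_(v in `]c, +oo[) ((v - c) `^ (p - 1) * (coshR x + v) `^ (-1 - q))).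
  rewrite -RintegralZl//; last exact: integrable_betak_scale.
  by apply: eq_Rintegral => v _; rewrite /g; ring.
by rewrite /Rintegral integral_betak_scale//=; ring.
Qed.

Let iS : mu.-integrable `]0, +oo[ (EFin \o (fun x => f x * (coshR x + c) `^ (-1 - (q - p)))).
Proof. exact: (integrable_stj mf fM c0 qp0). Qed.

Let glty : (\int[mu]_(x in `]0%R, +oo[) \int[mu]_(v in `]c, +oo[) `|g v x|%:E < +oo)%E.
Proof.
have := integrable_scale (betaI p q) (measurable_itv _) iS => /integrableP[_].
apply: le_lt_trans; rewrite le_eqVlt; apply/orP; left; apply/eqP.
apply: eq_integral => x _ /=.
transitivity (\int[mu]_(v in `]c, +oo[) (`|f x|%:E * ((v - c) `^ (p - 1) * (coshR x + v) `^ (-1 - q))%:E))%E.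
  apply: eq_integral => v _; rewrite /g !normrM -EFinM; congr EFin.
  by rewrite !(ger0_norm (powR_ge0 _ _)); ring.
have /integrableP[mi _] := integrable_betak_scale p1 pq (cx x).
rewrite ge0_integralZl//.
  rewrite integral_betak_scale// -EFinM !normrM [`|_ `^ _|]ger0_norm ?powR_ge0//.
  by rewrite (ger0_norm (ltW (betaI_gt0 p1 pq))); congr EFin; ring.
by move=> v _; rewrite lee_fin mulr_ge0 ?powR_ge0.
Qed.

Lemma weyl_stj_integrable : mu.-integrable `]c, +oo[
  (EFin \o (fun v => (v - c) `^ (p - 1) * stj f q v)).
Proof.
have i1' (v : R) : [set` `]c, +oo[%R] v -> mu.-integrable `]0, +oo[ (EFin \o g v).
  by rewrite /= in_itv/= andbT; exact: i1.
have := @integrable_fubini_on R _ _ _ _ mu mu `]c, +oo[%classic `]0, +oo[%classic g (measurable_itv _) (measurable_itv _) mg i1' glty.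
apply: eq_integrable => // v; rewrite inE/= in_itv/= andbT => cv; congr EFin.
rewrite /g RintegralZl//; apply: (integrable_stj mf fM); last exact: q0.
exact: lt_trans cv.
Qed.

Lemma weyl_stj : betaI p q * stj f (q - p) c =
  \int[mu]_(v in `]c, +oo[) ((v - c) `^ (p - 1) * stj f q v).
Proof.
transitivity (\int[mu]_(v in `]c, +oo[) \int[mu]_(x in `]0, +oo[) g v x); last first.
  apply: eq_Rintegral => v; rewrite inE/= in_itv/= andbT => cv.
  rewrite /g RintegralZl//; apply: (integrable_stj mf fM); last exact: q0.
  exact: lt_trans cv.
rewrite fubini_on//; last by move=> v; rewrite /= in_itv/= andbT; exact: i1.
rewrite /stj -RintegralZl//; apply: eq_Rintegral => x _.
by rewrite gE.
Qed.

End Weyl.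

(** * Pointwise bounds for the kernel and its gradient *)

Section HeatKernelDerivatives.
Context {R : realType}.
Notation mu := (@lebesgue_measure R).
Variables (nu t : R).
Hypotheses (nu0 : 0 <= nu) (t0 : 0 < t).
Implicit Types (x u q c : R).

Let al := nu / 2.
Let a := (4 * t)^-1.
Let S s c := stj (hw a) s c.

Let a0 : 0 < a. Proof. by rewrite invr_gt0 mulr_gt0. Qed.
Let al0 : 0 <= al. Proof. by rewrite divr_ge0. Qed.

Lemma is_derive_coshrho1 x u :
  is_derive x 1 (coshrho^~ u) (expR (- u) * x).
Proof.
by rewrite /coshrho; apply: is_derive_eq; rewrite /GRing.scale/=; field.
Qed.

Lemma is_derive_coshrho2 x u :
  is_derive u 1 (coshrho x) (expR u - coshrho x u).
Proof.
have dc := is_derive_coshR u; have de := is_derive_expRN u.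
rewrite /coshrho; apply: is_derive_eq; rewrite /GRing.scale/= -(coshRDsinhR u).
by field.
Qed.

Lemma Y1_heat_kernel x u : Y1 (heat_kernel nu t) (x, u) =
  - (hkcst nu t * expR (- (al * u)) * x * ((1 + al) * S (al + 1) (coshrho x u))).
Proof.
rewrite /Y1/=.
have -> : (fun y => heat_kernel nu t (y, u)) =
    (fun y => hkcst nu t * expR (- (al * u)) * S al (coshrho y u)).
  by apply/funext => y; rewrite heat_kernelE.
have d1 := is_derive_stj (measurable_hw a) (hw_ub a0) (coshrho_gt0 x u) al0.
have d2 := is_derive_chain (g := coshrho^~ u) d1 (is_derive_coshrho1 x u) erefl.
have d3 := is_deriveM (is_derive_cst (hkcst nu t * expR (- (al * u))) x 1) d2.
rewrite derive1E (@derive_val _ _ _ _ _ _ _ d3) /GRing.scale/=.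
have := expRxMexpNx_1 u; set e := expR u; set e' := expR (- u) => h.
transitivity ((e * e') * - (hkcst nu t * expR (- (al * u)) * x * ((1 + al) * S (al + 1) (coshrho x u)))).
  by rewrite /S; ring.
by rewrite h mul1r.
Qed.

Lemma Y0_heat_kernel x u : Y0 (heat_kernel nu t) (x, u) =
  hkcst nu t * expR (- (al * u)) *
  ((coshrho x u - expR u) * ((1 + al) * S (al + 1) (coshrho x u)) -
   al * S al (coshrho x u)).
Proof.
rewrite /Y0/=.
have -> : (fun v => heat_kernel nu t (x, v)) =
    (fun v => hkcst nu t * (expR (- (al * v)) * S al (coshrho x v))).
  by apply/funext => y; rewrite heat_kernelE// mulrA.
have d1 := is_derive_stj (measurable_hw a) (hw_ub a0) (coshrho_gt0 x u) al0.
have d2 := is_derive_chain (g := coshrho x) d1 (is_derive_coshrho2 x u) erefl.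
have h1 : is_derive u 1 (fun v => - (al * v)) (- al).
  by apply: is_derive_eq; rewrite /GRing.scale/=; ring.
have h2 := is_derive_chain (is_derive_expR _) h1 erefl.
have d3 := is_deriveM h2 d2.
have d4 := is_deriveM (is_derive_cst (hkcst nu t) u 1) d3.
rewrite derive1E (@derive_val _ _ _ _ _ _ _ d4) /GRing.scale/=.
rewrite /S; ring.
Qed.

End HeatKernelDerivatives.

Section RintegralLinear.
Context {R : realType}.
Notation mu := (@lebesgue_measure R).
Variables (D : set R) (f g : R -> R).

Lemma Rintegral_add : measurable D ->
  mu.-integrable D (EFin \o f) -> mu.-integrable D (EFin \o g) ->
  \int[mu]_(x in D) (f x + g x) = \int[mu]_(x in D) f x + \int[mu]_(x in D) g x.
Proof. by move=> mD i_f i_g; rewrite RintegralD. Qed.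

Lemma Rintegral_scale (k : R) : measurable D -> mu.-integrable D (EFin \o f) ->
  \int[mu]_(x in D) (k * f x) = k * \int[mu]_(x in D) f x.
Proof. by move=> mD i_f; rewrite RintegralZl. Qed.

End RintegralLinear.

Section WeylBounds.
Context {R : realType}.
Notation mu := (@lebesgue_measure R).
Variables (nu t : R) (m : nat).
Hypotheses (nu0 : 0 <= nu) (t0 : 0 < t) (mnu : nu / 2 + 1 <= m%:R).
Implicit Types (x u q c : R).

Let al := nu / 2.
Let a := (4 * t)^-1.
Let p := m%:R - al.
Let S s c := stj (hw a) s c.
Let E0 : R := expR (a * pi ^+ 2) / pi.

Let a0 : 0 < a. Proof. by rewrite invr_gt0 mulr_gt0. Qed.
Let al0 : 0 <= al. Proof. by rewrite divr_ge0. Qed.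
Let p1 : 1 <= p. Proof. by rewrite /p lerBrDl. Qed.
Let pm : p <= m%:R. Proof. by rewrite /p gerBl. Qed.
Let mpa : m%:R - p = al. Proof. by rewrite /p; ring. Qed.
Let E0_gt0 : 0 < E0. Proof. by rewrite divr_gt0 ?expR_gt0 ?pi_gt0. Qed.

(** The part of the constant of the kernel that depends on [nu] only. *)
Definition hkabs : R :=
  `|2 / Gamma (nu / 2) * 2 `^ (- (nu / 2)) * igcst (nu / 2)| / (2 * Num.sqrt pi).

Lemma hkabs_ge0 : 0 <= hkabs.
Proof. by rewrite divr_ge0// mulr_ge0// sqrtr_ge0. Qed.

(** The factor of [hkcst] that explodes as [t] tends to 0 is the one that normalizes
    [Gs]. *)
Lemma norm_hkcst : `|hkcst nu t| = hkabs * (Num.sqrt t)^-1 * E0.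
Proof.
have s0 : 0 < Num.sqrt (4 * pi ^+ 3 * t).
  by rewrite sqrtr_gt0 !mulr_gt0 ?exprn_gt0 ?pi_gt0.
have pi0 := @pi_gt0 R.
have sE : Num.sqrt (4 * pi ^+ 3 * t) = 2 * pi * Num.sqrt pi * Num.sqrt t.
  rewrite -[X in Num.sqrt X](_ : (2 * pi) ^+ 2 * (pi * t) = _); last by ring.
  rewrite sqrtrM ?sqr_ge0// sqrtr_sqr ger0_norm ?mulr_ge0 ?(ltW pi0)//.
  by rewrite sqrtrM ?(ltW pi0)// mulrA.
rewrite /hkcst -/a (_ : _ * igcst (nu / 2) =
  (2 / Gamma (nu / 2) * 2 `^ (- (nu / 2)) * igcst (nu / 2)) *
  (expR (a * pi ^+ 2) / Num.sqrt (4 * pi ^+ 3 * t))); last by ring.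
rewrite normrM [X in _ * X]ger0_norm; last by rewrite divr_ge0 ?expR_ge0// ltW.
rewrite sE /hkabs /E0; move: pi0; generalize (@pi R) => P P0; field.
by rewrite !gt_eqF ?sqrtr_gt0.
Qed.

Lemma Gs_stj k c : S k%:R c = (E0 * k`!%:R)^-1 * Gs a k c.
Proof.
rewrite /Gs /cmseq -/E0 /S [RHS](_ : _ = (E0 * k`!%:R)^-1 * (E0 * k`!%:R) * stj (hw a) k%:R c).
  by rewrite mulVf ?mul1r// mulf_neq0 ?gt_eqF// ltr0n fact_gt0.
by rewrite /E0; ring.
Qed.

Let norm_S k v : 1 < v -> `|stj (hw a) k%:R v| = (E0 * k`!%:R)^-1 * Gs a k v.
Proof.
move=> v1; rewrite -/(S k%:R v) Gs_stj ger0_norm//.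
by rewrite mulr_ge0 ?Gs_ge0// invr_ge0 mulr_ge0// ltW.
Qed.

Definition weylcst (n : nat) : R := hkabs / (betaI p n%:R * n`!%:R).

(** Absolute values go under the integral; the integrability of [phi] allows the constant
    to be moved inside first. *)
Lemma weyl_bound (K X c0 : R) (phi psi : R -> R) : 0 <= K ->
  mu.-integrable `]c0, +oo[ (EFin \o (fun v => (v - c0) `^ (p - 1) * phi v)) ->
  `|X| = K * `|\int[mu]_(v in `]c0, +oo[) ((v - c0) `^ (p - 1) * phi v)| ->
  (forall v, c0 < v -> K * `|phi v| <= psi v) ->
  (`|X|%:E <= \int[mu]_(v in `]c0, +oo[) ((v - c0) `^ (p - 1) * psi v)%:E)%E.
Proof.
move=> K0 iphi -> Kpsi.
pose f v := K * ((v - c0) `^ (p - 1) * phi v).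
have i_f : mu.-integrable `]c0, +oo[ (EFin \o f) by exact: integrable_scale.
rewrite -(ger0_norm K0) -normrM -RintegralZl//.
have fin : (\int[mu]_(v in `]c0, +oo[) (f v)%:E)%E \is a fin_num.
  exact: integrable_fin_num.
apply: (@le_trans _ _ (\int[mu]_(v in `]c0, +oo[) `|(f v)%:E|)%E).
  have /integrableP[mef _] := i_f.
  by have := le_abse_integral mu (measurable_itv _) mef; rewrite /= -[X in (`|X| <= _)%E -> _]fineK.
apply: le_ge0_integral => v; first by rewrite abse_ge0.
rewrite /= in_itv/= andbT => cv; rewrite lee_fin /f !normrM (ger0_norm (powR_ge0 _ _)) mulrCA (ger0_norm K0).
by rewrite ler_wpM2l ?powR_ge0// Kpsi.
Qed.

Let sqt := Num.sqrt t.
Let sqt0 : 0 < sqt. Proof. by rewrite sqrtr_gt0. Qed.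

Lemma coshrho_ge1 x u : 1 <= coshrho x u.
Proof. by rewrite (le_trans (coshR_ge1 u))// lerDl divr_ge0// mulr_ge0 ?expR_ge0 ?sqr_ge0. Qed.

Let b0 (n : nat) : (m <= n)%N -> 0 < betaI p n%:R.
Proof. by move=> mn; apply: betaI_gt0 => //; rewrite (le_trans pm)// ler_nat. Qed.

Let hk_Gs (n k : nat) (x u v : R) : (m <= n)%N -> coshrho x u < v ->
  `|hkcst nu t| * expR (- (al * u)) / betaI p n%:R * ((E0 * n`!%:R)^-1 * Gs a k v) =
  weylcst n / sqt * expR (- (al * u)) * Gs a k v.
Proof.
move=> mn cv; rewrite norm_hkcst /weylcst -/sqt; field.
by rewrite !gt_eqF ?b0// ltr0n fact_gt0.
Qed.

Lemma heat_kernel_weyl x u :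
  (`|heat_kernel nu t (x, u)|%:E <= \int[mu]_(v in `]coshrho x u, +oo[)
    ((v - coshrho x u) `^ (p - 1) * (weylcst m / sqt * expR (- (al * u)) * Gs a m v))%:E)%E.
Proof.
set c := coshrho x u; have c1 : 1 <= c := coshrho_ge1 x u; have c0 := coshrho_gt0 x u.
have W := weyl_stj (measurable_hw a) (hw_ub a0) p1 pm c0.
have Wi := weyl_stj_integrable (measurable_hw a) (hw_ub a0) p1 pm c0.
rewrite mpa in W.
apply: (@weyl_bound (`|hkcst nu t| * expR (- (al * u)) / betaI p m%:R) _ c _ _ _ Wi).
- by rewrite divr_ge0 ?mulr_ge0 ?expR_ge0// ltW// b0.
- rewrite -W heat_kernelE// -/a -/al; generalize (hkcst nu t) => H; rewrite !normrM (ger0_norm (expR_ge0 _)).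
  rewrite (gtr0_norm (b0 (leqnn m))); field; rewrite gt_eqF//; exact: b0.
move=> v cv; have v1 : 1 < v by exact: le_lt_trans cv.
by rewrite norm_S// (@hk_Gs m m x u).
Qed.

Lemma Y1_weyl x u :
  (`|Y1 (heat_kernel nu t) (x, u)|%:E <= \int[mu]_(v in `]coshrho x u, +oo[)
    ((v - coshrho x u) `^ (p - 1) *
     ((1 + al) * weylcst m.+1 / sqt * expR (- (al * u)) * `|x| * Gs a m.+1 v))%:E)%E.
Proof.
set c := coshrho x u; have c1 : 1 <= c := coshrho_ge1 x u; have c0 := coshrho_gt0 x u.
have pm1 : p <= m.+1%:R by rewrite (le_trans pm)// ler_nat.
have W := weyl_stj (measurable_hw a) (hw_ub a0) p1 pm1 c0.
have Wi := weyl_stj_integrable (measurable_hw a) (hw_ub a0) p1 pm1 c0.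
rewrite (_ : m.+1%:R - p = al + 1) in W; last by rewrite -natr1 /p; ring.
have al1 : 0 <= 1 + al by rewrite addr_ge0.
apply: (@weyl_bound (`|hkcst nu t| * expR (- (al * u)) / betaI p m.+1%:R * (`|x| * (1 + al))) _ c _ _ _ Wi).
- apply: mulr_ge0; last by rewrite mulr_ge0.
  by rewrite divr_ge0 ?mulr_ge0 ?expR_ge0// ltW// b0.
- rewrite -W Y1_heat_kernel// -/a -/al normrN; generalize (hkcst nu t) => H.
  rewrite !normrM (ger0_norm (expR_ge0 _)).
  rewrite (gtr0_norm (b0 (leqnSn m))) (ger0_norm al1); field; rewrite gt_eqF//; exact: b0.
move=> v cv; have v1 : 1 < v by exact: le_lt_trans cv.
rewrite norm_S// mulrAC (@hk_Gs m.+1 m.+1 x u)//.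
by rewrite le_eqVlt; apply/orP; left; apply/eqP; ring.
Qed.

(** The factor [c - q] does not commute with the Weyl integral; write
    [v - q = (v - c) + (c - q)] inside, where the first summand raises [p] by one. *)
Lemma weyl_twist q c : 0 < c ->
  mu.-integrable `]c, +oo[ (EFin \o (fun v => (v - c) `^ (p - 1) *
     ((m%:R + 1) * (v - q) * S m.+1%:R v - m%:R * S m%:R v))) /\
  betaI p m%:R * ((c - q) * ((1 + al) * S (al + 1) c) - al * S al c) =
  \int[mu]_(v in `]c, +oo[) ((v - c) `^ (p - 1) *
     ((m%:R + 1) * (v - q) * S m.+1%:R v - m%:R * S m%:R v)).
Proof.
move=> c0.
have pm1 : p <= m.+1%:R by rewrite (le_trans pm)// ler_nat.
have p11 : 1 <= p + 1 by rewrite lerDr; exact: le_trans p1.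
have pm11 : p + 1 <= m.+1%:R by rewrite -natr1 lerD2r.
have W1 := weyl_stj (measurable_hw a) (hw_ub a0) p11 pm11 c0.
have i1 := weyl_stj_integrable (measurable_hw a) (hw_ub a0) p11 pm11 c0.
have W2 := weyl_stj (measurable_hw a) (hw_ub a0) p1 pm1 c0.
have i2 := weyl_stj_integrable (measurable_hw a) (hw_ub a0) p1 pm1 c0.
have W3 := weyl_stj (measurable_hw a) (hw_ub a0) p1 pm c0.
have i3 := weyl_stj_integrable (measurable_hw a) (hw_ub a0) p1 pm c0.
rewrite (_ : m.+1%:R - (p + 1) = al) in W1; last by rewrite -natr1 /p; ring.
rewrite (_ : m.+1%:R - p = al + 1) in W2; last by rewrite -natr1 /p; ring.
rewrite mpa in W3.
set f1 := (fun v => _ * stj (hw a) m.+1%:R v) in W1 i1.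
set f2 := (fun v => _ * stj (hw a) m.+1%:R v) in W2 i2.
set f3 := (fun v => _ * stj (hw a) m%:R v) in W3 i3.
have j1 := integrable_scale (m%:R + 1) (measurable_itv _) i1.
have j2 := integrable_scale ((m%:R + 1) * (c - q)) (measurable_itv _) i2.
have j3 := integrable_scale (- m%:R) (measurable_itv _) i3.
have j12 := integrable_add (measurable_itv _) j1 j2.
have j123 := integrable_add (measurable_itv _) j12 j3.
have E v : c < v -> (m%:R + 1) * f1 v + (m%:R + 1) * (c - q) * f2 v + (- m%:R) * f3 v =
   (v - c) `^ (p - 1) * ((m%:R + 1) * (v - q) * S m.+1%:R v - m%:R * S m%:R v).
  move=> cv; have vc : 0 < v - c by rewrite subr_gt0.
  rewrite /f1 /f2 /f3 (_ : p + 1 - 1 = p - 1 + 1); last by ring.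
  rewrite (@powRD _ (v - c) (p - 1) 1); last by rewrite (gt_eqF vc) implybT.
  by rewrite powRr1 ?(ltW vc)// /S; ring.
clearbody f1 f2 f3.
split.
  apply: eq_integrable j123 => // v; rewrite inE/= in_itv/= andbT => cv /=.
  by rewrite E.
transitivity (\int[mu]_(v in `]c, +oo[) ((m%:R + 1) * f1 v + (m%:R + 1) * (c - q) * f2 v + (- m%:R) * f3 v)); last first.
  by apply: eq_Rintegral => v; rewrite inE/= in_itv/= andbT => cv; rewrite E.
rewrite (Rintegral_add (measurable_itv _) j12 j3) (Rintegral_add (measurable_itv _) j1 j2).
rewrite (Rintegral_scale _ (measurable_itv _) i1) (Rintegral_scale _ (measurable_itv _) i2).
rewrite (Rintegral_scale _ (measurable_itv _) i3) -W1 -W2 -W3.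
have := betaI_add p1 pm; have := betaI_deriv p1 pm; rewrite mpa !natr1.
set b1 := betaI _ _; set b2 := betaI p m%:R; set b3 := betaI (p + 1) _ => h1 h2.
rewrite /S; set s1 := stj _ al c; set s2 := stj _ _ c.
(* Both beta integrals become multiples of [b2]; the coefficients of [S al] then
   add up to [- al]. *)
have e3 : m.+1%:R * b3 = (m.+1%:R - (1 + al)) * b2.
  by rewrite -[b3](addrK b1) h2 mulrBr h1; ring.
rewrite (_ : m.+1%:R * (b3 * s1) + m.+1%:R * (c - q) * (b1 * s2) + - m%:R * (b2 * s1) =
  (m.+1%:R * b3) * s1 + (c - q) * (m.+1%:R * b1) * s2 - m%:R * (b2 * s1)); last by ring.
by rewrite e3 h1 -natr1; ring.
Qed.

Lemma Y0_weyl x u :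
  (`|Y0 (heat_kernel nu t) (x, u)|%:E <= \int[mu]_(v in `]coshrho x u, +oo[)
    ((v - coshrho x u) `^ (p - 1) *
     (weylcst m / sqt * expR (- (al * u)) * `|Eseq a (expR u) m v|))%:E)%E.
Proof.
set c := coshrho x u; have c1 : 1 <= c := coshrho_ge1 x u; have c0 := coshrho_gt0 x u.
have [Wi W] := weyl_twist (expR u) c0.
apply: (@weyl_bound (`|hkcst nu t| * expR (- (al * u)) / betaI p m%:R) _ c _ _ _ Wi).
- by rewrite divr_ge0 ?mulr_ge0 ?expR_ge0// ltW// b0.
- pose Z := (c - expR u) * ((1 + al) * S (al + 1) c) - al * S al c.
  have -> : Y0 (heat_kernel nu t) (x, u) = hkcst nu t * expR (- (al * u)) * Z.
    exact: Y0_heat_kernel.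
  have <- : betaI p m%:R * Z = _ := W.
  generalize (hkcst nu t) Z => H z; rewrite !normrM (ger0_norm (expR_ge0 _)).
  rewrite (gtr0_norm (b0 (leqnn m))).
  by field; rewrite gt_eqF//; exact: b0.
move=> v cv; have v1 : 1 < v by exact: le_lt_trans cv.
have f0 : 0 < m`!%:R :> R by rewrite ltr0n fact_gt0.
have -> : (m%:R + 1) * (v - expR u) * S m.+1%:R v - m%:R * S m%:R v =
    (E0 * m`!%:R)^-1 * Eseq a (expR u) m v.
  rewrite !Gs_stj factS natrM /Eseq natr1; field.
  by rewrite !gt_eqF// ltr0n.
set Z := Eseq _ _ _ _.
have -> : `|(E0 * m`!%:R)^-1 * Z| = (E0 * m`!%:R)^-1 * `|Z|.
  by rewrite normrM (@ger0_norm _ (E0 * m`!%:R)^-1)// invr_ge0 mulr_ge0// ltW.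
rewrite norm_hkcst /weylcst -/sqt le_eqVlt; apply/orP; left; apply/eqP; field.
by rewrite !gt_eqF ?b0.
Qed.

End WeylBounds.

(** * Integration over horocycles *)

Section HorocycleSlice.
Context {R : realType}.
Notation mu := (@lebesgue_measure R).
Variables (lam sig : R) (Th : R -> R).
Hypotheses (sig0 : 0 <= sig) (mTh : measurable_fun (`]1, +oo[ : set R) Th)
  (Th0 : forall v, 1 < v -> 0 <= Th v).
Implicit Types (x u v : R).

Let Th1 : R -> R := Th \_ `]1, +oo[.

Let mTh1 : measurable_fun [set: R] Th1.
Proof. exact: (iffLR (measurable_restrictT Th (measurable_itv `]1, +oo[)) mTh). Qed.

Let Th1E v : 1 < v -> Th1 v = Th v.
Proof. by move=> v1; rewrite /Th1 patchE mem_setE in_itv/= v1. Qed.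

Let Th1_ge0 v : 0 <= Th1 v.
Proof.
by rewrite /Th1 patchE mem_setE in_itv/= andbT; case: ifPn => // v1; exact: Th0.
Qed.

Let x2max u v : R := 2 * expR u * (v - 1).

(** In the domain [v > coshrho x u] one has [cosh u < v] and
    [x^2 <= 2 e^u (v - 1)]; on this larger domain [x] is moreover replaced by its
    maximum in the integrand, which makes the [x]-integral that of a constant. *)
Definition slicek (z : (R * R) * R) : R :=
  if [&& 0 <= z.1.1, coshR z.1.2 < z.2 & z.1.1 ^+ 2 <= x2max z.1.2 z.2]
  then expR (lam * z.1.2) * x2max z.1.2 z.2 `^ (sig / 2) * Th1 z.2 else 0.

Lemma slicek_ge0 z : 0 <= slicek z.
Proof. by rewrite /slicek; case: ifPn => // _; rewrite !mulr_ge0 ?expR_ge0 ?powR_ge0. Qed.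

Lemma measurable_slicek : measurable_fun [set: (R * R) * R] slicek.
Proof.
have m1 : measurable_fun [set: (R * R) * R] (fun z => z.1.1) by exact: measurableT_comp.
have m2 : measurable_fun [set: (R * R) * R] (fun z => z.1.2) by exact: measurableT_comp.
have m3 : measurable_fun [set: (R * R) * R] (fun z => z.2) by exact: measurable_snd.
have mX : measurable_fun [set: (R * R) * R] (fun z => x2max z.1.2 z.2).
  apply: measurable_funM; last exact: measurable_funB.
  by apply: measurable_funM => //; apply: measurableT_comp.
apply: measurable_fun_ifT.
- apply: measurable_and; first exact: measurable_fun_ler.
  apply: measurable_and.
    apply: measurable_fun_ltr => //; apply: measurableT_comp => //.
    exact: measurable_coshR.
  by apply: measurable_fun_ler => //; exact: measurable_funX.
- apply: measurable_funM; last exact: (measurableT_comp mTh1 m3).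
  apply: measurable_funM.
    by apply: measurableT_comp => //; exact: measurable_funM.
  by apply: (measurableT_comp (f := fun a : R => a `^ (sig / 2))).
- exact: measurable_cst.
Qed.

Definition sliceI (z : R * R) : \bar R := \int[mu]_v (slicek (z, v))%:E.

Let mslice : measurable_fun [set: (R * R) * R] (EFin \o slicek).
Proof. by apply/measurable_EFinP; exact: measurable_slicek. Qed.

Let slice0 z : (0 <= (EFin \o slicek) z)%E.
Proof. by rewrite lee_fin slicek_ge0. Qed.

Lemma measurable_sliceI : measurable_fun [set: R * R] sliceI.
Proof. exact: (measurable_fun_fubini_tonelli_F (m2 := mu) _ mslice slice0). Qed.

Lemma sliceI_ge0 z : (0 <= sliceI z)%E.
Proof. by apply: integral_ge0 => v _; exact: slice0. Qed.

Lemma sliceI_ub x u (psi : R -> R) : 0 <= x ->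
  (forall v, coshrho x u < v -> 0 <= psi v <= expR (lam * u) * x `^ sig * Th v) ->
  (\int[mu]_(v in `]coshrho x u, +oo[) (psi v)%:E <= sliceI (x, u))%E.
Proof.
move=> x0 H; rewrite integral_mkcond /sliceI.
apply: le_ge0_integral => v _; rewrite patchE mem_setE in_itv/= andbT; case: ifPn => // cv.
- by have /andP[] := H v cv.
- have /andP[_ h] := H v cv; rewrite lee_fin.
  apply: (le_trans h); rewrite /slicek/= x0/=.
  have c1 := coshR_ge1 u; have e0 := expR_gt0 u.
  have ee : expR u * expR (- u) = 1 := expRxMexpNx_1 u.
  have xv : x ^+ 2 <= x2max u v.
    have : coshR u + expR (- u) * x ^+ 2 / 2 <= v := ltW cv.
    move=> h1; rewrite /x2max -(ler_pM2l (expR_gt0 (- u))).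
    rewrite (_ : expR (- u) * (2 * expR u * (v - 1)) = 2 * (v - 1)); first lra.
    by rewrite -mulrA mulrCA [expR (- u) * _]mulrA [expR (- u) * _]mulrC ee mul1r.
  have uv : coshR u < v.
    apply: le_lt_trans cv; rewrite lerDl divr_ge0// mulr_ge0 ?expR_ge0 ?sqr_ge0//.
  rewrite uv xv/= Th1E; last by apply: le_lt_trans uv.
  rewrite ler_wpM2r ?Th0//; first by apply: le_lt_trans uv.
  rewrite ler_wpM2l ?expR_ge0//.
  have -> : x `^ sig = (x ^+ 2) `^ (sig / 2).
    by rewrite -powR_mulrn// -powRrM; congr (_ `^ _); field.
  by rewrite ge0_ler_powR ?nnegrE ?sqr_ge0 ?divr_ge0// (le_trans _ xv)// sqr_ge0.
- by rewrite lee_fin slicek_ge0.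
Qed.

Let be := (sig + 1) / 2.

Lemma integral_slicek_x u v : (\int[mu]_x (slicek ((x, u), v))%:E =
  if (coshR u < v)%R then (2 `^ be * (v - 1) `^ be * Th v * expR ((lam + be) * u))%:E else 0)%E.
Proof.
case: ifPn => uv; last first.
  by rewrite integral0_eq// => x _; rewrite /slicek/= (negbTE uv)/= andbF.
have v1 : 1 < v by apply: le_lt_trans uv; exact: coshR_ge1.
pose X := x2max u v; have X0 : 0 < X by rewrite !mulr_gt0 ?expR_gt0 ?subr_gt0.
pose q := expR (lam * u) * X `^ (sig / 2) * Th v.
transitivity (\int[mu]_(x in `[0%R, Num.sqrt X]) q%:E)%E.
  rewrite [RHS]integral_mkcond; apply: eq_integral => x _.
  rewrite patchE mem_setE in_itv/= /slicek/= uv/= Th1E// -/X -/q.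
  case: (leP 0 x) => x0 //=.
  rewrite -[x ^+ 2 <= X](_ : (x <= Num.sqrt X) = _); first by case: ifP.
  by rewrite -{2}(sqr_sqrtr (ltW X0)) ler_pXn2r// ?nnegrE// sqrtr_ge0.
rewrite integral_cst//= lebesgue_measure_itv/= lte_fin sqrtr_gt0 X0 -EFinB subr0 -EFinM.
congr EFin; rewrite -powR12_sqrt ?(ltW X0)// /q.
rewrite (_ : expR ((lam + be) * u) = expR (lam * u) * expR (be * u)); last first.
  by rewrite mulrDl expRD.
have -> : expR (be * u) = expR u `^ be by rewrite /powR gt_eqF ?expR_gt0// expRK.
rewrite (_ : 2 `^ be * (v - 1) `^ be * Th v * (expR (lam * u) * expR u `^ be) =
  expR (lam * u) * Th v * (2 `^ be * expR u `^ be * (v - 1) `^ be)); last by ring.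
rewrite -!powRM ?mulr_ge0 ?expR_ge0 ?subr_ge0 ?(ltW v1)// -/(x2max u v) -/X.
rewrite (_ : be = sig / 2 + 2^-1); last by rewrite /be; field.
by rewrite (@powRD _ X); [ring|rewrite (gt_eqF X0) implybT].
Qed.

(** Integrating first over [x], of which the slice is the interval from 0 to
    [sqrt (2 e^u (v - 1))], then over [u], which ranges over [|u| < arccosh v]. *)
Lemma integral_sliceI : (\int[mu \x mu]_z sliceI z =
  \int[mu]_(v in `]1%R, +oo[) ((2 `^ be * (v - 1) `^ be * Th v)%:E *
    \int[mu]_(u in `](- arccosh v)%R, (arccosh v)%R[) (expR ((lam + be) * u))%:E))%E.
Proof.
pose K (z : R * R) : R := if coshR z.1 < z.2
  then 2 `^ be * (z.2 - 1) `^ be * Th1 z.2 * expR ((lam + be) * z.1) else 0.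
have mK : measurable_fun [set: R * R] (EFin \o K).
  apply/measurable_EFinP; apply: measurable_fun_ifT.
  - apply: measurable_fun_ltr; last exact: measurable_snd.
    by apply: measurableT_comp => //; exact: measurable_coshR.
  - apply: measurable_funM.
      apply: measurable_funM; last exact: (measurableT_comp mTh1 measurable_snd).
      apply: measurable_funM; first exact: measurable_cst.
      apply: (measurableT_comp (f := fun a : R => a `^ be)) => //.
      by apply: measurable_funB; [exact: measurable_snd|exact: measurable_cst].
    by apply: measurableT_comp => //; exact: measurable_funM.
  - exact: measurable_cst.
have K0 z : (0 <= (EFin \o K) z)%E.
  by rewrite lee_fin /K; case: ifP => // _; rewrite !mulr_ge0 ?powR_ge0 ?expR_ge0.
transitivity (\int[mu]_u \int[mu]_v (K (u, v))%:E)%E.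
  transitivity (\int[mu]_u (fubini_G mu sliceI u))%E.
    exact: (fubini_tonelli2 (m1 := mu) (m2 := mu) sliceI measurable_sliceI sliceI_ge0).
  apply: eq_integral => u _; rewrite /fubini_G /sliceI.
  pose s (z : R * R) : \bar R := (slicek ((z.1, u), z.2))%:E.
  have ms : measurable_fun [set: R * R] s.
    apply: (measurableT_comp mslice (f := EFin \o slicek) (g := fun z : R * R => ((z.1, u), z.2))).
    by do 2 apply: measurable_fun_pair => //.
  have s0 z : (0 <= s z)%E by exact: slice0.
  have := fubini_tonelli (m1 := mu) (m2 := mu) s ms s0 => /= ->.
  apply: eq_integral => v _; rewrite integral_slicek_x /K /=.
  by case: ifPn => // uv; rewrite Th1E//; apply: le_lt_trans uv; exact: coshR_ge1.
have := fubini_tonelli (m1 := mu) (m2 := mu) (EFin \o K) mK K0 => /= ->.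
rewrite [RHS]integral_mkcond; apply: eq_integral => v _.
rewrite patchE mem_setE in_itv/= andbT.
transitivity (\int[mu]_u (if (coshR u < v)%R then
  (2 `^ be * (v - 1) `^ be * Th v * expR ((lam + be) * u))%:E else 0))%E.
  apply: eq_integral => u _; rewrite /K /=; case: ifPn => // uv.
  by rewrite Th1E//; apply: le_lt_trans uv; exact: coshR_ge1.
case: ifPn => v1; last first.
  rewrite integral0_eq// => u _; rewrite ifF//; apply/negbTE.
  by apply: contra v1; apply: le_lt_trans; exact: coshR_ge1.
have r0 := arccosh_gt0 v1.
have mexp : measurable_fun [set: R] (fun u => (expR ((lam + be) * u))%:E).
  apply/measurable_EFinP; apply: measurableT_comp => //; exact: measurable_funM.
have cst0 : 0 <= 2 `^ be * (v - 1) `^ be * Th v by rewrite !mulr_ge0 ?powR_ge0// Th0.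
rewrite -ge0_integralZl; last 4 first.
- exact: measurable_itv.
- exact: measurable_funTS mexp.
- by move=> u _; rewrite lee_fin expR_ge0.
- by rewrite lee_fin.
rewrite [RHS]integral_mkcond; apply: eq_integral => u _.
rewrite patchE mem_setE in_itv/= -ltr_norml.
have -> : (coshR u < v) = (`|u| < arccosh v).
  have -> : coshR u = coshR `|u|.
    by case: (leP 0 u) => h; [rewrite ger0_norm|rewrite ltr0_norm// coshRN].
  apply/idP/idP => h.
    rewrite ltNge; apply/negP => h'; have := ler_coshR (ltW r0) h'.
    by rewrite coshR_arccosh ?(ltW v1)// leNgt h.
  by rewrite -[ltRHS](coshR_arccosh (ltW v1)) ltr_coshR.
by case: ifP.
Qed.

End HorocycleSlice.

Section HorocycleWeights.
Context {R : realType}.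
Notation mu := (@lebesgue_measure R).

Lemma integral_expR_sym (ka r : R) : ka != 0 -> 0 < r ->
  (\int[mu]_(u in `](- r)%R, r[) (expR (ka * u))%:E = (2 * sinhR (ka * r) / ka)%:E)%E.
Proof.
move=> k0 r0; pose F (u : R) := expR (ka * u) / ka.
have dF (u : R) : is_derive u 1 F (expR (ka * u)).
  have h1 : is_derive u 1 (fun u => ka * u) ka.
    by apply: is_derive_eq; rewrite /GRing.scale/= mulr1.
  have h2 := is_derive_chain (is_derive_expR _) h1 erefl.
  by apply: is_derive_eq; rewrite /GRing.scale/=; field.
have cf : continuous (fun u : R => expR (ka * u)).
  move=> u; apply: (continuous_comp (f := fun u : R => ka * u) (g := expR)); last exact: continuous_expR.
  by apply: cvgM; [exact: cvg_cst|exact: cvg_id].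
have cF (u : R) : {for u, continuous F} := is_derive_continuous (dF u).
rewrite integral_itv_bndo_bndc; last first.
  apply/measurable_EFinP; apply: measurable_funTS.
  exact: continuous_measurable_fun.
rewrite (@integral_itv_obnd_cbnd R); last first.
  apply/measurable_EFinP; apply: measurable_funTS.
  exact: continuous_measurable_fun.
rewrite (@continuous_FTC2 _ _ F).
- rewrite -EFinB; congr EFin; rewrite /F mulrN -(coshRDsinhR (ka * r)) -(expRN_coshRBsinhR (ka * r)).
  by field.
- lra.
- exact: continuous_subspaceT.
- split.
  + by move=> u _; have [] := dF u.
  + exact: cvg_at_right_filter (cF _).
  + exact: cvg_at_left_filter (cF _).
- by move=> u _; rewrite derive1E; have [_ ->] := dF u.
Qed.

Lemma integral_one_sym (r : R) : 0 < r ->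
  (\int[mu]_(u in `](- r)%R, r[) (expR (0 * u))%:E = (2 * r)%:E)%E.
Proof.
move=> r0; under eq_integral do rewrite mul0r expR0.
rewrite integral_cst//= lebesgue_measure_itv/= lte_fin ifT; last lra.
by rewrite mul1e -EFinB; congr EFin; ring.
Qed.

Lemma sinhR_half (r : R) : 0 <= r -> sinhR (r / 2) = Num.sqrt ((coshR r - 1) / 2).
Proof.
move=> r0; have s0 : 0 <= sinhR (r / 2) by rewrite sinhR_ge0// divr_ge0.
rewrite -[LHS]ger0_norm// -sqrtr_sqr; congr Num.sqrt.
rewrite {2}(_ : r = r / 2 + r / 2); last by field.
by rewrite coshRD -!expr2 coshR_sqr; field.
Qed.

End HorocycleWeights.

(** * Weighted radial bounds *)

Section WeightedBounds.
Context {R : realType}.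
Notation mu := (@lebesgue_measure R).
Implicit Types (F : nat -> R -> R).

Lemma measurable_dseq F k : dseq F -> measurable_fun (`]1, +oo[ : set R) (F k).
Proof.
move=> dF; apply: open_continuous_measurable_fun => // c.
rewrite inE/= in_itv/= andbT => c1; exact: is_derive_continuous (dF k c c1).
Qed.

Lemma measurable_arccosh : measurable_fun (`]1, +oo[ : set R) (@arccosh R).
Proof.
apply: open_continuous_measurable_fun => // c.
rewrite inE/= in_itv/= andbT => c1; exact: is_derive_continuous (is_derive_arccosh c1).
Qed.

Lemma measurable_hbar (s N : R) : 1 <= N -> measurable_fun (`]1, +oo[ : set R) (hbar s N).
Proof.
move=> N1; apply: open_continuous_measurable_fun => // c.
by rewrite inE/= in_itv/= andbT => c1; exact: continuous_hbar.
Qed.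

Lemma integral_le_hbar (f : R -> R) (s N B : R) : 0 < s -> 1 <= N -> 0 <= B ->
  (forall v, 1 < v -> 0 <= f v <= B * hbar s N v) ->
  (\int[mu]_(v in `]1%R, +oo[) (f v)%:E <= (B * N)%:E)%E.
Proof.
move=> s0 N1 B0 fB.
apply: (@le_trans _ _ (\int[mu]_(v in `]1%R, +oo[) (B%:E * (hbar s N v)%:E))%E).
  by apply: le_ge0_integral => v /=; rewrite in_itv/= andbT => /fB/andP[]; rewrite -?EFinM ?lee_fin.
rewrite ge0_integralZl//.
- by rewrite EFinM lee_wpmul2l ?lee_fin//; exact: integral_hbar.
- by apply/measurable_EFinP; exact: measurable_hbar.
- by move=> v /=; rewrite in_itv/= andbT => v1; rewrite lee_fin hbar_ge0.
Qed.

Variables (nu eps t : R) (k : nat).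
Hypotheses (nu1 : 1 <= nu) (e0 : 0 <= eps) (t0 : 0 < t)
  (knu : nu / 2 <= k%:R).

Let al := nu / 2.
Let s := Num.sqrt t.
Let p := k.+1%:R - al.

Let s0 : 0 < s. Proof. by rewrite sqrtr_gt0. Qed.
Let nu0 : 0 <= nu. Proof. exact: le_trans nu1. Qed.
Let p1 : 1 <= p. Proof. by rewrite /p -natr1 lerBrDl lerD2r. Qed.

Definition expW (c : R) : R := expR (eps * arccosh c / s).

Lemma expW_homo (c v : R) : 1 <= c -> c <= v -> expW c <= expW v.
Proof.
move=> c1 cv; rewrite ler_expR ler_wpM2r ?invr_ge0 ?(ltW s0)//.
by rewrite ler_wpM2l// ler_arccosh.
Qed.

(** The integrand with [coshrho x u] replaced by [v] in the exponential weight and by 1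
    in the power of [v - coshrho x u]; both increase because the exponent [p - 1] is
    nonnegative. *)
Definition sliceT (Th : R -> R) (v : R) : R := expW v * (v - 1) `^ (p - 1) * Th v.

(** The majorant of a term carrying [x^j e^(l u)] besides the common factor
    [e^(- alpha u)] and the density [x^(nu - 1)]. *)
Definition sliceH (j : nat) (l : R) (Th : R -> R) : R * R -> \bar R :=
  sliceI (l - al) (nu - 1 + j%:R) (sliceT Th).

Lemma measurable_sliceT (Th : R -> R) : measurable_fun (`]1, +oo[ : set R) Th ->
  measurable_fun (`]1, +oo[ : set R) (sliceT Th).
Proof.
move=> mTh; apply: measurable_funM => //; apply: measurable_funM.
  apply: (measurableT_comp (f := expR)) => //; apply: measurable_funM => //.
  by apply: measurable_funM => //; exact: measurable_arccosh.
apply: measurable_funTS; have := @measurable_powR_affine R 1 (- 1) (p - 1).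
by congr measurable_fun; apply/funext => v; rewrite mul1r.
Qed.

Lemma sliceT_ge0 (Th : R -> R) : (forall v, 1 < v -> 0 <= Th v) -> forall v, 1 < v -> 0 <= sliceT Th v.
Proof. by move=> Th0 v v1; rewrite /sliceT !mulr_ge0 ?expR_ge0 ?powR_ge0 ?Th0. Qed.

Let sig0 (j : nat) : 0 <= nu - 1 + j%:R.
Proof. by rewrite addr_ge0// subr_ge0. Qed.

Let powR_mulX (j : nat) (x : R) : 0 <= x -> x `^ (nu - 1) * x ^+ j = x `^ (nu - 1 + j%:R).
Proof.
rewrite le_eqVlt => /predU1P[<-|x0].
  case: j => [|j]; first by rewrite expr0 mulr1 addr0.
  rewrite exprS mul0r mulr0 powR0// gt_eqF// ltr_wpDl ?subr_ge0//.
rewrite (@powRD _ x (nu - 1) j%:R); last by rewrite (gt_eqF x0) implybT.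
by rewrite powR_mulrn// ltW.
Qed.

Lemma sliceH_ub (j : nat) (l x u : R) (Th : R -> R) : 0 <= x ->
  measurable_fun (`]1, +oo[ : set R) Th -> (forall v, 1 < v -> 0 <= Th v) ->
  (\int[mu]_(v in `]coshrho x u, +oo[)
     (expW (coshrho x u) * x `^ (nu - 1) * ((v - coshrho x u) `^ (p - 1) *
        (expR (- (al * u)) * x ^+ j * expR (l * u) * Th v)))%:E <= sliceH j l Th (x, u))%E.
Proof.
move=> x0 mTh Th0; apply: (sliceI_ub (sig0 j) (sliceT_ge0 Th0) x0).
move=> v cv; set c := coshrho x u in cv *.
have c1 : 1 <= c := coshrho_ge1 x u; have v1 : 1 < v by exact: le_lt_trans cv.
rewrite !mulr_ge0 ?powR_ge0 ?expR_ge0 ?exprn_ge0 ?Th0//=.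
rewrite (_ : (l - al) * u = - (al * u) + l * u); last by ring.
rewrite expRD -powR_mulX// /sliceT.
rewrite [leLHS](_ : _ = expR (- (al * u)) * expR (l * u) * (x `^ (nu - 1) * x ^+ j) *
  (expW c * (v - c) `^ (p - 1) * Th v)); last by ring.
rewrite ler_wpM2l ?mulr_ge0 ?expR_ge0 ?powR_ge0 ?exprn_ge0// ler_wpM2r ?Th0//.
rewrite ler_pM ?expR_ge0 ?powR_ge0 ?expW_homo ?(ltW cv)//.
by rewrite ge0_ler_powR ?nnegrE ?subr_ge0 ?(ltW cv) ?(ltW v1)// lerD2l lerN2.
Qed.

Lemma sliceH_ge0 j l (Th : R -> R) z : (forall v, 1 < v -> 0 <= Th v) -> (0 <= sliceH j l Th z)%E.
Proof. by move=> Th0; exact/sliceI_ge0/sliceT_ge0. Qed.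

Lemma measurable_sliceH j l (Th : R -> R) : measurable_fun (`]1, +oo[ : set R) Th ->
  (forall v, 1 < v -> 0 <= Th v) -> measurable_fun [set: R * R] (sliceH j l Th).
Proof.
by move=> mTh Th0; apply: measurable_sliceI; [exact: measurable_sliceT|exact: sliceT_ge0].
Qed.

Let powk (v : R) : 1 < v -> (v - 1) `^ al * (v - 1) `^ (p - 1) = (v - 1) ^+ k.
Proof.
move=> v1; have v0 : 0 < v - 1 by rewrite subr_gt0.
rewrite -powRD ?(gt_eqF v0) ?implybT// -powR_mulrn ?(ltW v0)//; congr (_ `^ _).
by rewrite /p -natr1; ring.
Qed.

Lemma integral_sliceH0 (l N B : R) (J Th : R -> R) : 1 <= N -> 0 <= B ->
  measurable_fun (`]1, +oo[ : set R) Th -> (forall v, 1 < v -> 0 <= Th v) ->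
  (forall r : R, 0 < r -> (\int[mu]_(u in `](- r)%R, r[) (expR (l * u))%:E = (J r)%:E)%E) ->
  (forall r, 0 < r -> 0 <= J r) ->
  (forall v, 1 < v -> 2 `^ al * (expW v * ((v - 1) ^+ k * Th v) * J (arccosh v)) <= B * hbar s N v) ->
  (\int[mu \x mu]_z sliceH 0 l Th z <= (B * N)%:E)%E.
Proof.
move=> N1 B0 mTh Th0 JE J0 H.
rewrite /sliceH integral_sliceI//; [|exact: measurable_sliceT|exact: sliceT_ge0].
rewrite (_ : (nu - 1 + 0%:R + 1) / 2 = al); last by rewrite /al; field.
rewrite subrK.
apply: le_trans (integral_le_hbar (f := fun v =>
  2 `^ al * (expW v * ((v - 1) ^+ k * Th v) * J (arccosh v))) s0 N1 B0 _).
  rewrite le_eqVlt; apply/orP; left; apply/eqP.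
  apply: eq_integral => v; rewrite inE/= in_itv/= andbT => v1.
  rewrite JE ?arccosh_gt0// -EFinM; congr EFin.
  by rewrite -(powk v1) /sliceT; ring.
move=> v v1; rewrite H// andbT !mulr_ge0 ?powR_ge0 ?expR_ge0 ?Th0 ?J0 ?arccosh_gt0//.
by rewrite exprn_ge0// subr_ge0 ltW.
Qed.

(** For the derivative in [x] the [u]-integral is that of [e^(u / 2)], namely
    [4 sinh (r / 2)], which is a multiple of [sqrt (v - 1)] and completes the exponent
    of [v - 1] to [k + 1]. *)
Lemma integral_sliceH1 (N B : R) (Th : R -> R) : 1 <= N -> 0 <= B ->
  measurable_fun (`]1, +oo[ : set R) Th -> (forall v, 1 < v -> 0 <= Th v) ->
  (forall v, 1 < v -> 4 * 2 `^ al * (expW v * ((v - 1) ^+ k.+1 * Th v)) <= B * hbar s N v) ->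
  (\int[mu \x mu]_z sliceH 1 0 Th z <= (B * N)%:E)%E.
Proof.
move=> N1 B0 mTh Th0 H.
rewrite /sliceH integral_sliceI//; [|exact: measurable_sliceT|exact: sliceT_ge0].
rewrite (_ : (nu - 1 + 1%:R + 1) / 2 = al + 2^-1); last by rewrite /al; field.
rewrite (_ : 0 - al + (al + 2^-1) = 2^-1); last by ring.
apply: le_trans (integral_le_hbar (f := fun v =>
  4 * 2 `^ al * (expW v * ((v - 1) ^+ k.+1 * Th v))) s0 N1 B0 _).
  rewrite le_eqVlt; apply/orP; left; apply/eqP.
  apply: eq_integral => v; rewrite inE/= in_itv/= andbT => v1.
  have r0 := arccosh_gt0 v1; have v0 : 0 < v - 1 by rewrite subr_gt0.
  rewrite integral_expR_sym ?invr_eq0// -EFinM; congr EFin.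
  rewrite [2^-1 * arccosh v]mulrC sinhR_half ?(ltW r0)// coshR_arccosh ?(ltW v1)//.
  rewrite sqrtrM ?(ltW v0)// sqrtrV//.
  rewrite !(@powRD _ _ al 2^-1) ?(gt_eqF v0) ?implybT//; last by rewrite pnatr_eq0 implybT.
  rewrite !powR12_sqrt ?(ltW v0)// exprS -(powk v1) /sliceT.
  have s2 : Num.sqrt 2 != 0 :> R by rewrite gt_eqF// sqrtr_gt0.
  have sv : Num.sqrt (v - 1) * Num.sqrt (v - 1) = v - 1 by rewrite -expr2 sqr_sqrtr// ltW.
  rewrite -[X in _ = 4 * _ * (_ * (X * _ * _))]sv; field.
  exact: s2.
move=> v v1; rewrite H// andbT !mulr_ge0 ?powR_ge0 ?expR_ge0 ?Th0//.
by rewrite exprn_ge0// subr_ge0 ltW.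
Qed.

End WeightedBounds.

(** * The weighted norms *)

Section Assembly.
Context {R : realType}.
Notation mu := (@lebesgue_measure R).
Variables (nu eps : R) (k : nat).
Hypotheses (nu1 : 1 <= nu) (e0 : 0 <= eps) (knu : nu / 2 <= k%:R).

Let al := nu / 2.
Let p := k.+1%:R - al.

Let nu0 : 0 <= nu. Proof. exact: le_trans nu1. Qed.
Let al0 : 0 <= al. Proof. by rewrite divr_ge0. Qed.
Let p1 : 1 <= p. Proof. by rewrite /p -natr1 lerBrDl lerD2r. Qed.
Let mnu : nu / 2 + 1 <= k.+1%:R. Proof. by rewrite -[k.+1%:R]natr1 lerD2r. Qed.

Definition redcst (n i j l : nat) : R :=
  (2 ^+ n) ^+ i * (2 ^+ n) ^+ l * step_cst n * gcst (i + j) (eps * 2 ^+ n).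

Lemma redcst_ge0 n i j l : 0 <= redcst n i j l.
Proof. by rewrite !mulr_ge0 ?exprn_ge0 ?step_cst_ge0 ?gcst_ge0. Qed.

Let D0 := weylcst nu k.+1 k.+1.
Let D1 := weylcst nu k.+1 k.+2.

Let weylcst_ge0 n : (k.+1 <= n)%N -> 0 <= weylcst nu k.+1 n.
Proof.
move=> kn; have b : 0 < betaI (k.+1%:R - nu / 2) n%:R.
  by apply: betaI_gt0; [exact: p1|rewrite (@le_trans _ _ k.+1%:R) ?ler_nat// gerBl].
by rewrite divr_ge0 ?hkabs_ge0// mulr_ge0// ltW.
Qed.

Let D0_ge0 : 0 <= D0. Proof. exact: weylcst_ge0. Qed.
Let D1_ge0 : 0 <= D1. Proof. exact: weylcst_ge0. Qed.

Local Opaque weylcst.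

Lemma dseq_reduce_expW (F : nat -> R -> R) (n i j l : nat) (t D c : R) :
  dseq F -> (forall i c, 1 < c -> 0 <= F i c) -> 0 < t -> 0 <= D ->
  (forall r, 0 < r -> F 0%N (coshR r) * sinhR r ^+ l.+1 <=
     D * (r / Num.sqrt t) ^+ j * expR (- ((r / Num.sqrt t) ^+ 2 / 4))) ->
  1 < c ->
  expW eps t c * arccosh c ^+ i * sinhR (arccosh c) ^+ l * ((c - 1) ^+ n * F n c) <=
  redcst n i j l * D * Num.sqrt t ^+ i.+1 * hbar (Num.sqrt t) (2 ^+ n) c.
Proof. by move=> dF F0 t0; apply: dseq_reduce; rewrite ?sqrtr_gt0. Qed.

Local Opaque redcst.

Let two n : 1 <= 2 ^+ n :> R. Proof. by rewrite exprn_ege1// ler1n. Qed.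

Section FixedTime.
Variable t : R.
Hypothesis t0 : 0 < t.

Let s := Num.sqrt t.
Let a := (4 * t)^-1.
Let s0 : 0 < s. Proof. by rewrite sqrtr_gt0. Qed.
Let s_n0 : s != 0. Proof. by rewrite gt_eqF. Qed.
Let a0 : 0 < a. Proof. by rewrite invr_gt0 mulr_gt0. Qed.
Let aE : 2 * a = (2 * s ^+ 2)^-1.
Proof. by rewrite /a sqr_sqrtr ?(ltW t0)//; field; rewrite gt_eqF. Qed.
Let gE r : (r / s) ^+ 2 / 4 = a * r ^+ 2.
Proof. by rewrite /a -(sqr_sqrtr (ltW t0)) -/s; field; rewrite gt_eqF. Qed.

Let cosh_gt1 (r : R) : 0 < r -> 1 < coshR r.
Proof. by move=> r0; rewrite -[ltLHS]coshR0 ltr_coshR. Qed.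

Let Gs0r (r : R) : 0 < r -> Gs a 0 (coshR r) = expR (- ((r / s) ^+ 2 / 4)).
Proof. by move=> r0; rewrite (Gs0E a0) ?cosh_gt1// arccosh_coshR ?(ltW r0)// gE. Qed.

(** The three inequalities that start [dseq_reduce], for the sequences occurring in the
    bounds of the kernel and of its derivatives. *)
Lemma seed_Gs (r : R) : 0 < r -> seqshift (Gs a) 0 (coshR r) * sinhR r ^+ 1 <=
  (2 * s)^-1 * (r / s) ^+ 1 * expR (- ((r / s) ^+ 2 / 4)).
Proof.
move=> r0; rewrite /seqshift (Gs1E a0) ?cosh_gt1// Gs0r// Aseq0E// aE.
have := sinhR_gt0 r0; move: (sinhR r) (expR _) => S E S0.
rewrite le_eqVlt; apply/orP; left; apply/eqP; field.
by rewrite !gt_eqF.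
Qed.

Lemma seed_KB (r : R) : 0 < r -> KB a 0 (coshR r) * sinhR r ^+ 1 <=
  1 * (r / s) ^+ 0 * expR (- ((r / s) ^+ 2 / 4)).
Proof.
move=> r0; rewrite /KB /= Gs0r// expr0 expr1 !mul1r.
rewrite mulrAC -[leRHS]mul1r ler_wpM2r ?expR_ge0//.
by have := Bseq1_bound r0; rewrite /B0seq mulrC mul1r.
Qed.

Lemma seed_KA (r : R) : 0 < r -> KA a 0 (coshR r) * sinhR r ^+ 2 <=
  s * (r / s) ^+ 1 * expR (- ((r / s) ^+ 2 / 4)).
Proof.
move=> r0; rewrite /KA /= Gs0r// expr1 mulrAC ler_wpM2r ?expR_ge0//.
rewrite (_ : s * (r / s) = r); last by field.
by rewrite mulrC; exact: Aseq1_bound.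
Qed.

Let mGs n : measurable_fun (`]1, +oo[ : set R) (Gs a n).
Proof. exact: measurable_dseq (dseq_Gs a0). Qed.

Let mscale (K : R) (f : R -> R) : measurable_fun (`]1, +oo[ : set R) f ->
  measurable_fun (`]1, +oo[ : set R) (fun v => K * f v).
Proof. by move=> mf; exact: measurable_funM. Qed.

(** The profiles that multiply [e^(- alpha u) x^j e^(l u)] in the bounds: [thK] for the
    kernel, [thX] for [Y1], and [thG], [thB], [thA] for the three terms of [Y0], of which
    only the last carries [e^u]. *)
Definition thK v : R := D0 / s * Gs a k.+1 v.
Definition thX v : R := (1 + al) * D1 / s * Gs a k.+2 v.
Definition thG v : R := D0 / s * (2 * a) * (arccosh v * Gs a k.+1 v).
Definition thB v : R := D0 / s * (2 * a) * k.+1%:R * KB a k v.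
Definition thA v : R := D0 / s * (2 * a) * k.+1%:R * KA a k v.

Let mthK : measurable_fun (`]1, +oo[ : set R) thK. Proof. exact: mscale. Qed.
Let mthX : measurable_fun (`]1, +oo[ : set R) thX. Proof. exact: mscale. Qed.
Let mthG : measurable_fun (`]1, +oo[ : set R) thG.
Proof. by apply: mscale; apply: measurable_funM => //; exact: measurable_arccosh. Qed.
Let mthB : measurable_fun (`]1, +oo[ : set R) thB.
Proof. by apply: mscale; exact: measurable_dseq (dseq_KB a0). Qed.
Let mthA : measurable_fun (`]1, +oo[ : set R) thA.
Proof. by apply: mscale; exact: measurable_dseq (dseq_KA a0). Qed.

Let Ds0 : 0 <= D0 / s. Proof. by rewrite divr_ge0// ltW. Qed.
Let Dsa0 : 0 <= D0 / s * (2 * a). Proof. by rewrite mulr_ge0// mulr_ge0// ltW. Qed.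

Let thK0 v : 1 < v -> 0 <= thK v.
Proof. by move=> v1; apply: mulr_ge0 => //; exact: Gs_ge0. Qed.
Let thX0 v : 1 < v -> 0 <= thX v.
Proof.
move=> v1; apply: mulr_ge0; last exact: Gs_ge0.
by rewrite divr_ge0 ?(ltW s0)// mulr_ge0// addr_ge0//.
Qed.
Let thG0 v : 1 < v -> 0 <= thG v.
Proof.
move=> v1; apply: mulr_ge0 => //; apply: mulr_ge0; last exact: Gs_ge0.
by rewrite arccosh_ge0// ltW.
Qed.
Let thB0 v : 1 < v -> 0 <= thB v.
Proof.
move=> v1; apply: mulr_ge0; last exact: KB_ge0.
by rewrite mulr_ge0.
Qed.
Let thA0 v : 1 < v -> 0 <= thA v.
Proof.
move=> v1; apply: mulr_ge0; last exact: KA_ge0.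
by rewrite mulr_ge0.
Qed.

Let dS := dseq_seqshift (dseq_Gs a0).
Let S0 (i : nat) (c : R) : 1 < c -> 0 <= seqshift (Gs a) i c.
Proof. by move=> c1; exact: Gs_ge0. Qed.

Let two_s : 0 <= (2 * s)^-1. Proof. by rewrite invr_ge0 mulr_ge0// ltW. Qed.

Let H := sliceH nu eps t k.

Definition bK : R := 2 `^ al * D0 * redcst k 1 1 0.
Definition bX : R := 2 * 2 `^ al * (1 + al) * D1 * redcst k.+1 0 1 0.
Definition bG : R := 2 `^ al * D0 * redcst k 2 1 0 / 2.
Definition bB : R := 2 `^ al * D0 * k.+1%:R * redcst k 1 0 0.
Definition bA : R := 2 `^ al * D0 * k.+1%:R * redcst k 0 1 1.

Let pow2 : 0 <= 2 `^ al :> R. Proof. exact: powR_ge0. Qed.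

Lemma bK_ge0 : 0 <= bK.
Proof. exact: (mulr_ge0 (mulr_ge0 pow2 D0_ge0) (redcst_ge0 k 1 1 0)). Qed.

Lemma bX_ge0 : 0 <= bX.
Proof. exact: (mulr_ge0 (mulr_ge0 (mulr_ge0 (mulr_ge0 (ler0n R 2) pow2) (addr_ge0 ler01 al0)) D1_ge0) (redcst_ge0 k.+1 0 1 0)). Qed.

Lemma bG_ge0 : 0 <= bG.
Proof. exact: (divr_ge0 (mulr_ge0 (mulr_ge0 pow2 D0_ge0) (redcst_ge0 k 2 1 0)) (ler0n R 2)). Qed.

Lemma bB_ge0 : 0 <= bB.
Proof. exact: (mulr_ge0 (mulr_ge0 (mulr_ge0 pow2 D0_ge0) (ler0n R k.+1)) (redcst_ge0 k 1 0 0)). Qed.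

Lemma bA_ge0 : 0 <= bA.
Proof. exact: (mulr_ge0 (mulr_ge0 (mulr_ge0 pow2 D0_ge0) (ler0n R k.+1)) (redcst_ge0 k 0 1 1)). Qed.

Let J0 (r : R) : 0 < r -> (\int[mu]_(u in `](- r)%R, r[) (expR (0 * u))%:E = (2 * r)%:E)%E.
Proof. exact: integral_one_sym. Qed.

Let J0_ge0 (r : R) : 0 < r -> 0 <= 2 * r. Proof. by move=> r0; rewrite mulr_ge0// ltW. Qed.

Let cK0 : 0 <= 2 * 2 `^ al * D0 / s :=
  divr_ge0 (mulr_ge0 (mulr_ge0 (ler0n R 2) pow2) D0_ge0) (ltW s0).

Let a20 : 0 <= 2 * a. Proof. by rewrite aE invr_ge0 mulr_ge0 ?sqr_ge0. Qed.

Lemma integral_HK : (\int[mu \x mu]_z H 0 0 thK z <= (bK * 2 ^+ k)%:E)%E.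
Proof.
apply: (integral_sliceH0 t0 (two k) bK_ge0 mthK thK0 J0 J0_ge0) => v v1.
have := dseq_reduce_expW k 1 dS S0 t0 two_s seed_Gs v1.
rewrite -/s /seqshift !expr1 expr0 mulr1 => h.
have := ler_wpM2l cK0 h; rewrite /thK /bK.
move: (hbar _ _ _) (redcst _ _ _ _) (expW _ _ _) (Gs _ _ _) (arccosh v) => h1 h2 h3 h4 h5.
rewrite [X in X <= _ -> _](_ : _ =
  2 `^ al * (h3 * ((v - 1) ^+ k * (D0 / s * h4)) * (2 * h5))); last by ring.
by rewrite [X in _ <= X -> _](_ : _ = 2 `^ al * D0 * h2 * h1)//; field.
Qed.

Lemma integral_HX : (\int[mu \x mu]_z H 1 0 thX z <= (bX / s * 2 ^+ k.+1)%:E)%E.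
Proof.
have b0 : 0 <= bX / s by apply: divr_ge0; [exact: bX_ge0|exact: ltW].
apply: (integral_sliceH1 t0 (two k.+1) b0 mthX thX0) => v v1.
have := dseq_reduce_expW k.+1 0 dS S0 t0 two_s seed_Gs v1.
rewrite -/s /seqshift !expr0 !mulr1 expr1 => h.
have c0 : 0 <= 4 * 2 `^ al * (1 + al) * D1 / s.
  exact: (divr_ge0 (mulr_ge0 (mulr_ge0 (mulr_ge0 (ler0n R 4) pow2) (addr_ge0 ler01 al0)) D1_ge0) (ltW s0)).
have := ler_wpM2l c0 h; rewrite /thX /bX.
move: (hbar _ _ _) (redcst _ _ _ _) (expW _ _ _) (Gs _ _ _) ((v - 1) ^+ _) => h1 h2 h3 h4 h5.
rewrite [X in X <= _ -> _](_ : _ =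
  4 * 2 `^ al * (h3 * (h5 * ((1 + al) * D1 / s * h4)))); last by ring.
by rewrite [X in _ <= X -> _](_ : _ = 2 * 2 `^ al * (1 + al) * D1 * h2 / s * h1)//; field.
Qed.

Lemma integral_HG : (\int[mu \x mu]_z H 0 0 thG z <= (bG / s * 2 ^+ k)%:E)%E.
Proof.
have b0 : 0 <= bG / s by apply: divr_ge0; [exact: bG_ge0|exact: ltW].
apply: (integral_sliceH0 t0 (two k) b0 mthG thG0 J0 J0_ge0) => v v1.
have := dseq_reduce_expW k 2 dS S0 t0 two_s seed_Gs v1.
rewrite -/s /seqshift !expr0 !mulr1 => h.
have c0 := mulr_ge0 cK0 a20.
have := ler_wpM2l c0 h; rewrite /thG /bG aE.
move: (hbar _ _ _) (redcst _ _ _ _) (expW _ _ _) (Gs _ _ _) (arccosh v) => h1 h2 h3 h4 h5.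
rewrite [X in X <= _ -> _](_ : _ =
  2 `^ al * (h3 * ((v - 1) ^+ k * (D0 / s * (2 * s ^+ 2)^-1 * (h5 * h4))) * (2 * h5))); last by ring.
by rewrite [X in _ <= X -> _](_ : _ = 2 `^ al * D0 * h2 / 2 / s * h1)//; field.
Qed.

Lemma integral_HB : (\int[mu \x mu]_z H 0 0 thB z <= (bB / s * 2 ^+ k)%:E)%E.
Proof.
have b0 : 0 <= bB / s by apply: divr_ge0; [exact: bB_ge0|exact: ltW].
apply: (integral_sliceH0 t0 (two k) b0 mthB thB0 J0 J0_ge0) => v v1.
have := dseq_reduce_expW k 1 (dseq_KB a0) (fun i c => KB_ge0 a0 i (c := c)) t0 ler01 seed_KB v1.
rewrite -/s !expr0 !mulr1 expr1 => h.
have c0 := mulr_ge0 (mulr_ge0 cK0 a20) (ler0n R k.+1).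
have := ler_wpM2l c0 h; rewrite /thB /bB aE.
move: (hbar _ _ _) (redcst _ _ _ _) (expW _ _ _) (KB _ _ _) (arccosh v) => h1 h2 h3 h4 h5.
rewrite [X in X <= _ -> _](_ : _ =
  2 `^ al * (h3 * ((v - 1) ^+ k * (D0 / s * (2 * s ^+ 2)^-1 * k.+1%:R * h4)) * (2 * h5))); last by ring.
by rewrite [X in _ <= X -> _](_ : _ = 2 `^ al * D0 * k.+1%:R * h2 / s * h1)//; field.
Qed.

Lemma integral_HA : (\int[mu \x mu]_z H 0 1 thA z <= (bA / s * 2 ^+ k)%:E)%E.
Proof.
have b0 : 0 <= bA / s by apply: divr_ge0; [exact: bA_ge0|exact: ltW].
have J1 (r : R) : 0 < r -> (\int[mu]_(u in `](- r)%R, r[) (expR (1 * u))%:E = (2 * sinhR r)%:E)%E.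
  by move=> r0; rewrite integral_expR_sym ?oner_eq0// mul1r divr1.
have J10 (r : R) : 0 < r -> 0 <= 2 * sinhR r.
  by move=> r0; apply: mulr_ge0 => //; rewrite ltW// sinhR_gt0.
apply: (integral_sliceH0 t0 (two k) b0 mthA thA0 J1 J10) => v v1.
have := dseq_reduce_expW k 0 (dseq_KA a0) (fun i c => KA_ge0 a0 i (c := c)) t0 (ltW s0) seed_KA v1.
rewrite -/s !expr0 !mulr1 !expr1 => h.
have c0 := mulr_ge0 (mulr_ge0 cK0 a20) (ler0n R k.+1).
have := ler_wpM2l c0 h; rewrite /thA /bA aE.
move: (hbar _ _ _) (redcst _ _ _ _) (expW _ _ _) (KA _ _ _) (sinhR _) => h1 h2 h3 h4 h5.
rewrite [X in X <= _ -> _](_ : _ =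
  2 `^ al * (h3 * ((v - 1) ^+ k * (D0 / s * (2 * s ^+ 2)^-1 * k.+1%:R * h4)) * (2 * h5))); last by ring.
by rewrite [X in _ <= X -> _](_ : _ = 2 `^ al * D0 * k.+1%:R * h2 / s * h1)//; field.
Qed.

Let wt (x u : R) := expW eps t (coshrho x u) * x `^ (nu - 1).

Let wt_ge0 x u : 0 <= wt x u. Proof. by rewrite mulr_ge0 ?expR_ge0 ?powR_ge0. Qed.

Let sub1 x u : `]coshrho x u, +oo[%classic `<=` (`]1, +oo[%classic : set R).
Proof.
move=> v /=; rewrite !in_itv/= !andbT; apply: le_lt_trans; exact: coshrho_ge1.
Qed.

Let measurable_weyl (w c : R) (psi : R -> R) : measurable_fun (`]1, +oo[ : set R) psi ->
  measurable_fun (`]1, +oo[ : set R) (fun v => w * ((v - c) `^ (p - 1) * psi v)).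
Proof.
move=> mpsi; apply: mscale; apply: measurable_funM => //; apply: measurable_funTS.
have := @measurable_powR_affine R 1 (- c) (p - 1).
by congr measurable_fun; apply/funext => v; rewrite mul1r.
Qed.

Lemma weighted_le (w X x u : R) (psi : R -> R) : 0 <= w ->
  measurable_fun (`]1, +oo[ : set R) psi -> (forall v, 1 < v -> 0 <= psi v) ->
  (`|X|%:E <= \int[mu]_(v in `]coshrho x u, +oo[)
    ((v - coshrho x u) `^ (p - 1) * psi v)%:E)%E ->
  ((w * `|X|)%:E <= \int[mu]_(v in `]coshrho x u, +oo[)
    (w * ((v - coshrho x u) `^ (p - 1) * psi v))%:E)%E.
Proof.
move=> w0 mpsi psi0 h.
have -> : (\int[mu]_(v in `]coshrho x u, +oo[) (w * ((v - coshrho x u) `^ (p - 1) * psi v))%:E =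
   w%:E * \int[mu]_(v in `]coshrho x u, +oo[) ((v - coshrho x u) `^ (p - 1) * psi v)%:E)%E.
  rewrite -ge0_integralZl//.
  - have m1 := measurable_weyl 1 (coshrho x u) mpsi.
    have := measurable_funS (measurable_itv _) (@sub1 x u) m1.
    move=> m2; apply/measurable_EFinP; move: m2.
    by congr measurable_fun; apply/funext => v; rewrite mul1r.
  - move=> v /sub1/=; rewrite in_itv/= andbT => v1.
    by rewrite lee_fin mulr_ge0 ?powR_ge0 ?psi0.
by rewrite EFinM lee_wpmul2l ?lee_fin.
Qed.

Lemma weighted_heat_kernel x u : 0 <= x ->
  ((wt x u * `|heat_kernel nu t (x, u)|)%:E <= H 0 0 thK (x, u))%E.
Proof.
move=> x0.
apply: le_trans (sliceH_ub nu1 e0 t0 knu 0 0 u x0 mthK thK0).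
have W := heat_kernel_weyl nu0 t0 mnu x u.
apply: (le_trans (weighted_le (wt_ge0 x u) _ _ W)).
- exact: mscale.
- by move=> v v1; rewrite mulr_ge0 ?Gs_ge0// mulr_ge0 ?expR_ge0.
rewrite le_eqVlt; apply/orP; left; apply/eqP; apply: eq_integral => v _.
congr EFin; congr (_ * (_ * _)).
by rewrite -/s -/a -/al -/D0 mul0r expR0 /thK expr0; ring.
Qed.

Lemma weighted_Y1 x u : 0 <= x ->
  ((wt x u * `|Y1 (heat_kernel nu t) (x, u)|)%:E <= H 1 0 thX (x, u))%E.
Proof.
move=> x0.
apply: le_trans (sliceH_ub nu1 e0 t0 knu 1 0 u x0 mthX thX0).
have W := Y1_weyl nu0 t0 mnu x u.
have c0 : 0 <= (1 + al) * D1 / s.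
  exact: (divr_ge0 (mulr_ge0 (addr_ge0 ler01 al0) D1_ge0) (ltW s0)).
apply: (le_trans (weighted_le (wt_ge0 x u) _ _ W)).
- exact: mscale.
- move=> v v1; apply: mulr_ge0; last exact: Gs_ge0.
  by apply: mulr_ge0 => //; apply: mulr_ge0; [exact: c0|exact: expR_ge0].
rewrite le_eqVlt; apply/orP; left; apply/eqP; apply: eq_integral => v _.
congr EFin; congr (_ * (_ * _)).
by rewrite -/s -/a -/al -/D1 mul0r expR0 /thX expr1 (ger0_norm x0); ring.
Qed.

Lemma weighted_Y0 x u : 0 <= x ->
  ((wt x u * `|Y0 (heat_kernel nu t) (x, u)|)%:E <=
   H 0 0 thG (x, u) + H 0 0 thB (x, u) + H 0 1 thA (x, u))%E.
Proof.
move=> x0.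
have HG := sliceH_ub nu1 e0 t0 knu 0 0 u x0 mthG thG0.
have HB := sliceH_ub nu1 e0 t0 knu 0 0 u x0 mthB thB0.
have HA := sliceH_ub nu1 e0 t0 knu 0 1 u x0 mthA thA0.
apply: le_trans (leeD (leeD HG HB) HA).
pose f l (Th : R -> R) v := wt x u * ((v - coshrho x u) `^ (p - 1) *
   (expR (- (al * u)) * x ^+ 0 * expR (l * u) * Th v)).
have mf l Th : measurable_fun (`]1, +oo[ : set R) Th ->
    measurable_fun (`]coshrho x u, +oo[ : set R) (EFin \o f l Th).
  move=> mTh; apply/measurable_EFinP.
  by apply: (measurable_funS (measurable_itv _) (@sub1 x u)); apply: measurable_weyl; exact: mscale.
have f0 l (Th : R -> R) v : (forall v, 1 < v -> 0 <= Th v) ->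
    [set` `]coshrho x u, +oo[%R] v -> (0 <= (f l Th v)%:E)%E.
  move=> Th0 /sub1/=; rewrite in_itv/= andbT => v1; rewrite lee_fin.
  apply: mulr_ge0 => //; apply: mulr_ge0; first exact: powR_ge0.
  by apply: mulr_ge0; [rewrite !mulr_ge0 ?expR_ge0|exact: Th0].
have W := Y0_weyl nu0 t0 mnu x u.
apply: (le_trans (weighted_le (wt_ge0 x u) _ _ W)).
- apply: mscale; apply: measurableT_comp => //.
  exact: measurable_dseq (dseq_Eseq a0 (expR u)).
- by move=> v v1; apply: mulr_ge0 => //; apply: mulr_ge0 => //; exact: expR_ge0.
have -> : (\int[mu]_(v in `]coshrho x u, +oo[) (f 0 thG v)%:E +
    \int[mu]_(v in `]coshrho x u, +oo[) (f 0 thB v)%:E +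
    \int[mu]_(v in `]coshrho x u, +oo[) (f 1 thA v)%:E =
    \int[mu]_(v in `]coshrho x u, +oo[) ((f 0 thG v)%:E + (f 0 thB v)%:E + (f 1 thA v)%:E))%E.
  rewrite ge0_integralD//; last 4 first.
  - by move=> v hv; apply: adde_ge0; exact: f0.
  - by apply: emeasurable_funD; exact: mf.
  - by move=> v hv; exact: f0.
  - exact: mf.
  rewrite ge0_integralD//.
  - by move=> v hv; exact: f0.
  - exact: mf.
  - by move=> v hv; exact: f0.
  - exact: mf.
have v1_of (v : R) : [set` `]coshrho x u, +oo[%R] v -> 1 < v.
  by move=> /sub1/=; rewrite in_itv/= andbT.
apply: le_ge0_integral => v cv; have v1 := v1_of v cv.
  rewrite lee_fin; apply: mulr_ge0 => //; apply: mulr_ge0; first exact: powR_ge0.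
  by apply: mulr_ge0 => //; apply: mulr_ge0 => //; exact: expR_ge0.
(* This makes [horocycle_le] applicable: the distance dominates [|u|]. *)
have uv : coshR u <= v.
  move: cv; rewrite /= in_itv/= andbT => cv; apply: le_trans (ltW cv).
  by rewrite lerDl divr_ge0// mulr_ge0 ?expR_ge0 ?sqr_ge0.
rewrite -!EFinD lee_fin /f -!mulrDr ler_wpM2l// ler_wpM2l ?powR_ge0//.
rewrite -/s -/a -/al -/D0 expr0 mulr1 mul0r mul1r expR0 mulr1.
have E1 := Eseq_ub a0 k (expR_ge0 u) v1.
have E2 := ler_wpM2r (Gs_ge0 a0 k.+1 v1) (horocycle_le v1 uv).
have c0 := mulr_ge0 Ds0 (expR_ge0 (- (al * u))).
apply: (le_trans (ler_wpM2l c0 E1)).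
have c1 := mulr_ge0 c0 a20.
have E3 := ler_wpM2l c1 E2.
rewrite /thG /thB /thA.
move: E3; move: (`|v - expR u| * Aseq 0 v * Gs a k.+1 v) (arccosh v * Gs a k.+1 v).
move: (KB a k v) (KA a k v) (expR (- (al * u))) (expR u) (D0 / s) (2 * a) => b1 b2 b3 b4 b5 b6 b7 b8 h.
rewrite [leLHS](_ : _ = b5 * b3 * b6 * b7 + b3 * b5 * b6 * k.+1%:R * (b1 + b4 * b2)); last by ring.
rewrite [leRHS](_ : _ = b5 * b3 * b6 * b8 + b3 * b5 * b6 * k.+1%:R * (b1 + b4 * b2)); last by ring.
by rewrite lerD2r.
Qed.

Let mH j l (Th : R -> R) : measurable_fun (`]1, +oo[ : set R) Th ->
  (forall v : R, 1 < v -> 0 <= Th v) -> measurable_fun [set: R * R] (H j l Th).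
Proof. exact: measurable_sliceH. Qed.

Let H_ge0 j l (Th : R -> R) z : (forall v : R, 1 < v -> 0 <= Th v) -> (0 <= H j l Th z)%E.
Proof. exact: sliceH_ge0. Qed.

Let rhoE x u : expR (eps * rho (x, u) / Num.sqrt t) = expW eps t (coshrho x u).
Proof. by []. Qed.

Lemma L1norm_heat_kernel :
  (L1norm nu (fun z => (expR (eps * rho z / Num.sqrt t) * heat_kernel nu t z)%R)
   <= (bK * 2 ^+ k)%:E)%E.
Proof.
apply: le_trans integral_HK; rewrite /L1norm integral_mkcond.
apply: le_ge0_integral => -[x u] _; rewrite patchE; case: ifPn => //; last by move=> _; exact: H_ge0.
- by rewrite lee_fin mulr_ge0// powR_ge0.
rewrite inE /Gset/= => x0; apply: le_trans (weighted_heat_kernel u x0).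
by rewrite rhoE lee_fin normrM (ger0_norm (expR_ge0 _)) /wt; rewrite mulrAC.
Qed.

Lemma L1norm_grad_heat_kernel :
  (L1norm nu (fun z => (expR (eps * rho z / Num.sqrt t) * grad_norm (heat_kernel nu t) z)%R)
   <= ((bG * 2 ^+ k + bB * 2 ^+ k + bA * 2 ^+ k + bX * 2 ^+ k.+1) / s)%:E)%E.
Proof.
pose HG := H 0 0 thG; pose HB := H 0 0 thB; pose HA := H 0 1 thA; pose HX := H 1 0 thX.
have mHG : measurable_fun [set: R * R] HG by exact: mH.
have mHB : measurable_fun [set: R * R] HB by exact: mH.
have mHA : measurable_fun [set: R * R] HA by exact: mH.
have mHX : measurable_fun [set: R * R] HX by exact: mH.
have HG0 z : (0 <= HG z)%E by exact: H_ge0.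
have HB0 z : (0 <= HB z)%E by exact: H_ge0.
have HA0 z : (0 <= HA z)%E by exact: H_ge0.
have HX0 z : (0 <= HX z)%E by exact: H_ge0.
have HGB0 z : (0 <= HG z + HB z)%E by exact: adde_ge0.
have HGBA0 z : (0 <= HG z + HB z + HA z)%E by exact: adde_ge0.
apply: (@le_trans _ _ (\int[(mu \x mu)%E]_z (HG z + HB z + HA z + HX z))%E).
  rewrite /L1norm integral_mkcond.
  apply: le_ge0_integral => -[x u] _; rewrite patchE; case: ifPn => //; last by move=> _; exact: (adde_ge0 (adde_ge0 (adde_ge0 (HG0 _) (HB0 _)) (HA0 _)) (HX0 _)).
  - by rewrite lee_fin mulr_ge0// powR_ge0.
  rewrite inE /Gset/= => x0.
  apply: le_trans (leeD (weighted_Y0 u x0) (weighted_Y1 u x0)).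
  rewrite -EFinD lee_fin rhoE normrM (ger0_norm (expR_ge0 _)) mulrAC -mulrDr.
  apply: (ler_wpM2l (wt_ge0 x u)).
  rewrite /grad_norm ger0_norm ?sqrtr_ge0//.
  set y0 := Y0 _ _; set y1 := Y1 _ _.
  rewrite -[leRHS]ger0_norm ?addr_ge0// -sqrtr_sqr ler_wsqrtr//.
  rewrite sqrrD !real_normK ?num_real// lerD2r lerDl.
  by rewrite mulrn_wge0// mulr_ge0.
rewrite ge0_integralD//; last by apply: emeasurable_funD => //; exact: emeasurable_funD.
rewrite ge0_integralD//; last exact: emeasurable_funD.
rewrite ge0_integralD//.
apply: le_trans (leeD (leeD (leeD integral_HG integral_HB) integral_HA) integral_HX) _.
rewrite -!EFinD lee_fin le_eqVlt; apply/orP; left; apply/eqP.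
by ring.
Qed.

End FixedTime.

End Assembly.

Theorem proposition4p4 (R : realType) (nu eps : R) (hnu : 1 <= nu)
    (heps : 0 <= eps) :
  exists C : R, forall t : R, 0 < t ->
    (L1norm nu (fun p => (expR (eps * rho p / Num.sqrt t) *
                          heat_kernel nu t p)%R) <= C%:E)%E /\
    (L1norm nu (fun p => (expR (eps * rho p / Num.sqrt t) *
                          grad_norm (heat_kernel nu t) p)%R)
       <= (C * t `^ (- (1 / 2)))%:E)%E.
Proof.
(* An integer above [nu / 2]: the Weyl integral raises the order [nu / 2] to
   [k + 1]. *)
pose k := (Num.truncn (nu / 2)).+1.
have knu : nu / 2 <= k%:R by exact/ltW/truncnS_gt.
pose C1 := bK nu eps k * 2 ^+ k.
pose C2 := bG nu eps k * 2 ^+ k + bB nu eps k * 2 ^+ k + bA nu eps k * 2 ^+ k +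
  bX nu eps k * 2 ^+ k.+1.
exists (Num.max C1 C2) => t t0; split.
  apply: (le_trans (L1norm_heat_kernel hnu heps knu t0)).
  by rewrite lee_fin le_max lexx.
apply: (le_trans (L1norm_grad_heat_kernel hnu heps knu t0)).
rewrite lee_fin div1r powRN powR12_sqrt ?(ltW t0)//.
by rewrite ler_wpM2r ?invr_ge0 ?sqrtr_ge0// le_max lexx orbT.
Qed.
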